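(* The singular locus of the variety of reductions $Red(4)$ is the disjoint union $Red(4)_{sing}=\mathcal{O}'_{min}\coprod\mathcal{O}''_{min}$.
   Context: Everything is over $\mathbb{C}$. $Red(4)$ is the Zariski closure, in the Grassmannian $G(3,\mathfrak{sl}_4)$ of $3$-dimensional linear subspaces of $\mathfrak{sl}_4$, of the set of Cartan subalgebras of $\mathfrak{sl}_4$ (the subalgebras of traceless matrices diagonal with respect to some basis of $\mathbb{C}^4$), with its reduced structure. For a linear subspace $V\subset\mathbb{C}^4$ let $\mathfrak{a}(V)=\{x\in\mathfrak{gl}_4 : \mathrm{Im}(x)\subset V\subset \mathrm{Ker}(x)\}$. Then $\mathcal{O}'_{min}=\{\mathfrak{a}(V): \dim V=1\}\simeq\mathbb{P}^{3}$ and $\mathcal{O}''_{min}=\{\mathfrak{a}(V):\dim V=3\}\simeq\check{\mathbb{P}}^{3}$; these are closed $PGL_4$-orbits in $Red(4)$. *)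

(* Defs.v *)
From HB Require Import structures.
From mathcomp Require Import all_boot all_order all_algebra.
From mathcomp Require Import mpoly complex boolp classical_sets reals.

Set Implicit Arguments.
Unset Strict Implicit.
Unset Printing Implicit Defensive.

Import GRing.Theory.
Local Open Scope classical_set_scope.
Local Open Scope ring_scope.

(* Varieties are handled in the classical language of reduced varieties over an
   algebraically closed field K: a variety is its set of K-points, and the
   functions on it are the restrictions of polynomials. *)

Section Grassmannian.
Variables (K : fieldType) (vT : vectType K) (U : {vspace vT}) (k : nat).

Definition grassmannian : set {vspace vT} :=
  [set W | (W <= U)%VS /\ \dim W = k].

(* When b ++ c is a basis of U, the map A |-> chart b c A identifies the affine
   space of k x m matrices with the open set of those W that are complementary
   to <<c>> in U; A is the matrix of the linear map <<b>> -> <<c>> of which W is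
   the graph, and A = 0 gives <<b>>. *)
Definition chart (m : nat) (b : k.-tuple vT) (c : m.-tuple vT)
    (A : 'M[K]_(k, m)) : {vspace vT} :=
  <<[seq (tnth b i + \sum_(j < m) A i j *: tnth c j)%R | i : 'I_k]>>%VS.

Definition mxeval (m : nat) (p : {mpoly K[k * m]}) (A : 'M[K]_(k, m)) : K :=
  p.@[fun l => mxvec A 0 l].

Definition zariski_closed (Z : set {vspace vT}) : Prop :=
  Z `<=` grassmannian /\
  forall (m : nat) (b : k.-tuple vT) (c : m.-tuple vT), basis_of U (b ++ c) ->
    exists I : set {mpoly K[k * m]},
      forall A, Z (chart b c A) <-> (forall p, I p -> mxeval p A = 0).

Definition zariski_closure (X : set {vspace vT}) : set {vspace vT} :=
  [set W | grassmannian W /\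
           forall Z, zariski_closed Z -> X `<=` Z -> Z W].

Definition irreducible_closed (Z : set {vspace vT}) : Prop :=
  [/\ zariski_closed Z, Z !=set0 &
      forall Z1 Z2, zariski_closed Z1 -> zariski_closed Z2 ->
        Z `<=` Z1 `|` Z2 -> Z `<=` Z1 \/ Z `<=` Z2].

(* Z 0 < Z 1 < ... < Z d; these chains correspond to the chains of prime ideals
   of length d in the local ring of X at x. *)
Definition irreducible_chain (X : set {vspace vT}) (x : {vspace vT}) (d : nat)
    (Z : nat -> set {vspace vT}) : Prop :=
  (forall i, (i <= d)%N -> [/\ irreducible_closed (Z i), Z i `<=` X & Z i x]) /\
  (forall i, (i < d)%N -> Z i `<` Z i.+1).

(* The Krull dimension of the local ring of X at x is d. *)
Definition local_dim (X : set {vspace vT}) (x : {vspace vT}) (d : nat) : Prop :=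
  (exists Z, irreducible_chain X x d Z) /\
  (forall e Z, irreducible_chain X x e Z -> (e <= d)%N).

(* The Zariski tangent space of X at <<b>>, in the coordinates of the chart
   centred at <<b>>. Quantifying over all polynomials vanishing on X is what
   gives X its reduced structure. *)
Definition tangent_space (X : set {vspace vT}) (m : nat)
    (b : k.-tuple vT) (c : m.-tuple vT) : set 'M[K]_(k, m) :=
  [set D | forall p : {mpoly K[k * m]},
      (forall A, X (chart b c A) -> mxeval p A = 0) ->
      \sum_(l < k * m) mxeval (mderiv l p) 0 * mxvec D 0 l = 0].

(* The Zariski tangent space of X at x has dimension d; the choice of a chart
   centred at x is immaterial. *)
Definition tangent_dim (X : set {vspace vT}) (x : {vspace vT}) (d : nat) : Prop :=
  exists (m : nat) (b : k.-tuple vT) (c : m.-tuple vT),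
    [/\ basis_of U (b ++ c), <<b>>%VS = x &
        exists E : {vspace 'M[K]_(k, m)},
          [set D | D \in E] = tangent_space X b c /\ \dim E = d].

(* The local ring of X at x is regular. *)
Definition nonsingular (X : set {vspace vT}) (x : {vspace vT}) : Prop :=
  exists d, local_dim X x d /\ tangent_dim X x d.

Definition singular_locus (X : set {vspace vT}) : set {vspace vT} :=
  [set x | X x /\ ~ nonsingular X x].

End Grassmannian.

Section Reductions.
Variables (K : fieldType) (n : nat).

Definition sl : {vspace 'M[K]_n} := lker (linfun (@mxtrace K n : 'M[K]_n -> K^o)).

Lemma mem_sl (x : 'M[K]_n) : (x \in sl) = (\tr x == 0).
Proof. by rewrite memv_ker lfunE. Qed.

(* Vectors are columns; the columns of P are the diagonalizing basis. *)
Definition cartan_subalgebra : set {vspace 'M[K]_n} :=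
  [set W : {vspace 'M[K]_n} | exists2 P : 'M[K]_n, P \in unitmx &
     forall x, (x \in W) = (x \in sl) && is_diag_mx (invmx P *m x *m P)].

Definition Red : set {vspace 'M[K]_n} :=
  zariski_closure sl n.-1 cartan_subalgebra.

Definition Red_sing : set {vspace 'M[K]_n} := singular_locus sl n.-1 Red.

Definition frak_a (V : {vspace 'cV[K]_n}) : set 'M[K]_n :=
  [set x | let f : 'End('cV[K]_n) := linfun (mulmx x) in
           (limg f <= V)%VS /\ (V <= lker f)%VS].

Definition Omin (r : nat) : set {vspace 'M[K]_n} :=
  [set W : {vspace 'M[K]_n} | exists2 V : {vspace 'cV[K]_n}, \dim V = r &
     [set x | x \in W] = frak_a V].

End Reductions.

Arguments cartan_subalgebra K n : clear implicits.
Arguments Red K n : clear implicits.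
Arguments Red_sing K n : clear implicits.
Arguments Omin K n r : clear implicits.

(* Main.v *)
(* Let W0 be spanned by the matrix units E13, E14, E24, and work in the affine
   chart of the Grassmannian centred at W0. There the equations [x, y] = 0 on the
   three basis matrices can be solved polynomially for all coordinates but
   twelve, and a generic solution consists of simultaneously diagonalizable
   matrices; hence Red(4) is, in this chart, the graph of a polynomial map on
   C^12. This gives smoothness there, and it bounds the length of chains of
   irreducible closed subsets of Red(4) by 12, at every point, because functions
   on Red(4) become rational functions of twelve parameters.

   A point W of Red(4) is a commuting space. Looking at the orbits A v and
   f A of the algebra A = C 1 + W, either some conjugate of W lies in the chart,
   or all elements of W have a common kernel of dimension 3 or a common image of
   dimension 1, that is, W = a(V) with dim V = 3 or 1.

   Finally, the points a(V) with dim V = 3 are conjugate to each other, and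
   transposition exchanges them with the case dim V = 1. The regular
   representations of the algebras with unit e_3 and e_i e_j = 0 (i <> j),
   e_i^2 = s_i e_i, for s near 0, are Cartan subalgebras degenerating to a(V);
   together with their conjugates they have 13 linearly independent tangent
   directions there, one more than the dimension. *)

Require Import Defs.
From mathcomp Require Import all_boot all_order all_algebra.
From mathcomp Require Import mpoly complex boolp classical_sets reals.
From mathcomp Require Import separable zify ring.

Set Implicit Arguments.
Unset Strict Implicit.
Unset Printing Implicit Defensive.

Import Order.TTheory GRing.Theory Num.Theory.
Local Open Scope ring_scope.

(** * Polynomial functions *)

(** No dimension theory is presupposed, and this shapes the proof. [nonsingular] asks for one number
    that is both the local and the tangent dimension. A point is therefore singular once chains
    through it have length at most 12 and its tangent dimension is at least 13; the local dimension
    at a(V) never has to be computed.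

    The bound 12 rests on two facts about algebraic independence. Functions separating the
    consecutive members of a chain are independent on the last member, while a count of monomials
    against grid points makes any 13 rational functions of 12 parameters dependent.

    Closures are not described by equations. They are handled through polynomial curves of tuples of
    vectors: a closed condition that holds for all but finitely many parameters passes to the span
    at 0, and the linear coefficient of the curve gives a tangent vector there. Denominators are
    avoided throughout by using adjugates in place of inverses.

    The centre E13, E14, E24 is chosen because a diagonal one-parameter group contracts the whole
    chart to it. All coordinates then have positive weight, which makes the commutation equations
    triangular. *)

Section FunctionAlgebras.
Variable K : numFieldType.

Lemma mpoly_ring_ind n (P : {mpoly K[n]} -> Prop) :
  (forall c, P c%:MP) -> (forall i, P 'X_i) ->
  (forall p q, P p -> P q -> P (p + q)) ->
  (forall p q, P p -> P q -> P (p * q)) -> forall p, P p.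
Proof.
move=> PC PX PD PM p; rewrite (mpolyE p).
have P1 : P 1 by rewrite -mpolyC1; apply: PC.
apply: (big_ind P) => [|//|m _]; first by rewrite -mpolyC0; apply: PC.
rewrite -mul_mpolyC; apply: (PM _ _ (PC _)).
rewrite mpolyXE_id; apply: (big_ind P) => // i _.
by elim: (m i) => [|k IH]; rewrite ?expr0 // exprS; apply: PM.
Qed.

(** A common interface for four notions of polynomial function: in one variable ([poly1fun]), in the
    entries of a matrix ([mxfun]), in [N] variables ([mpolyfun]), and of bounded degree in each
    variable separately ([polyfun]). Determinants, adjugates and compositions are thus treated
    once. *)
Record funalg (T : Type) (S : (T -> K) -> Prop) : Prop := FunAlg {
  funalgC : forall c, S (fun=> c);
  funalgD : forall f g, S f -> S g -> S (fun t => f t + g t);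
  funalgM : forall f g, S f -> S g -> S (fun t => f t * g t) }.

Section Closure.
Variables (T : Type) (S : (T -> K) -> Prop).
Hypothesis SA : funalg S.

Lemma funalg_ext f g : f =1 g -> S f -> S g.
Proof. by move=> /funext ->. Qed.

Lemma funalgN f : S f -> S (fun t => - f t).
Proof.
move=> Sf; apply: (funalg_ext _ (funalgM SA (funalgC SA (-1)) Sf)) => t.
by rewrite mulN1r.
Qed.

Lemma funalgB f g : S f -> S g -> S (fun t => f t - g t).
Proof. by move=> Sf Sg; apply: (funalgD SA Sf (funalgN Sg)). Qed.

Lemma funalgX f n : S f -> S (fun t => f t ^+ n).
Proof.
move=> Sf; elim: n => [|n IH]; first exact: (funalgC SA 1).
by apply: (funalg_ext _ (funalgM SA Sf IH)) => t; rewrite exprS.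
Qed.

Lemma funalg_sum I (r : seq I) (P : pred I) (f : I -> T -> K) :
  (forall i, P i -> S (f i)) -> S (fun t => \sum_(i <- r | P i) f i t).
Proof.
move=> Sf; elim: r => [|i r IH].
  by apply: (funalg_ext _ (funalgC SA 0)) => t; rewrite big_nil.
case: (boolP (P i)) => Pi; last first.
  by apply: (funalg_ext _ IH) => t; rewrite big_cons (negPf Pi).
by apply: (funalg_ext _ (funalgD SA (Sf i Pi) IH)) => t; rewrite big_cons Pi.
Qed.

Lemma funalg_prod I (r : seq I) (P : pred I) (f : I -> T -> K) :
  (forall i, P i -> S (f i)) -> S (fun t => \prod_(i <- r | P i) f i t).
Proof.
move=> Sf; elim: r => [|i r IH].
  by apply: (funalg_ext _ (funalgC SA 1)) => t; rewrite big_nil.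
case: (boolP (P i)) => Pi; last first.
  by apply: (funalg_ext _ IH) => t; rewrite big_cons (negPf Pi).
by apply: (funalg_ext _ (funalgM SA (Sf i Pi) IH)) => t; rewrite big_cons Pi.
Qed.

Lemma funalg_det n (M : T -> 'M[K]_n) :
  (forall i j, S (fun t => M t i j)) -> S (fun t => \det (M t)).
Proof.
move=> SM; rewrite /determinant; apply: funalg_sum => s _.
by apply: (funalgM SA (funalgC SA _)); apply: funalg_prod.
Qed.

Lemma funalg_adj n (M : T -> 'M[K]_n) i j :
  (forall i j, S (fun t => M t i j)) -> S (fun t => (\adj (M t)) i j).
Proof.
move=> SM.
apply: (@funalg_ext (fun t => (-1) ^+ (j + i) * \det (row' j (col' i (M t))))).
  by move=> t; rewrite mxE.
apply: (funalgM SA (funalgC SA _)); apply: funalg_det => a b.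
by apply: (@funalg_ext (fun t => M t (lift j a) (lift i b))) => // t; rewrite !mxE.
Qed.

Lemma funalg_mulmx m n p (A : T -> 'M[K]_(m, n)) (B : T -> 'M[K]_(n, p)) i j :
  (forall i j, S (fun t => A t i j)) -> (forall i j, S (fun t => B t i j)) ->
  S (fun t => (A t *m B t) i j).
Proof.
move=> SAA SB; apply: (@funalg_ext (fun t => \sum_k A t i k * B t k j)).
  by move=> t; rewrite mxE.
by apply: funalg_sum => k _; apply: (funalgM SA).
Qed.

Lemma funalg_meval n (a : 'I_n -> T -> K) (p : {mpoly K[n]}) :
  (forall l, S (a l)) -> S (fun t => p.@[fun l => a l t]).
Proof.
move=> Sa; elim/mpoly_ring_ind: p => [c|i|p q Sp Sq|p q Sp Sq].
- by apply: (funalg_ext _ (funalgC SA c)) => t; rewrite mevalC.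
- by apply: (funalg_ext _ (Sa i)) => t; rewrite mevalXU.
- by apply: (funalg_ext _ (funalgD SA Sp Sq)) => t; rewrite mevalD.
- by apply: (funalg_ext _ (funalgM SA Sp Sq)) => t; rewrite mevalM.
Qed.

(** Clears the denominators of [p] at the fractions [B l / d]. One extra factor [d] makes [f] vanish
    wherever [d] does, so its zeros also include the points at which the fractions have no
    meaning. *)
Lemma funalg_homog n (d : T -> K) (B : 'I_n -> T -> K) (p : {mpoly K[n]}) :
  S d -> (forall l, S (B l)) ->
  exists e f, [/\ S f, forall t, d t = 0 -> f t = 0 &
    forall t, d t != 0 -> f t = d t ^+ e * p.@[fun l => B l t / d t]].
Proof.
move=> Sd SB; suff: exists e f, S f /\
    forall t, d t != 0 -> f t = d t ^+ e * p.@[fun l => B l t / d t].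
  move=> [e [f [Sf Ef]]]; exists e.+1, (fun t => d t * f t); split.
  - exact: (funalgM SA).
  - by move=> t ->; rewrite mul0r.
  - by move=> t dt; rewrite Ef // mulrA -exprS.
elim/mpoly_ring_ind: p => [c|i|p q [e [f [Sf Ef]]] [e' [g [Sg Eg]]]|
                           p q [e [f [Sf Ef]]] [e' [g [Sg Eg]]]].
- exists 0%N, (fun=> c); split; first exact: (funalgC SA).
  by move=> t _; rewrite expr0 mul1r mevalC.
- exists 1%N, (B i); split=> // t dt.
  by rewrite expr1 mevalXU mulrC divfK.
- exists (e + e')%N, (fun t => d t ^+ e' * f t + d t ^+ e * g t); split.
    by apply: (funalgD SA); apply: (funalgM SA) => //; apply: funalgX.
  by move=> t dt; rewrite Ef // Eg // mevalD exprD; ring.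
- exists (e + e')%N, (fun t => f t * g t); split; first exact: (funalgM SA).
  by move=> t dt; rewrite Ef // Eg // mevalM exprD; ring.
Qed.

End Closure.

Definition poly1fun (f : K -> K) := exists p : {poly K}, forall t, f t = p.[t].

Lemma poly1fun_alg : funalg poly1fun.
Proof.
split=> [c|f g [p pf] [q qg]|f g [p pf] [q qg]].
- by exists c%:P => t; rewrite hornerC.
- by exists (p + q) => t; rewrite hornerD pf qg.
- by exists (p * q) => t; rewrite hornerM pf qg.
Qed.

Definition mxfun k m (f : 'M[K]_(k, m) -> K) :=
  exists p : {mpoly K[k * m]}, forall A, f A = mxeval p A.

Lemma mxfun_alg k m : funalg (@mxfun k m).
Proof.
split=> [c|f g [p pf] [q qg]|f g [p pf] [q qg]].
- by exists c%:MP => t; rewrite /mxeval mevalC.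
- by exists (p + q) => t; rewrite /mxeval mevalD pf qg.
- by exists (p * q) => t; rewrite /mxeval mevalM pf qg.
Qed.

Lemma mxfun_entry k m i j : mxfun (fun A : 'M[K]_(k, m) => A i j).
Proof.
by exists 'X_(mxvec_index i j) => A; rewrite /mxeval mevalXU mxvecE.
Qed.

Lemma mxeval_fun T (S : (T -> K) -> Prop) k m (p : {mpoly K[k * m]})
    (A : T -> 'M[K]_(k, m)) :
  funalg S -> (forall i j, S (fun t => A t i j)) -> S (fun t => mxeval p (A t)).
Proof.
move=> SA SE; apply: (funalg_meval SA) => l.
by case/mxvec_indexP: l => i j; apply: (funalg_ext _ (SE i j)) => t; rewrite mxvecE.
Qed.

Lemma poly_eq0_of_roots (p : {poly K}) : (forall t, p.[t] = 0) -> p = 0.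
Proof.
move=> p0; apply/eqP/negPn/negP => pn0.
have := @max_poly_roots _ p [seq n%:R | n <- iota 0 (size p)] pn0.
rewrite size_map size_iota ltnn => H; suff: false by [].
apply: H; first by apply/allP => x _; apply/eqP; apply: p0.
rewrite map_inj_uniq ?iota_uniq // => a b /eqP.
by rewrite eqr_nat => /eqP.
Qed.

(** This is how statements valid at generic points of a curve become polynomial identities. *)
Lemma poly_eq0_generic (p q : {poly K}) :
  q != 0 -> (forall t, q.[t] != 0 -> p.[t] = 0) -> p = 0.
Proof.
move=> q0 H; have: p * q = 0.
  apply: poly_eq0_of_roots => t; rewrite hornerM.
  have [->|qt] := eqVneq q.[t] 0; first by rewrite mulr0.
  by rewrite H // mul0r.
by move=> /eqP; rewrite mulf_eq0 (negPf q0) orbF => /eqP.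
Qed.

Lemma poly_ext (p q : {poly K}) : (forall t, p.[t] = q.[t]) -> p = q.
Proof.
move=> H; apply/eqP; rewrite -subr_eq0; apply/eqP/poly_eq0_of_roots => t.
by rewrite hornerD hornerN H subrr.
Qed.

End FunctionAlgebras.

(** * Derivatives along polynomial and rational curves *)

Section Derivatives.
Variable K : numFieldType.

Let mnm_subxx n (u : 'X_{1..n}) : (u - u)%MM = 0%MM.
Proof. by apply/mnmP => i; rewrite mnmBE mnm0E subnn. Qed.

Lemma meval_deriv n (a : 'I_n -> {poly K}) (p : {mpoly K[n]}) t0 :
  exists Q : {poly K}, (forall t, Q.[t] = p.@[fun l => (a l).[t]]) /\
    Q^`().[t0] = \sum_l (mderiv l p).@[fun l => (a l).[t0]] * (a l)^`().[t0].
Proof.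
elim/mpoly_ring_ind: p => [c|i|p q [P [EP DP]] [Q [EQ DQ]]|p q [P [EP DP]] [Q [EQ DQ]]].
- exists c%:P; split=> [t|]; first by rewrite hornerC mevalC.
  by rewrite derivC horner0 big1 // => l _; rewrite mderivC meval0 mul0r.
- exists (a i); split=> [t|]; first by rewrite mevalXU.
  rewrite (bigD1 i) //= big1 ?addr0 => [|l li]; rewrite mderivX mevalZ mnm1E.
    by rewrite eqxx mul1r mnm_subxx mpolyX0 meval1 mul1r.
  by rewrite eq_sym (negPf li) !mul0r.
- exists (P + Q); split=> [t|]; first by rewrite hornerD mevalD EP EQ.
  rewrite derivD hornerD DP DQ -big_split; apply: eq_bigr => l _.
  by rewrite mderivD mevalD mulrDl.
- exists (P * Q); split=> [t|]; first by rewrite hornerM mevalM EP EQ.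
  rewrite derivM hornerD !hornerM DP DQ EP EQ mulr_suml mulr_sumr -big_split.
  by apply: eq_bigr => l _; rewrite mderivM mevalD !mevalM /=; ring.
Qed.

(* [p] is expanded to first order along [B / d], whose value at [0] is [0]. *)
Lemma homog_deriv n (d : {poly K}) (B : 'I_n -> {poly K}) (p : {mpoly K[n]}) :
  (forall l, (B l).[0] = 0) ->
  exists e (Q : {poly K}),
  [/\ forall t, d.[t] != 0 ->
        Q.[t] = d.[t] ^+ e * (p.@[fun l => (B l).[t] / d.[t]] - p.@[fun=> 0]),
      Q.[0] = 0 &
      d.[0] * Q^`().[0] =
      d.[0] ^+ e * \sum_l (mderiv l p).@[fun=> 0] * (B l)^`().[0]].
Proof.
move=> B0.
elim/mpoly_ring_ind: p => [c|i|p q [e [P [EP P0 DP]]] [f [Q [EQ Q0 DQ]]]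
                         |p q [e [P [EP P0 DP]]] [f [Q [EQ Q0 DQ]]]].
- exists 0%N, 0; split=> [t _||]; rewrite ?horner0 ?mevalC ?subrr ?mulr0 //.
  rewrite deriv0 horner0 mulr0 big1 ?mulr0 // => l _.
  by rewrite mderivC meval0 mul0r.
- exists 1%N, (B i); split=> [t dt|//|].
    by rewrite !mevalXU subr0 expr1 mulrC divfK.
  rewrite expr1 (bigD1 i) //= big1 ?addr0 => [|l li]; rewrite mderivX mevalZ mnm1E.
    by rewrite eqxx mul1r mnm_subxx mpolyX0 meval1 mul1r.
  by rewrite eq_sym (negPf li) !mul0r.
- exists (e + f)%N, (d ^+ f * P + d ^+ e * Q); split=> [t dt||].
  + by rewrite hornerD !hornerM !horner_exp EP // EQ // !mevalD exprD; ring.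
  + by rewrite hornerD !hornerM P0 Q0 !mulr0 addr0.
  + rewrite derivD !derivM !hornerD !hornerM P0 Q0 !mulr0 !add0r !horner_exp.
    under eq_bigr do rewrite mderivD mevalD mulrDl.
    rewrite big_split /= mulrDr mulrCA DP [d.[0] * (_ ^+ e * _)]mulrCA DQ.
    by rewrite exprD mulrDr; ring.
- exists (e + f)%N, (P * Q + p.@[fun=> 0] *: (d ^+ e * Q)
                    + q.@[fun=> 0] *: (d ^+ f * P)); split=> [t dt||].
  + rewrite !hornerD !hornerZ !hornerM !horner_exp EP // EQ // !mevalM exprD; ring.
  + by rewrite !hornerD !hornerZ !hornerM P0 Q0 !(mulr0, addr0).
  + rewrite !derivD !derivZ !derivM !hornerD !hornerZ !hornerD !hornerM P0 Q0.
    rewrite !(mulr0, add0r, mul0r) !horner_exp.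
    set sp := \sum_l _ in DP; set sq := \sum_l _ in DQ.
    rewrite (_ : \sum_l _ = q.@[fun=> 0] * sp + p.@[fun=> 0] * sq); last first.
      rewrite !mulr_sumr -big_split; apply: eq_bigr => l _.
      by rewrite mderivM mevalD !mevalM /=; ring.
    rewrite exprD mulrDr.
    rewrite [d.[0] * (p.@[_] * _)]mulrCA [d.[0] * (_ ^+ e * _)]mulrCA DQ.
    rewrite [d.[0] * (q.@[_] * _)]mulrCA [d.[0] * (_ ^+ f * _)]mulrCA DP.
    by ring.
Qed.

End Derivatives.

(** * Charts and the Zariski topology of the Grassmannian *)

Section Charts.
Variables (K : numFieldType) (vT : vectType K).

Lemma span_famP k (f : 'I_k -> vT) x :
  reflect (exists l : 'I_k -> K, x = \sum_i l i *: f i)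
          (x \in <<[seq f i | i : 'I_k]>>%VS).
Proof.
have E : [seq f i | i : 'I_k] = [tuple f i | i < k] :> seq vT by [].
apply: (iffP idP) => [|[l ->]].
  rewrite E => /coord_span {1}->; eexists => /=.
  by apply: eq_bigr => i _; rewrite nth_mktuple.
by apply: memv_suml => i _; apply/memvZ/memv_span/fintype.image_f.
Qed.

Lemma span_fam_sub k (f : 'I_k -> vT) (W : {vspace vT}) :
  (forall i, f i \in W) -> (<<[seq f i | i : 'I_k]>> <= W)%VS.
Proof. by move=> fW; apply/span_subvP => _ /fintype.imageP [i _ ->]. Qed.

Lemma mem_span_fam k (f : 'I_k -> vT) i : f i \in <<[seq f i | i : 'I_k]>>%VS.
Proof. exact/memv_span/fintype.image_f. Qed.

Lemma span_fam_tuple k (b : k.-tuple vT) :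
  <<[seq tnth b i | i : 'I_k]>>%VS = <<b>>%VS.
Proof.
congr <<_>>%VS; apply: (@eq_from_nth _ 0); rewrite size_image card_ord ?size_tuple //.
move=> i ik; rewrite [in RHS](_ : i = Ordinal ik :> nat) // -tnth_nth.
rewrite (nth_map (Ordinal ik)) ?size_enum_ord //.
by congr (tnth _ _); apply: val_inj; rewrite /= nth_enum_ord.
Qed.

Lemma span_fam_unit k (Q : 'M[K]_k) (f g : 'I_k -> vT) : Q \in unitmx ->
  (forall i, f i = \sum_j Q i j *: g j) ->
  <<[seq f i | i : 'I_k]>>%VS = <<[seq g i | i : 'I_k]>>%VS.
Proof.
move=> Qu fg; apply/eqP; rewrite eqEsubv; apply/andP; split; apply: span_fam_sub => i.
  by apply/span_famP; exists (Q i).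
apply/span_famP; exists (invmx Q i).
under eq_bigr do rewrite fg scaler_sumr.
rewrite exchange_big /= (eq_bigr (fun j => (1%:M : 'M[K]_k) i j *: g j)).
  rewrite (bigD1 i) //= big1 ?addr0 ?mxE ?eqxx ?scale1r // => j ij.
  by rewrite mxE eq_sym (negPf ij) scale0r.
move=> j _; rewrite -(mulVmx Qu) mxE scaler_suml.
by apply: eq_bigr => l _; rewrite scalerA.
Qed.

Section Coordinates.
Variables (U : {vspace vT}) (k m : nat) (b : k.-tuple vT) (c : m.-tuple vT).
Hypothesis bcU : basis_of U (b ++ c).

(** [bmx w] and [cmx w] are the two blocks of coordinates of the family [w] in the basis [b ++ c]. A
    change of family multiplies both on the left, so the span of [w] is in the chart exactly when
    [bmx w] is invertible, and its coordinates are then [invmx (bmx w) *m cmx w]. *)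
Definition bmx (w : 'I_k -> vT) : 'M[K]_k :=
  \matrix_(i, j) coord [tuple of b ++ c] (lshift m j) (w i).
Definition cmx (w : 'I_k -> vT) : 'M[K]_(k, m) :=
  \matrix_(i, j) coord [tuple of b ++ c] (rshift k j) (w i).

Definition rows (A : 'M[K]_(k, m)) (i : 'I_k) : vT :=
  tnth b i + \sum_(j < m) A i j *: tnth c j.

Lemma chartE A : chart b c A = <<[seq rows A i | i : 'I_k]>>%VS.
Proof. by []. Qed.

Lemma bc_decomp w i : w i \in U ->
  w i = \sum_j bmx w i j *: tnth b j + \sum_j cmx w i j *: tnth c j.
Proof.
move=> wU; rewrite {1}(coord_basis (X := [tuple of b ++ c]) bcU wU) big_split_ord /=.
congr (_ + _); apply: eq_bigr => j _; rewrite mxE.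
  by rewrite -(tnth_lshift b c) (tnth_nth 0).
by rewrite -(tnth_rshift b c) (tnth_nth 0).
Qed.

Lemma coord_b i j : coord [tuple of b ++ c] j (tnth b i) = (lshift m i == j)%:R.
Proof.
by rewrite -(tnth_lshift b c) (tnth_nth 0) coord_free ?(basis_free bcU) // eq_sym.
Qed.

Lemma coord_c i j : coord [tuple of b ++ c] j (tnth c i) = (rshift k i == j)%:R.
Proof.
by rewrite -(tnth_rshift b c) (tnth_nth 0) coord_free ?(basis_free bcU) // eq_sym.
Qed.

Lemma bmx_rows A : bmx (rows A) = 1%:M.
Proof.
apply/matrixP => i j; rewrite !mxE linearD linear_sum /= coord_b.
rewrite eq_lshift big1 ?addr0 // => l _.
by rewrite linearZ /= coord_c eq_rlshift mulr0.
Qed.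

Lemma cmx_rows A : cmx (rows A) = A.
Proof.
apply/matrixP => i j; rewrite !mxE linearD linear_sum /= coord_b.
rewrite eq_lrshift add0r (bigD1 j) //= big1 ?addr0 => [|l lj];
  rewrite linearZ /= coord_c eq_rshift ?eqxx ?mulr1 //.
by rewrite (negPf lj) mulr0.
Qed.

Lemma bmx_lin (Q : 'M[K]_k) v w : (forall i, v i = \sum_j Q i j *: w j) ->
  bmx v = Q *m bmx w.
Proof.
move=> vw; apply/matrixP => i j; rewrite !mxE vw linear_sum.
by apply: eq_bigr => l _; rewrite linearZ mxE.
Qed.

Lemma cmx_lin (Q : 'M[K]_k) v w : (forall i, v i = \sum_j Q i j *: w j) ->
  cmx v = Q *m cmx w.
Proof.
move=> vw; apply/matrixP => i j; rewrite !mxE vw linear_sum.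
by apply: eq_bigr => l _; rewrite linearZ mxE.
Qed.

Lemma tnth_b_in i : tnth b i \in U.
Proof. by rewrite -(span_basis bcU) memv_span // mem_cat mem_tnth. Qed.

Lemma tnth_c_in i : tnth c i \in U.
Proof. by rewrite -(span_basis bcU) memv_span // mem_cat mem_tnth orbT. Qed.

Lemma rows_in A i : rows A i \in U.
Proof.
by rewrite memvD ?tnth_b_in // memv_suml // => j _; rewrite memvZ // tnth_c_in.
Qed.

Lemma span_chart w : (forall i, w i \in U) -> bmx w \in unitmx ->
  <<[seq w i | i : 'I_k]>>%VS = chart b c (invmx (bmx w) *m cmx w).
Proof.
move=> wU Mu; rewrite chartE; apply/esym/(span_fam_unit (Q := invmx (bmx w))).
  by rewrite unitmx_inv.
move=> i; rewrite /rows.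
under [RHS]eq_bigr do rewrite (bc_decomp (wU _)) scalerDr.
rewrite big_split /=; congr (_ + _).
  under eq_bigr do rewrite scaler_sumr.
  rewrite exchange_big (eq_bigr (fun j => (1%:M : 'M[K]_k) i j *: tnth b j)).
    rewrite (bigD1 i) //= big1 ?addr0 ?mxE ?eqxx ?scale1r // => j ij.
    by rewrite mxE eq_sym (negPf ij) scale0r.
  move=> j _; rewrite -(mulVmx Mu) [in RHS]mxE scaler_suml.
  by apply: eq_bigr => l _; rewrite scalerA.
under [RHS]eq_bigr do rewrite scaler_sumr.
rewrite exchange_big; apply: eq_bigr => j _.
by rewrite mxE scaler_suml; apply: eq_bigr => l _; rewrite scalerA.
Qed.

Lemma span_chart_inv w A : (forall i, w i \in U) ->
  <<[seq w i | i : 'I_k]>>%VS = chart b c A ->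
  bmx w \in unitmx /\ A = invmx (bmx w) *m cmx w.
Proof.
move=> wU E.
have /fin_all_exists [Q HQ] : forall i, exists l : 'I_k -> K,
    rows A i = \sum_j l j *: w j.
  by move=> i; apply/span_famP; rewrite E chartE mem_span_fam.
have H i : rows A i = \sum_j (\matrix_(i, j) Q i j) i j *: w j.
  by rewrite HQ; apply: eq_bigr => j _; rewrite mxE.
have := bmx_lin H; rewrite bmx_rows => /esym QM.
have := cmx_lin H; rewrite cmx_rows => ->.
have /mulmx1_unit [_ Mu] := QM; split=> //.
by congr (_ *m _); rewrite -[LHS]mulmx1 -(mulmxV Mu) mulmxA QM mul1mx.
Qed.

Lemma chart_inj A A' : chart b c A = chart b c A' -> A = A'.
Proof.
move=> /(span_chart_inv (rows_in A)) [_ ->].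
by rewrite bmx_rows cmx_rows invmx1 mul1mx.
Qed.

Lemma chart0 : chart b c 0 = <<b>>%VS.
Proof.
rewrite chartE -span_fam_tuple; congr <<_>>%VS; apply: eq_map => i.
by rewrite /rows big1 ?addr0 // => j _; rewrite mxE scale0r.
Qed.

Lemma chart_grassmannian A : grassmannian U k (chart b c A).
Proof.
split; first exact/span_fam_sub/rows_in.
have: free [tuple rows A i | i < k].
  apply/freeP => l; under eq_bigr do rewrite nth_mktuple.
  move=> l0 i.
  have H (r : 'I_k) : 0 = \sum_j (\matrix_(_ < k, j < k) l j) r j *: rows A j.
    by rewrite -[LHS]l0; apply: eq_bigr => j _; rewrite mxE.
  have := bmx_lin (v := fun=> 0) H; rewrite bmx_rows mulmx1.
  by move=> /matrixP/(_ i i); rewrite !mxE linear0 => <-.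
by move=> /eqP H; rewrite [LHS]H size_tuple.
Qed.

End Coordinates.

Lemma basis_completion (U : {vspace vT}) k (b : k.-tuple vT) :
  free b -> (<<b>> <= U)%VS -> exists m (c : m.-tuple vT), basis_of U (b ++ c).
Proof.
move=> fb bU; exists _, (vbasis (U :\: <<b>>)%VS).
have E : (<<b>> + (U :\: <<b>>) = U)%VS.
  by rewrite -[RHS](addv_diff_cap U <<b>>%VS) (capv_idPr bU) addvC.
rewrite -[X in basis_of X _]E; apply: cat_basis; rewrite ?vbasisP //.
  by apply/directv_addP; rewrite capvC capv_diff.
by rewrite basisEfree fb subvv dim_span.
Qed.

End Charts.

(** * Closed sets across charts, and limits along curves *)

Section ZariskiClosed.
Variables (K : numFieldType) (vT : vectType K) (U : {vspace vT}) (k : nat).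
Local Open Scope classical_set_scope.

(** Everything outside the chart is included. This makes the set closed in the whole Grassmannian,
    and for [p = 1] it is the complement of the chart. *)
Definition chart_zeros m (b : k.-tuple vT) (c : m.-tuple vT) (p : {mpoly K[k * m]}) :
    set {vspace vT} :=
  [set W | grassmannian U k W /\ forall A, W = chart b c A -> mxeval p A = 0].

Lemma coord_rows_fun m m' (b : k.-tuple vT) (c : m.-tuple vT) (b' : k.-tuple vT)
    (c' : m'.-tuple vT) i j :
  mxfun (fun A : 'M[K]_(k, m') => bmx b c (rows b' c' A) i j).
Proof.
have SA := mxfun_alg K k m'.
apply: (@funalg_ext _ _ _ (fun A : 'M[K]_(k, m') =>
  coord [tuple of b ++ c] (lshift m j) (tnth b' i) +
  \sum_l A i l * coord [tuple of b ++ c] (lshift m j) (tnth c' l))).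
  move=> A; rewrite mxE linearD linear_sum; congr (_ + _).
  by apply: eq_bigr => l _; rewrite linearZ.
apply: (funalgD SA (funalgC SA _)); apply: (funalg_sum SA) => l _.
by apply: (funalgM SA) (funalgC SA _); apply: mxfun_entry.
Qed.

Lemma coord_rows_fun' m m' (b : k.-tuple vT) (c : m.-tuple vT) (b' : k.-tuple vT)
    (c' : m'.-tuple vT) i j :
  mxfun (fun A : 'M[K]_(k, m') => cmx b c (rows b' c' A) i j).
Proof.
have SA := mxfun_alg K k m'.
apply: (@funalg_ext _ _ _ (fun A : 'M[K]_(k, m') =>
  coord [tuple of b ++ c] (rshift k j) (tnth b' i) +
  \sum_l A i l * coord [tuple of b ++ c] (rshift k j) (tnth c' l))).
  move=> A; rewrite mxE linearD linear_sum; congr (_ + _).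
  by apply: eq_bigr => l _; rewrite linearZ.
apply: (funalgD SA (funalgC SA _)); apply: (funalg_sum SA) => l _.
by apply: (funalgM SA) (funalgC SA _); apply: mxfun_entry.
Qed.

Lemma mxeval_invmx m (M : 'M[K]_k) (N : 'M[K]_(k, m)) (p : {mpoly K[k * m]}) :
  M \in unitmx ->
  mxeval p (invmx M *m N) = p.@[fun l => mxvec (\adj M *m N) 0 l / \det M].
Proof.
move=> Mu; apply: meval_eq => l; case/mxvec_indexP: l => i j.
by rewrite /invmx Mu -scalemxAl !mxvecE [LHS]mxE mulrC.
Qed.

(** In a second chart, the coordinates of the first are the entries of [\adj M *m N] divided by
    [\det M]. Clearing denominators gives a single equation, whose zeros include those of [\det M],
    that is, the points outside the first chart. *)
Lemma chart_zeros_closed m (b : k.-tuple vT) (c : m.-tuple vT) p :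
  basis_of U (b ++ c) -> zariski_closed U k (chart_zeros b c p).
Proof.
move=> bcU; split=> [W []//|m' b' c' bcU'].
pose M (A : 'M[K]_(k, m')) := bmx b c (rows b' c' A).
pose N (A : 'M[K]_(k, m')) := cmx b c (rows b' c' A).
have SA := mxfun_alg K k m'.
have SM i j : mxfun (fun A => M A i j) by apply: coord_rows_fun.
have SN i j : mxfun (fun A => N A i j) by apply: coord_rows_fun'.
have [||e [f [[q fq] f0 fE]]] := @funalg_homog _ _ _ SA _
   (fun A => \det (M A)) (fun l A => mxvec (\adj (M A) *m N A) 0 l) p.
- exact: (funalg_det SA).
- move=> l; case/mxvec_indexP: l => i j.
  apply: (@funalg_ext _ _ _ (fun A => (\adj (M A) *m N A) i j)) => [A|].
    by rewrite mxvecE.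
  apply: (funalg_mulmx SA) => // i' j'; exact: (funalg_adj SA).
exists [set q] => A; split=> [[_ H] _ ->|/(_ q erefl) q0].
  rewrite -fq; have [d0|dn0] := eqVneq (\det (M A)) 0; first exact: f0.
  have Mu : M A \in unitmx by rewrite unitmxE unitfE.
  rewrite fE // -mxeval_invmx // H ?mulr0 //.
  by rewrite chartE (span_chart bcU) //; apply: rows_in.
split=> [|A' E]; first exact: chart_grassmannian.
have [Mu ->] := span_chart_inv bcU (rows_in bcU' A) E.
have dn0 : \det (M A) != 0 by rewrite -unitfE -unitmxE.
move: q0; rewrite -fq fE // mxeval_invmx // => /eqP.
by rewrite mulf_eq0 expf_eq0 (negPf dn0) andbF => /eqP.
Qed.

Lemma chart_zeros_chart m (b : k.-tuple vT) (c : m.-tuple vT) p A :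
  basis_of U (b ++ c) -> chart_zeros b c p (chart b c A) <-> mxeval p A = 0.
Proof.
move=> bcU; split=> [[_ ->]//|p0]; split; first exact: chart_grassmannian.
by move=> A' /(chart_inj bcU) <-.
Qed.

Lemma grassmannian_basis W : grassmannian U k W ->
  exists m (b : k.-tuple vT) (c : m.-tuple vT), basis_of U (b ++ c) /\ <<b>>%VS = W.
Proof.
move=> [WU dW]; have sW : size (vbasis W) == k by rewrite size_tuple dW.
have [||m [c bc]] := @basis_completion _ _ U _ (Tuple sW).
- exact: (basis_free (vbasisP W)).
- by rewrite (span_basis (vbasisP W)).
by exists m, (Tuple sW), c; rewrite (span_basis (vbasisP W)).
Qed.

Section Curves.
Variables (L : nat) (w : 'I_k -> nat -> vT).
Hypothesis wU : forall i s, w i s \in U.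

(** Given by coefficient vectors, so that the value and the velocity at 0 are [w i 0] and [w i 1];
    the bound [L.+2] guarantees that both occur. *)
Definition curve (t : K) (i : 'I_k) : vT := \sum_(s < L.+2) t ^+ s *: w i s.

Definition curve_span t := <<[seq curve t i | i : 'I_k]>>%VS.

Lemma curve_in t i : curve t i \in U.
Proof. by apply: memv_suml => s _; apply: memvZ. Qed.

Lemma curve0 i : curve 0 i = w i 0%N.
Proof.
rewrite /curve big_ord_recl expr0 scale1r big1 ?addr0 // => s _.
by rewrite exprS mul0r scale0r.
Qed.

Section InChart.
Variables (m : nat) (b : k.-tuple vT) (c : m.-tuple vT).
Hypothesis bcU : basis_of U (b ++ c).

Definition bpoly : 'M[{poly K}]_k :=
  \matrix_(i, j) \poly_(s < L.+2) bmx b c (w^~ s) i j.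
Definition cpoly : 'M[{poly K}]_(k, m) :=
  \matrix_(i, j) \poly_(s < L.+2) cmx b c (w^~ s) i j.

Lemma bpolyE t : bmx b c (curve t) = map_mx (horner^~ t) bpoly.
Proof.
apply/matrixP => i j; rewrite !mxE horner_poly linear_sum.
by apply: eq_bigr => s _; rewrite linearZ mxE mulrC.
Qed.

Lemma cpolyE t : cmx b c (curve t) = map_mx (horner^~ t) cpoly.
Proof.
apply/matrixP => i j; rewrite !mxE horner_poly linear_sum.
by apply: eq_bigr => s _; rewrite linearZ mxE mulrC.
Qed.

Definition chart_num : 'M[{poly K}]_(k, m) := \adj bpoly *m cpoly.

Lemma det_bpoly t : (\det bpoly).[t] = \det (bmx b c (curve t)).
Proof. by rewrite bpolyE; apply: (esym (det_map_mx (horner_eval t) _)). Qed.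

Lemma chart_numE t :
  map_mx (horner^~ t) chart_num = \adj (bmx b c (curve t)) *m cmx b c (curve t).
Proof.
have := map_mxM (horner_eval t) (\adj bpoly) cpoly; rewrite map_mx_adj.
by rewrite bpolyE cpolyE.
Qed.

Lemma curve_span_chart t : (\det bpoly).[t] != 0 ->
  curve_span t = chart b c (invmx (bmx b c (curve t)) *m cmx b c (curve t)).
Proof.
move=> dt; apply: (span_chart bcU (curve_in t)).
by rewrite unitmxE unitfE -det_bpoly.
Qed.

Lemma mxeval_curve t (p : {mpoly K[k * m]}) : (\det bpoly).[t] != 0 ->
  mxeval p (invmx (bmx b c (curve t)) *m cmx b c (curve t)) =
  p.@[fun l => (mxvec chart_num 0 l).[t] / (\det bpoly).[t]].
Proof.
move=> dt; rewrite mxeval_invmx; last by rewrite unitmxE unitfE -det_bpoly.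
apply: meval_eq => l; rewrite det_bpoly; congr (_ / _).
by rewrite -chart_numE -map_mxvec mxE.
Qed.

Hypothesis w0 : curve_span 0 = <<b>>%VS.

Lemma det_bpoly0 : (\det bpoly).[0] != 0.
Proof.
rewrite det_bpoly -unitfE -unitmxE.
have := span_chart_inv (w := curve 0) (A := 0) bcU (curve_in 0).
by rewrite chart0 -/(curve_span 0) w0 => /(_ erefl) [].
Qed.

Lemma cmx_curve0 : cmx b c (curve 0) = 0.
Proof.
have := span_chart_inv (w := curve 0) (A := 0) bcU (curve_in 0).
rewrite chart0 -/(curve_span 0) w0 => /(_ erefl) [Mu /(congr1 (mulmx (bmx b c (curve 0))))].
by rewrite mulmx0 mulmxA mulmxV // mul1mx.
Qed.

Lemma chart_num0 l : (mxvec chart_num 0 l).[0] = 0.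
Proof.
have := congr1 (fun A => mxvec A 0 l) (chart_numE 0).
by rewrite cmx_curve0 mulmx0 -map_mxvec mxE => ->; rewrite linear0 mxE.
Qed.

Lemma chart_num_deriv0 :
  map_mx (fun p => p^`().[0]) chart_num =
  \adj (bmx b c (curve 0)) *m cmx b c (w^~ 1%N).
Proof.
apply/matrixP => i j; rewrite /chart_num [LHS]mxE [in LHS]mxE raddf_sum.
rewrite horner_sum [RHS]mxE; apply: eq_bigr => l _.
rewrite [X in X.[0]](derivM _ _) hornerD !hornerM.
have -> : (cpoly l j).[0] = 0.
  by have := congr1 (fun A : 'M[K]__ => A l j) (cpolyE 0); rewrite cmx_curve0 mxE [RHS]mxE.
rewrite mulr0 add0r; congr (_ * _).
  have := congr1 (fun A : 'M[K]__ => A i l) (map_mx_adj (horner_eval 0) bpoly).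
  by rewrite -[X in _ = \adj X i l]/(map_mx (horner^~ 0) bpoly) -bpolyE mxE.
by rewrite horner_coef0 coef_deriv mulr1n mxE coef_poly.
Qed.

(** Since [p] vanishes at generic points of the curve, the expansion [Q] is minus the value of [p]
    at the centre times a power of the determinant. At 0, [Q] vanishes and the determinant does not,
    so this value is 0. Then [Q = 0], and its derivative at 0 gives the required sum. The adjugate
    in place of the inverse only rescales the tangent vector. *)
Lemma curve_tangent (X : set {vspace vT}) (q : {poly K}) : q != 0 ->
  (forall t, q.[t] != 0 -> X (curve_span t)) ->
  tangent_space X b c (\adj (bmx b c (w^~ 0%N)) *m cmx b c (w^~ 1%N)).
Proof.
move=> q0 Xq p pX.
have [e [Q [EQ Q0 DQ]]] := homog_deriv (\det bpoly) p chart_num0.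
pose s := q * \det bpoly.
have dn0 : \det bpoly != 0.
  by apply: contraNneq det_bpoly0 => ->; rewrite horner0.
have s0 : s != 0 by rewrite mulf_neq0.
have H t : s.[t] != 0 -> Q.[t] = - p.@[fun=> 0] * (\det bpoly).[t] ^+ e.
  rewrite hornerM mulf_eq0 negb_or => /andP [qt dt].
  rewrite EQ // -mxeval_curve // pX ?sub0r 1?mulrC // -curve_span_chart //.
  exact: Xq.
have HQ : Q = - p.@[fun=> 0] *: \det bpoly ^+ e.
  apply/eqP; rewrite -subr_eq0; apply/eqP/(poly_eq0_generic s0) => t st.
  by rewrite hornerD hornerN hornerZ horner_exp H // subrr.
have p0 : p.@[fun=> 0] = 0.
  have := Q0; rewrite HQ hornerZ horner_exp => /eqP.
  rewrite mulf_eq0 expf_eq0 (negPf det_bpoly0) andbF orbF oppr_eq0.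
  by move=> /eqP.
have Q00 : Q = 0 by rewrite HQ p0 oppr0 scale0r.
move: DQ; rewrite Q00 deriv0 horner0 mulr0 => /esym/eqP.
rewrite mulf_eq0 expf_eq0 (negPf det_bpoly0) andbF /= => /eqP DQ.
rewrite -[RHS]DQ; apply: eq_bigr => l _.
congr (_ * _); first by rewrite /mxeval; apply: meval_eq => j; rewrite linear0 mxE.
have -> : bmx b c (w^~ 0%N) = bmx b c (curve 0).
  by apply/matrixP => i j; rewrite !mxE curve0.
by rewrite -chart_num_deriv0 -map_mxvec mxE.
Qed.

End InChart.

(** A chart equation of [Z], pulled back to the curve and cleared of denominators, is a polynomial
    in [t] that vanishes generically, hence at 0. Freeness at 0 provides a chart centred at the
    limit span. *)
Lemma curve_closed (Z : set {vspace vT}) (q : {poly K}) : zariski_closed U k Z ->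
  q != 0 -> (forall t, q.[t] != 0 -> Z (curve_span t)) ->
  free [tuple w i 0%N | i < k] -> Z (curve_span 0).
Proof.
move=> [_ Zc] q0 Zq fw.
set b := [tuple _ | _ < _] in fw.
have bE : curve_span 0 = <<b>>%VS.
  by rewrite /curve_span; congr <<_>>%VS; apply: eq_map => i; rewrite curve0.
have [|m [c bcU]] := basis_completion (U := U) fw.
  by rewrite -bE; apply/span_fam_sub/curve_in.
have [I HI] := Zc m b c bcU.
rewrite bE -(chart0 b c); apply/HI => p Ip.
have SA := poly1fun_alg K.
have [||e [f [[g fg] f0 fE]]] := @funalg_homog _ _ _ SA _
   (fun t => (\det (bpoly b c)).[t]) (fun l t => (mxvec (chart_num b c) 0 l).[t]) p.
- by exists (\det (bpoly b c)).
- by move=> l; exists (mxvec (chart_num b c) 0 l).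
have g0 : g = 0.
  apply: (poly_eq0_generic q0) => t qt; rewrite -fg.
  have [d0|dn0] := eqVneq (\det (bpoly b c)).[t] 0; first exact: f0.
  rewrite fE // -mxeval_curve //; have := Zq t qt.
  by rewrite (curve_span_chart bcU) // => /HI ->; rewrite ?mulr0.
have d0 := det_bpoly0 bcU bE.
have := fE 0 d0; rewrite fg g0 horner0 -mxeval_curve // cmx_curve0 // mulmx0.
by move=> /esym/eqP; rewrite mulf_eq0 expf_eq0 (negPf d0) andbF => /eqP.
Qed.

End Curves.

Lemma zariski_closureP (X : set {vspace vT}) :
  zariski_closed U k (zariski_closure U k X).
Proof.
split=> [W []//|m b c bcU].
exists [set p | exists Z, [/\ zariski_closed U k Z, X `<=` Z &
                  forall A, Z (chart b c A) -> mxeval p A = 0]] => A.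
split=> [[_ H] p [Z [Zc XZ]]|H]; first by apply; apply: H.
split=> [|Z Zc XZ]; first exact: chart_grassmannian.
have [_ /(_ m b c bcU) [I HI]] := Zc.
apply/HI => p Ip; apply: H; exists Z; split=> // A' /HI; exact.
Qed.

Lemma sub_zariski_closure (X : set {vspace vT}) :
  X `<=` grassmannian U k -> X `<=` zariski_closure U k X.
Proof. by move=> XG W XW; split=> [|Z _]; [apply: XG|apply]. Qed.

Lemma zariski_closure_min (X Z : set {vspace vT}) :
  zariski_closed U k Z -> X `<=` Z -> zariski_closure U k X `<=` Z.
Proof. by move=> Zc XZ W [_]; apply. Qed.

End ZariskiClosed.

(** * Chains of irreducible closed subsets *)

Section GridVanishing.
Variables (K : numFieldType) (N : nat).
Implicit Types (f g : ('I_N -> K) -> K) (v : 'I_N -> K).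

Definition upd v (i : 'I_N) (t : K) : 'I_N -> K := fun j => if j == i then t else v j.

(** The degree is bounded in each variable separately, the others being fixed: this is the form in
    which values on a grid determine the function. *)
Definition pdeg d f := forall i v,
  exists p : {poly K}, (size p <= d.+1)%N /\ forall t, f (upd v i t) = p.[t].

Definition polyfun f := exists d, pdeg d f.

Lemma pdegW d e f : (d <= e)%N -> pdeg d f -> pdeg e f.
Proof.
by move=> de H i v; have [p [sp pf]] := H i v; exists p; split=> //; apply: leq_trans sp _.
Qed.

Lemma pdegC c : pdeg 0 (fun=> c).
Proof. by move=> i v; exists c%:P; split=> [|t]; rewrite ?size_polyC ?hornerC // leq_b1. Qed.

Lemma pdegD d f g : pdeg d f -> pdeg d g -> pdeg d (fun v => f v + g v).
Proof.
move=> Hf Hg i v; have [p [sp pf]] := Hf i v; have [q [sq qg]] := Hg i v.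
exists (p + q); split=> [|t]; last by rewrite hornerD pf qg.
by apply: leq_trans (size_polyD p q) _; rewrite geq_max sp sq.
Qed.

Lemma pdegM d e f g : pdeg d f -> pdeg e g -> pdeg (d + e) (fun v => f v * g v).
Proof.
move=> Hf Hg i v; have [p [sp pf]] := Hf i v; have [q [sq qg]] := Hg i v.
exists (p * q); split=> [|t]; last by rewrite hornerM pf qg.
apply: leq_trans (size_polyMleq p q) _.
by move: sp sq; lia.
Qed.

Lemma pdegX d n f : pdeg d f -> pdeg (n * d) (fun v => f v ^+ n).
Proof.
move=> Hf; elim: n => [|n IH]; first exact: (pdegC 1).
have := pdegM Hf IH; rewrite mulSn; congr (pdeg _ _).
by apply/funext => v; rewrite exprS.
Qed.

Lemma pdeg_prod n (F : 'I_n -> ('I_N -> K) -> K) d :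
  (forall l, pdeg d (F l)) -> pdeg (n * d) (fun v => \prod_l F l v).
Proof.
elim: n F => [|n IH] F HF.
  have := pdegC 1; congr (pdeg _ _).
  by apply/funext => v; rewrite big_ord0.
have := pdegM (HF ord0) (IH (fun l => F (lift ord0 l)) (fun l => HF _)).
by rewrite mulSn; congr (pdeg _ _); apply/funext => v; rewrite big_ord_recl.
Qed.

Lemma pdeg_sum I (r : seq I) (F : I -> ('I_N -> K) -> K) d :
  (forall l, pdeg d (F l)) -> pdeg d (fun v => \sum_(l <- r) F l v).
Proof.
move=> HF; elim: r => [|i r IH].
  have := pdegW (leq0n d) (pdegC 0); congr (pdeg _ _).
  by apply/funext => v; rewrite big_nil.
have := pdegD (HF i) IH; congr (pdeg _ _).
by apply/funext => v; rewrite big_cons.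
Qed.

Lemma polyfun_alg : funalg polyfun.
Proof.
split=> [c|f g [d Hf] [e Hg]|f g [d Hf] [e Hg]].
- by exists 0%N; apply: pdegC.
- exists (d + e)%N; apply: pdegD.
    by apply: pdegW Hf; rewrite leq_addr.
  by apply: pdegW Hg; rewrite leq_addl.
- by exists (d + e)%N; apply: pdegM.
Qed.

Lemma polyfun_coord i : polyfun (fun v => v i).
Proof.
exists 1%N => j v; have [ij|ij] := eqVneq i j.
  by exists 'X; split=> [|t]; rewrite ?size_polyX // hornerX /upd ij eqxx.
exists (v i)%:P; split=> [|t]; last by rewrite hornerC /upd (negPf ij).
by rewrite size_polyC; case: (_ != _).
Qed.

Lemma polyfun_meval (p : {mpoly K[N]}) : polyfun (fun v => p.@[v]).
Proof. exact: (funalg_meval polyfun_alg _ polyfun_coord). Qed.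

(** Coordinates are released from the grid one at a time: in the coordinate being released, [f] is a
    polynomial of degree at most [d] with roots 0, ..., [d], which are distinct in characteristic
    0. *)
Lemma pdeg_grid d f : pdeg d f ->
  (forall g : {ffun 'I_N -> 'I_d.+1}, f (fun i => (g i)%:R) = 0) -> forall v, f v = 0.
Proof.
move=> Hf f0.
suff H j : (j <= N)%N -> forall v,
    (forall i : 'I_N, (j <= i)%N -> exists a : 'I_d.+1, v i = a%:R) -> f v = 0.
  by move=> v; apply: (H N) => // i; rewrite leqNgt ltn_ord.
elim: j => [|j IH] jN v vg.
  have /fin_all_exists [g Hg] : forall i, exists a : 'I_d.+1, v i = a%:R.
    by move=> i; apply: vg.
  have := f0 [ffun i => g i]; congr (f _ = _).
  by apply/funext => i; rewrite ffunE Hg.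
pose i := Ordinal jN; have [p [sp pf]] := Hf i v.
have -> : v = upd v i (v i).
  by apply/funext => l; rewrite /upd; case: eqP => // ->.
rewrite pf; suff -> : p = 0 by rewrite horner0.
apply/eqP/negPn/negP => pn0.
have := @max_poly_roots _ p [seq n%:R | n <- iota 0 d.+1] pn0.
rewrite size_map size_iota ltnNge sp => H; suff: false by []; apply: H; last first.
  rewrite map_inj_uniq ?iota_uniq // => a b /eqP.
  by rewrite eqr_nat => /eqP.
apply/allP => x /mapP [a]; rewrite mem_iota add0n => /andP [_ ad] ->.
rewrite /root -pf; apply/eqP; apply: IH; first exact: ltnW.
move=> l; rewrite leq_eqVlt => /orP [/eqP jl|jl].
  by exists (Ordinal ad); rewrite /upd -val_eqE /= jl eqxx.
have [a' Ha'] := vg l jl; exists a'; rewrite /upd -val_eqE /= -Ha'.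
by rewrite eq_sym ltn_eqF.
Qed.

Lemma kernel_vector m n (A : 'M[K]_(m, n)) : (n < m)%N ->
  exists v : 'rV[K]_m, v != 0 /\ v *m A = 0.
Proof.
move=> nm; exists (nz_row (kermx A)); split; last first.
  by apply/sub_kermxP; apply: nz_row_sub.
rewrite nz_row_eq0 -mxrank_eq0 mxrank_ker subn_eq0 -ltnNge.
by apply: leq_ltn_trans (rank_leq_col A) nm.
Qed.

(* Counting: the [D ^ (N + 1)] homogenized monomials outnumber the points of a
   grid on which polynomials of their degree are determined. *)
Lemma polyfun_dependent (f s : 'I_N.+1 -> ('I_N -> K) -> K) :
  (forall l, polyfun (f l)) -> (forall l, polyfun (s l)) ->
  exists D (a : {ffun 'I_N.+1 -> 'I_D} -> K), (exists m, a m != 0) /\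
    forall v, \sum_m a m * \prod_l (f l v ^+ m l * s l v ^+ (D - m l)) = 0.
Proof.
move=> /fin_all_exists [df Hf] /fin_all_exists [ds Hs].
pose d := (\sum_l df l + \sum_l ds l)%N.
have {}Hf l : pdeg d (f l).
  by apply: pdegW (Hf l); rewrite /d (bigD1 l) //= -!addnA leq_addr.
have {}Hs l : pdeg d (s l).
  by apply: pdegW (Hs l); rewrite /d addnC (bigD1 l) //= -!addnA leq_addr.
(* Each product has degree at most [D * C] in every variable, so the grid has at most
   [(D * C.+1) ^ N] points. Taking [D] larger than [C.+1 ^ N] makes this smaller than the number
   [D ^ N.+1] of products. *)
pose C := (N.+1 * d)%N; pose D := (C.+1 ^ N).+1.
pose term (m : {ffun 'I_N.+1 -> 'I_D}) v :=
  \prod_l (f l v ^+ m l * s l v ^+ (D - m l)).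
have Ht m : pdeg (D * C) (term m).
  rewrite mulnCA; apply: pdeg_prod => l.
  have := pdegM (pdegX (m l) (Hf l)) (pdegX (D - m l) (Hs l)).
  by rewrite -mulnDl subnKC // ltnW.
pose G := {ffun 'I_N -> 'I_(D * C).+1}.
have card : (#|{: G}| < #|{: {ffun 'I_N.+1 -> 'I_D}}|)%N.
  rewrite !card_ffun !card_ord.
  apply: (@leq_ltn_trans ((D * C.+1) ^ N)).
    by case: (N) => // n; rewrite leq_exp2r // mulnS -addn1 addnC leq_add2r.
  by rewrite expnMn expnSr ltn_pmul2l ?expn_gt0.
pose A : 'M[K]_(_, _) := \matrix_(i < #|{: {ffun 'I_N.+1 -> 'I_D}}|, j < #|{: G}|)
   term (enum_val i) (fun l => ((enum_val j : G) l)%:R).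
have [a [an0 aA]] := kernel_vector A card.
exists D, (fun m => a 0 (enum_rank m)); split.
  have /rV0Pn [i ai] := an0.
  by exists (enum_val i); rewrite enum_valK.
apply: (@pdeg_grid (D * C)) => [|g].
  apply: pdeg_sum => m; apply: pdegM (pdegC _) (Ht m).
have := congr1 (fun B : 'M[K]__ => B 0 (enum_rank g)) aA; rewrite !mxE => E.
rewrite -[RHS]E (reindex (@enum_val _ (mem {: {ffun 'I_N.+1 -> 'I_D}}))) /=; last first.
  by exists enum_rank => m _; rewrite ?enum_rankK ?enum_valK.
by apply: eq_bigr => i _; rewrite enum_valK [in RHS]mxE enum_rankK.
Qed.

End GridVanishing.

Section Chains.
Variables (K : numFieldType) (vT : vectType K) (U : {vspace vT}) (k : nat).
Local Open Scope classical_set_scope.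

Section InChart.
Variables (m : nat) (b : k.-tuple vT) (c : m.-tuple vT).
Hypothesis bcU : basis_of U (b ++ c).

(** The polynomials vanishing on [Z] in the chart have the defining property of a prime ideal: the
    two sets [chart_zeros] cover [Z], because they also contain everything outside the chart. *)
Lemma irreducible_prime (Z : set {vspace vT}) (f g : 'M[K]_(k, m) -> K) :
  irreducible_closed U k Z -> mxfun f -> mxfun g ->
  (forall A, Z (chart b c A) -> f A * g A = 0) ->
  (forall A, Z (chart b c A) -> f A = 0) \/ (forall A, Z (chart b c A) -> g A = 0).
Proof.
move=> [Zc _ Zirr] [p fp] [q gq] fg0.
have [|H|H] := Zirr _ _ (chart_zeros_closed p bcU) (chart_zeros_closed q bcU).
- move=> W ZW; have WG : grassmannian U k W by case: Zc => ZG _; apply: ZG.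
  have [[A WA]|nA] := pselect (exists A, W = chart b c A).
    rewrite WA in ZW *; have /eqP := fg0 A ZW; rewrite mulf_eq0.
    by case/orP => /eqP H; [left|right]; apply/(chart_zeros_chart _ _ bcU);
      rewrite -?fp -?gq.
  by left; split=> // A WA; case: nA; exists A.
- by left=> A /H /(chart_zeros_chart _ _ bcU); rewrite -fp.
- by right=> A /H /(chart_zeros_chart _ _ bcU); rewrite -gq.
Qed.

(** The complement of the chart is closed and misses [<<b>>], so by irreducibility the chart is
    dense in [Z']. A failure of inclusion is therefore already detected by a chart equation of
    [Z]. *)
Lemma irreducible_separated (Z Z' : set {vspace vT}) :
  irreducible_closed U k Z' -> zariski_closed U k Z -> Z' <<b>>%VS ->
  ~ (Z' `<=` Z) -> exists p, (forall A, Z (chart b c A) -> mxeval p A = 0) /\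
                   exists A, Z' (chart b c A) /\ mxeval p A != 0.
Proof.
move=> [Zc' _ Zirr] Zc Z'b nZ; apply: contrapT => np; apply: nZ.
have [|//|H] := Zirr _ _ Zc (chart_zeros_closed 1 bcU); last first.
  have := H _ Z'b; rewrite -(chart0 b c) => /(chart_zeros_chart _ _ bcU).
  by rewrite /mxeval meval1 => /eqP; rewrite oner_eq0.
move=> W Z'W; have WG : grassmannian U k W by case: Zc' => ZG _; apply: ZG.
have [[A WA]|nA] := pselect (exists A, W = chart b c A); last first.
  by right; split=> // A WA; case: nA; exists A.
left; rewrite WA; have [_ /(_ m b c bcU) [I HI]] := Zc.
apply/HI => p Ip; apply/eqP/negPn/negP => pA; apply: np; exists p; split.
  by move=> A' /HI; apply.
by exists A; rewrite -WA.
Qed.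

(* The f_l cutting down a chain are algebraically independent on its last
   member: divide a relation by the largest power of the last variable and
   restrict it to the previous member. *)
Lemma chain_independent e (Z : nat -> set {vspace vT}) (f : nat -> 'M[K]_(k, m) -> K) :
  (forall j, (j <= e)%N -> irreducible_closed U k (Z j) /\ Z j <<b>>%VS) ->
  (forall j, (j < e)%N -> [/\ Z j `<=` Z j.+1, mxfun (f j),
      forall A, Z j (chart b c A) -> f j A = 0 &
      exists A, Z j.+1 (chart b c A) /\ f j A != 0]) ->
  forall j, (j <= e)%N -> forall (I : finType) (P : pred I) (i0 : I) (a : I -> K)
    (d : I -> nat -> nat), P i0 -> (forall i, P i -> a i != 0) ->
    (forall i i', P i -> P i' -> (forall l, (l < j)%N -> d i l = d i' l) -> i = i') ->
    exists A, Z j (chart b c A) /\ \sum_(i | P i) a i * \prod_(l < j) f l A ^+ d i l != 0.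
Proof.
move=> Zirr Hf; elim=> [|j IH] je I P i0 a d Pi0 a0 dinj.
  have [_ Z0b] := Zirr 0%N je; exists 0; rewrite chart0; split=> //.
  rewrite (bigD1 i0) //= big_ord0 mulr1 [X in _ + X]big1 ?addr0 ?a0 // => i.
  by move=> /andP [Pi /eqP ii0]; case: ii0; apply: dinj.
have [Zj fm fZ [A1 [ZA1 fA1]]] := Hf j je.
pose i1 := [arg min_(i < i0 | P i) d i j].
have [Pi1 mini1] : P i1 /\ forall i, P i -> (d i1 j <= d i j)%N.
  by rewrite /i1; case: arg_minnP.
pose r := d i1 j.
pose G A := \sum_(i | P i) a i * (\prod_(l < j) f l A ^+ d i l * f j A ^+ (d i j - r)).
apply: contrapT => H.
have SA := mxfun_alg K k m.
have fmx l : (l < j.+1)%N -> mxfun (f l).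
  by move=> lj; have [_ ? _ _] := Hf l (leq_trans lj je).
have Gm : mxfun G.
  apply: (funalg_sum SA) => i _; apply: (funalgM SA (funalgC SA _)).
  apply: (funalgM SA); last by apply: (funalgX SA).
  by apply: (funalg_prod SA) => l _; apply: (funalgX SA); exact: fmx (leqW (ltn_ord l)).
have [||||] := irreducible_prime (f := fun A => f j A ^+ r) (g := G) (proj1 (Zirr _ je)).
- by apply: (funalgX SA).
- exact: Gm.
- move=> A ZA; apply/eqP/negPn/negP => nz; apply: H; exists A; split=> //.
  apply: contraNneq nz => H; rewrite -[X in _ == X]H mulr_sumr; apply/eqP.
  apply: eq_bigr => i Pi; rewrite big_ord_recr /= -(subnK (mini1 i Pi)) exprD -/r.
  by rewrite addnK; ring.
- by move=> Z'; have := Z' _ ZA1 => /eqP; rewrite expf_eq0 (negPf fA1) andbF.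
move=> G0; pose P' := [pred i | P i && (d i j == r)].
have P'i1 : P' i1 by rewrite /= Pi1 eqxx.
have [||A [ZA nz]] := IH (ltnW je) I P' i1 a d P'i1.
- by move=> i /andP [Pi _]; apply: a0.
- move=> i i' /andP [Pi /eqP di] /andP [Pi' /eqP di'] dd; apply: dinj => // l.
  by rewrite ltnS leq_eqVlt => /orP [/eqP ->|/dd //]; rewrite di di'.
case/negP: nz; rewrite -[X in _ == X](G0 A (Zj _ ZA)) /G.
rewrite [X in _ == X](bigID (fun i => d i j == r)) /= [X in _ == _ + X]big1 ?addr0.
  by apply/eqP/eq_bigr => i /andP [_ /eqP ->]; rewrite subnn mulr1.
move=> i /andP [Pi dr]; rewrite fZ // expr0n subn_eq0.
by rewrite leqNgt ltn_neqAle eq_sym dr mini1 // !mulr0.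
Qed.

End InChart.

(** Dominance of [Phi] is expressed by closed sets: one containing its image contains [X]. For a
    chain longer than [N], the first [N.+1] separating functions, read in a chart centred at [x] and
    pulled back by [Phi], are fractions with powers of [\det M] as denominators. They satisfy a
    polynomial relation on the image, hence on [X], against [chain_independent]. *)
Lemma chain_bound N m (b : k.-tuple vT) (c : m.-tuple vT)
    (Phi : ('I_N -> K) -> 'M[K]_(k, m)) (X : set {vspace vT}) x e Z :
  basis_of U (b ++ c) -> (forall i j, polyfun (fun v => Phi v i j)) ->
  (forall Y, zariski_closed U k Y -> (forall v, Y (chart b c (Phi v))) -> X `<=` Y) ->
  irreducible_chain U k X x e Z -> (e <= N)%N.
Proof.
move=> bcU PhiP XY [ZX Zlt]; rewrite leqNgt; apply/negP => Ne.
have xG : grassmannian U k x.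
  by have [[[ZG _] _ _] _ /ZG] := ZX 0%N isT.
have [m' [b' [c' [bcU' bx]]]] := grassmannian_basis xG.
have /choice [f Hf] : forall j, exists p : {mpoly K[k * m']}, (j < e)%N ->
    (forall A, Z j (chart b' c' A) -> mxeval p A = 0) /\
     exists A, Z j.+1 (chart b' c' A) /\ mxeval p A != 0.
  move=> j.
  have [je|//] := boolP (j < e)%N; last by exists 0.
  have [Zj _ _] := ZX j (ltnW je); have [Zj' _ Zx] := ZX _ je.
  have [|||p Hp] := irreducible_separated bcU' (Z := Z j) Zj'; rewrite ?bx //.
  - by case: Zj.
  - by case: (Zlt j je).
  by exists p.
pose M v := bmx b' c' (rows b c (Phi v)); pose Nm v := cmx b' c' (rows b c (Phi v)).
have SA := polyfun_alg K N.
have SM i j : polyfun (fun v => M v i j).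
  have [p Hp] := coord_rows_fun b' c' b c i j.
  apply: (@funalg_ext _ _ _ (fun v => mxeval p (Phi v))) => [v|]; first by rewrite -Hp.
  exact: mxeval_fun.
have SN i j : polyfun (fun v => Nm v i j).
  have [p Hp] := coord_rows_fun' b' c' b c i j.
  apply: (@funalg_ext _ _ _ (fun v => mxeval p (Phi v))) => [v|]; first by rewrite -Hp.
  exact: mxeval_fun.
have Sd : polyfun (fun v => \det (M v)) by apply: (funalg_det SA).
have SB l : polyfun (fun v => mxvec (\adj (M v) *m Nm v) 0 l).
  case/mxvec_indexP: l => i j.
  apply: (@funalg_ext _ _ _ (fun v => (\adj (M v) *m Nm v) i j)) => [v|].
    by rewrite mxvecE.
  apply: (funalg_mulmx SA) => // i' j'; exact: (funalg_adj SA).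
have /fin_all_exists [h /fin_all_exists [n Hn]] : forall l : 'I_N.+1, exists h n,
    polyfun n /\ forall v, \det (M v) != 0 ->
      n v = \det (M v) ^+ h * mxeval (f l) (invmx (M v) *m Nm v).
  move=> l; have [h [n [Sn _ nE]]] := funalg_homog SA (f l) Sd SB.
  exists h, n; split=> // v dv; rewrite nE // mxeval_invmx //.
  by rewrite unitmxE unitfE.
have [||D [a [[m0 am0] Ha]]] :=
    @polyfun_dependent _ _ n (fun l v => \det (M v) ^+ h l).
- by move=> l; have [? _] := Hn l.
- by move=> l; apply: (funalgX SA).
pose F A := \sum_(i : {ffun 'I_N.+1 -> 'I_D}) a i * \prod_(l < N.+1) mxeval (f l) A ^+ i l.
have [p Fp] : mxfun F.
  have SMX := mxfun_alg K k m'; apply: (funalg_sum SMX) => i _.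
  apply: (funalgM SMX (funalgC SMX _)); apply: (funalg_prod SMX) => l _.
  by apply: (funalgX SMX); exists (f l).
have XF : X `<=` chart_zeros U b' c' p.
  apply: XY; first exact: chart_zeros_closed.
  move=> v; split=> [|A EA]; first exact: chart_grassmannian.
  have [Mu ->] := span_chart_inv bcU' (rows_in bcU (Phi v)) EA.
  have dv : \det (M v) != 0 by rewrite -unitfE -unitmxE.
  apply/eqP; suff: (\prod_(l < N.+1) \det (M v) ^+ (h l * D)) *
      mxeval p (invmx (M v) *m Nm v) == 0.
    rewrite mulf_eq0 => /orP [|//] /prodf_eq0 [l _].
    by rewrite expf_eq0 (negPf dv) andbF.
  rewrite -Fp /F mulr_sumr -[X in _ == X](Ha v); apply/eqP; apply: eq_bigr => i _.
  rewrite mulrCA -big_split; congr (_ * _); apply: eq_bigr => l _ /=.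
  have [_ -> //] := Hn l.
  rewrite exprMn -!exprM mulrAC -exprD -mulnDr subnKC //.
  exact/ltnW.
have Zb j : (j <= e)%N -> irreducible_closed U k (Z j) /\ Z j <<b'>>%VS.
  by move=> je; have [? _ ?] := ZX j je; rewrite bx.
(* Exponents are indexed by natural numbers here: [insub] restores the ordinal, and the default 0
   beyond [N] is never read. *)
have [||||A [ZA nz]] := @chain_independent _ b' c' bcU' e Z (fun l A => mxeval (f l) A) Zb _
   N.+1 Ne _ [pred i | a i != 0] m0 a (fun i l => if insub l is Some j then i j : nat else 0%N).
- move=> j je; have [f0 f1] := Hf j je; split=> //; first by case: (Zlt j je).
  by exists (f j).
- exact: am0.
- by [].
- move=> i i' _ _ E; apply/ffunP => l; apply: val_inj.
  by have := E l (ltn_ord l); rewrite valK.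
have [_ /(_ _) ZjX _] := ZX _ Ne.
case/negP: nz; have [_ /(_ A erefl)] := XF _ (ZjX _ ZA); rewrite -Fp => FA.
rewrite -[X in _ == X]FA /F [X in _ == X](bigID (fun i => a i != 0)) /=.
rewrite [X in _ == _ + X]big1 ?addr0.
  apply/eqP; apply: eq_big => [//|i _]; congr (_ * _); apply: eq_bigr => l _.
  by rewrite valK.
by move=> i; rewrite negbK => /eqP ->; rewrite mul0r.
Qed.

End Chains.

(** * Closed sets that are graphs in a chart *)

Section SmoothChart.
Variables (K : numFieldType) (vT : vectType K) (U : {vspace vT}) (k : nat).
Local Open Scope classical_set_scope.

Definition mpolyfun N (f : ('I_N -> K) -> K) :=
  exists p : {mpoly K[N]}, forall v, f v = p.@[v].

Lemma mpolyfun_alg N : funalg (@mpolyfun N).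
Proof.
split=> [c|f g [p pf] [q qg]|f g [p pf] [q qg]].
- by exists c%:MP => t; rewrite mevalC.
- by exists (p + q) => t; rewrite mevalD pf qg.
- by exists (p * q) => t; rewrite mevalM pf qg.
Qed.

Lemma mpolyfun_coord N (l : 'I_N) : mpolyfun (fun v => v l).
Proof. by exists 'X_l => v; rewrite mevalXU. Qed.

Lemma mpolyfun_polyfun N f : @mpolyfun N f -> polyfun f.
Proof.
move=> [p pf]; apply: (@funalg_ext _ _ _ (fun v => p.@[v])) => //.
exact: polyfun_meval.
Qed.

Lemma mpolyfun_line N f (v d : 'I_N -> K) :
  mpolyfun f -> poly1fun (fun t => f (fun l => v l + t * d l)).
Proof.
move=> [p pf]; apply: (@funalg_ext _ _ _ (fun t => p.@[fun l => v l + t * d l])).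
  by move=> t; rewrite pf.
apply: (funalg_meval (poly1fun_alg K)) => l.
by exists ((v l)%:P + d l *: 'X) => t; rewrite hornerD hornerC hornerZ hornerX mulrC.
Qed.

Variables (N m : nat) (b : k.-tuple vT) (c : m.-tuple vT).
Hypothesis bcU : basis_of U (b ++ c).

Section Recentering.
Variable A0 : 'M[K]_(k, m).

(** Tangent spaces are read at the centre of a chart; translating the affine chart moves its centre
    to the point with coordinates [A0]. *)
Definition recentered : k.-tuple vT := [tuple rows b c A0 i | i < k].

Lemma recentered_chart A : chart recentered c A = chart b c (A0 + A).
Proof.
rewrite !chartE; congr <<_>>%VS; apply: eq_map => i.
rewrite /rows tnth_mktuple -addrA -big_split; congr (_ + _).
by apply: eq_bigr => j _; rewrite mxE scalerDl.
Qed.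

Lemma recentered_span : <<recentered>>%VS = chart b c A0.
Proof. by rewrite -[A0 in RHS]addr0 -recentered_chart chart0. Qed.

Lemma recentered_basis : basis_of U (recentered ++ c).
Proof.
rewrite basisEdim; apply/andP; split; last first.
  by have /andP [/eqP <- /eqP ->] := bcU; rewrite !size_cat !size_tuple.
rewrite -(span_basis bcU); apply/span_subvP => x; rewrite mem_cat => /orP [].
  move=> /tnthP [i ->]; have -> : tnth b i =
      tnth recentered i - \sum_(j < m) A0 i j *: tnth c j.
    by rewrite tnth_mktuple /rows addrK.
  apply: memvB; first by rewrite memv_span // mem_cat mem_tnth.
  by apply: memv_suml => j _; rewrite memvZ // memv_span // mem_cat mem_tnth orbT.
by move=> xc; rewrite memv_span // mem_cat xc orbT.
Qed.

End Recentering.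

Variables (Phi : ('I_N -> K) -> 'M[K]_(k, m)) (r : 'I_N -> 'I_k) (s : 'I_N -> 'I_m).
Hypothesis PhiP : forall i j, mpolyfun (fun v => Phi v i j).
Hypothesis Phi_coord : forall v l, Phi v (r l) (s l) = v l.
Variable X : set {vspace vT}.
Hypothesis Xclosed : zariski_closed U k X.
Hypothesis Xchart : forall A, X (chart b c A) <-> exists v, A = Phi v.

(** The image of the [i]-dimensional affine space of parameters that agree with [v0] from coordinate
    [i] on. The closures of these sets for [i = 0, ..., N] form a chain of length [N] at the point
    of [v0]. *)
Definition flat (v0 : 'I_N -> K) (i : nat) : set {vspace vT} :=
  [set W | exists2 v, forall l : 'I_N, (i <= l)%N -> v l = v0 l & W = chart b c (Phi v)].

Lemma flat_grassmannian v0 i : flat v0 i `<=` grassmannian U k.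
Proof. by move=> _ [v _ ->]; apply: chart_grassmannian. Qed.

Lemma closed_chart_line (Z : set {vspace vT}) v d (q : {poly K}) :
  zariski_closed U k Z -> q != 0 ->
  (forall t, q.[t] != 0 -> Z (chart b c (Phi (fun l => v l + t * d l)))) ->
  Z (chart b c (Phi v)).
Proof.
move=> [_ /(_ m b c bcU) [I HI]] q0 H; apply/HI => p Ip.
have [g Hg] : poly1fun (fun t => mxeval p (Phi (fun l => v l + t * d l))).
  apply: (mxeval_fun _ (poly1fun_alg K)) => i j.
  exact: (mpolyfun_line v d (PhiP i j)).
have g0 : g = 0.
  by apply: (poly_eq0_generic q0) => t qt; rewrite -Hg; have /HI := H t qt; apply.
have := Hg 0; rewrite g0 horner0 => <-; congr (mxeval p (Phi _)).
by apply/funext => l; rewrite mul0r addr0.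
Qed.

(** A line of parameters joins a point outside [Z1] to one outside [Z2]. Along it, the product of an
    equation of [Z1] and one of [Z2] vanishes identically, so one factor does, contrary to its value
    at 0 or at 1. *)
Lemma flat_irreducible v0 i : irreducible_closed U k (zariski_closure U k (flat v0 i)).
Proof.
split; first exact: zariski_closureP.
  exists (chart b c (Phi v0)); apply: sub_zariski_closure.
    exact: flat_grassmannian.
  by exists v0.
move=> Z1 Z2 Z1c Z2c Z12.
suff [] : flat v0 i `<=` Z1 \/ flat v0 i `<=` Z2.
- by move=> H; left; apply: zariski_closure_min.
- by move=> H; right; apply: zariski_closure_min.
apply: contrapT => /not_orP [].
move=> /existsNP [_ /not_implyP [[v1 Hv1 ->] n1]] /existsNP [_ /not_implyP [[v2 Hv2 ->] n2]].
have [_ /(_ m b c bcU) [I1 HI1]] := Z1c.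
have [_ /(_ m b c bcU) [I2 HI2]] := Z2c.
have [p1 [I1p1 n1p]] : exists p, I1 p /\ mxeval p (Phi v1) != 0.
  apply: contrapT => H; apply: n1; apply/HI1 => p Ip.
  by apply/eqP/negPn/negP => n; apply: H; exists p.
have [p2 [I2p2 n2p]] : exists p, I2 p /\ mxeval p (Phi v2) != 0.
  apply: contrapT => H; apply: n2; apply/HI2 => p Ip.
  by apply/eqP/negPn/negP => n; apply: H; exists p.
pose w t := (fun l => v1 l + t * (v2 l - v1 l)).
have [g1 Hg1] : poly1fun (fun t => mxeval p1 (Phi (w t))).
  apply: (mxeval_fun _ (poly1fun_alg K)) => i' j'.
  exact: (mpolyfun_line v1 (fun l => v2 l - v1 l) (PhiP i' j')).
have [g2 Hg2] : poly1fun (fun t => mxeval p2 (Phi (w t))).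
  apply: (mxeval_fun _ (poly1fun_alg K)) => i' j'.
  exact: (mpolyfun_line v1 (fun l => v2 l - v1 l) (PhiP i' j')).
have /eqP : g1 * g2 = 0.
  apply: poly_eq0_of_roots => t; rewrite hornerM -Hg1 -Hg2.
  have [|H|H] := Z12 (chart b c (Phi (w t))).
  - apply: sub_zariski_closure; first exact: flat_grassmannian.
    by exists (w t) => // l il; rewrite /w Hv1 // Hv2 // subrr mulr0 addr0.
  - by move/HI1: H => /(_ p1 I1p1) ->; rewrite mul0r.
  - by move/HI2: H => /(_ p2 I2p2) ->; rewrite mulr0.
rewrite mulf_eq0 => /orP [] /eqP g0.
  case/negP: n1p; have := Hg1 0; rewrite g0 horner0 => <-; apply/eqP.
  by congr (mxeval _ (Phi _)); apply/funext => l; rewrite /w mul0r addr0.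
case/negP: n2p; have := Hg2 1; rewrite g0 horner0 => <-; apply/eqP.
by congr (mxeval _ (Phi _)); apply/funext => l; rewrite /w mul1r addrC subrK.
Qed.

Lemma flat_chain v0 :
  irreducible_chain U k X (chart b c (Phi v0)) N (fun i => zariski_closure U k (flat v0 i)).
Proof.
have flatS i : flat v0 i `<=` zariski_closure U k (flat v0 i).
  by apply: sub_zariski_closure; apply: flat_grassmannian.
split=> i iN.
  split; first exact: flat_irreducible.
    by apply: zariski_closure_min => // _ [v _ ->]; apply/Xchart; exists v.
  have := flatS i (chart b c (Phi v0)); apply; by exists v0.
split.
  apply: zariski_closure_min; first exact: zariski_closureP.
  move=> _ [v Hv ->]; apply: flatS; exists v => // l il; apply: Hv; exact: ltnW il.
pose l := Ordinal iN.
have [p Hp] : mxfun (fun A : 'M[K]_(k, m) => A (r l) (s l) - v0 l).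
  apply: (funalgB (mxfun_alg K k m)); first exact: mxfun_entry.
  exact: (funalgC (mxfun_alg K k m)).
have sub : zariski_closure U k (flat v0 i) `<=` chart_zeros U b c p.
  apply: zariski_closure_min; first exact: chart_zeros_closed.
  move=> _ [v Hv ->]; apply/(chart_zeros_chart _ _ bcU).
  by rewrite -Hp Phi_coord Hv ?subrr.
move=> H; pose v := upd v0 l (v0 l + 1).
have /H/sub/(chart_zeros_chart _ _ bcU) : zariski_closure U k (flat v0 i.+1) (chart b c (Phi v)).
  apply: flatS; exists v => // j ij; rewrite /v /upd; case: eqP => // jl.
  by rewrite jl ltnn in ij.
rewrite -Hp Phi_coord /v /upd eqxx addrAC subrr add0r => /eqP.
by rewrite oner_eq0.
Qed.

Lemma mpolyfun_deriv (p : {mpoly K[N]}) (v d : 'I_N -> K) :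
  exists Q : {poly K}, (forall t, Q.[t] = p.@[fun l => v l + t * d l]) /\
    Q^`().[0] = \sum_l (mderiv l p).@[v] * d l.
Proof.
have [Q [EQ DQ]] := meval_deriv (fun l => (v l)%:P + d l *: 'X) p 0.
exists Q; split=> [t|].
  by rewrite EQ; apply: meval_eq => l; rewrite hornerD hornerC hornerZ hornerX mulrC.
rewrite DQ; apply: eq_bigr => l _; congr (_ * _).
  by apply: meval_eq => j; rewrite hornerD hornerC hornerZ hornerX mulr0 addr0.
by rewrite derivD derivC add0r derivZ derivX hornerZ hornerC mulr1.
Qed.

Lemma mxeval0 (p : {mpoly K[k * m]}) : mxeval p 0 = p.@[fun=> 0].
Proof. by apply: meval_eq => l; rewrite linear0 mxE. Qed.

(** The tangent space is the image of the derivative of [Phi], spanned by the partial derivatives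
    [D l]; these are independent because the entries [(r l, s l)] of [Phi v] are the parameters
    themselves. Conversely, the equations that express every entry through these [N] entries, once
    differentiated, determine a tangent vector by its [N] entries. *)
Lemma smooth_tangent v0 : tangent_dim U k X (chart b c (Phi v0)) N.
Proof.
have [P HP] : exists P : 'I_k -> 'I_m -> {mpoly K[N]}, forall i j v, Phi v i j = (P i j).@[v].
  have /fin_all_exists [P HP] : forall i, exists P : 'I_m -> {mpoly K[N]},
      forall j v, Phi v i j = (P j).@[v].
    move=> i; have /fin_all_exists [P HP] : forall j, exists p : {mpoly K[N]},
        forall v, Phi v i j = p.@[v].
      by move=> j; apply: PhiP.
    by exists P.
  by exists P.
pose D l : 'M[K]_(k, m) := \matrix_(i, j) (mderiv l (P i j)).@[v0].
have dPhi l' d : \sum_l (mderiv l (P (r l') (s l'))).@[v0] * d l = d l'.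
  have [Q [EQ <-]] := mpolyfun_deriv (P (r l') (s l')) v0 d.
  have -> : Q = (v0 l')%:P + d l' *: 'X.
    apply: poly_ext => t.
    by rewrite EQ -HP Phi_coord hornerD hornerC hornerZ hornerX mulrC.
  by rewrite derivD derivC add0r derivZ derivX hornerZ hornerC mulr1.
exists m, (recentered (Phi v0)), c; split.
- exact: recentered_basis.
- exact: recentered_span.
exists <<[seq D l | l : 'I_N]>>%VS; split; last first.
  have /eqP : free [tuple D l | l < N].
    apply/freeP => a; under eq_bigr do rewrite nth_mktuple.
    move=> aD l; have := congr1 (fun A : 'M[K]__ => A (r l) (s l)) aD.
    rewrite summxE mxE => H; rewrite -[RHS]H -[LHS](dPhi l).
    by apply: eq_bigr => l' _; rewrite !mxE mulrC.
  by rewrite size_tuple.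
apply/seteqP; split=> [_ /span_famP [a ->]|A HA] /=.
  move=> p pX.
  have /fin_all_exists [Q HQ] : forall i, exists Q : 'I_m -> {poly K}, forall j,
      (forall t, (Q j).[t] = Phi (fun l => v0 l + t * a l) i j) /\
      (Q j)^`().[0] = (\sum_l a l *: D l) i j.
    move=> i; apply: (@fin_all_exists _ (fun _ => {poly K}) (fun j q =>
      (forall t, q.[t] = Phi (fun l => v0 l + t * a l) i j) /\
      q^`().[0] = (\sum_l a l *: D l) i j)) => j.
    have [Q [EQ DQ]] := mpolyfun_deriv (P i j) v0 a.
    exists Q; split=> [t|]; first by rewrite EQ HP.
    by rewrite DQ summxE; apply: eq_bigr => l _; rewrite !mxE mulrC.
  pose B : 'M[{poly K}]_(k, m) := \matrix_(i, j) (Q i j - (Phi v0 i j)%:P).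
  have [G [EG DG]] := meval_deriv (fun l => mxvec B 0 l) p 0.
  have BE t : map_mx (horner^~ t) B = Phi (fun l => v0 l + t * a l) - Phi v0.
    apply/matrixP => i j; rewrite !mxE hornerD hornerN hornerC.
    by have [-> _] := HQ i j.
  have Bl t l : (mxvec B 0 l).[t] = mxvec (map_mx (horner^~ t) B) 0 l.
    by rewrite -map_mxvec mxE.
  have G0 : G = 0.
    apply: poly_eq0_of_roots => t; rewrite EG.
    rewrite (@meval_eq _ _ _ (fun l => mxvec (map_mx (horner^~ t) B) 0 l)) //.
    apply: pX; rewrite recentered_chart BE addrC subrK.
    by apply/Xchart; exists (fun l => v0 l + t * a l).
  move: DG; rewrite G0 deriv0 horner0 => /esym DG; rewrite -[RHS]DG.
  apply: eq_bigr => l _; congr (_ * _).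
    rewrite mxeval0; apply: meval_eq => j; rewrite Bl BE.
    rewrite (_ : (fun l => _) = v0) ?subrr ?linear0 ?mxE //.
    by apply/funext => l'; rewrite mul0r addr0.
  case/mxvec_indexP: l => i j; rewrite !mxvecE.
  rewrite [in RHS]mxE derivB derivC subr0.
  by have [_ ->] := HQ i j.
apply/span_famP; exists (fun l => A (r l) (s l)); apply/matrixP => i j.
have [p Hp] : mxfun (fun B : 'M[K]_(k, m) => (Phi v0 + B) i j -
    (P i j).@[fun l => (Phi v0 + B) (r l) (s l)]).
  have SA := mxfun_alg K k m.
  have SE i' j' : mxfun (fun B : 'M[K]_(k, m) => (Phi v0 + B) i' j').
    apply: (@funalg_ext _ _ _ (fun B : 'M[K]_(k, m) => Phi v0 i' j' + B i' j')) => [B|].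
      by rewrite mxE.
    by apply: (funalgD SA (funalgC SA _)); apply: mxfun_entry.
  by apply: (funalgB SA) => //; apply: (funalg_meval SA).
have {}pA : \sum_(l < k * m) mxeval (mderiv l p) 0 * mxvec A 0 l = 0.
  apply: HA => B; rewrite recentered_chart => /Xchart [v Ev].
  rewrite -Hp Ev HP; apply/eqP; rewrite subr_eq0; apply/eqP/meval_eq => l.
  by rewrite Phi_coord.
have [Q [EQ DQ]] := meval_deriv (fun l => mxvec A 0 l *: 'X) p 0.
have Q'0 : Q^`().[0] = 0.
  rewrite DQ -[RHS]pA; apply: eq_bigr => l _; congr (_ * _).
    by rewrite mxeval0; apply: meval_eq => j'; rewrite hornerZ hornerX mulr0.
  by rewrite derivZ derivX hornerZ hornerC mulr1.
have [R [ER DR]] := mpolyfun_deriv (P i j) v0 (fun l => A (r l) (s l)).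
have QR : Q = (Phi v0 i j)%:P + A i j *: 'X - R.
  apply: poly_ext => t; rewrite EQ hornerD hornerN hornerD hornerC hornerZ hornerX ER.
  rewrite (@meval_eq _ _ _ (fun l => mxvec (t *: A) 0 l)) => [|l]; last first.
    by rewrite linearZ hornerZ hornerX mxE mulrC.
  rewrite -/(mxeval p (t *: A)) -Hp !mxE [t * _]mulrC; congr (_ - _).
  by apply: meval_eq => l; rewrite !mxE Phi_coord.
move: Q'0; rewrite QR derivB derivD derivC add0r derivZ derivX.
rewrite hornerD hornerN hornerZ hornerC mulr1 DR => /eqP.
rewrite subr_eq0 => /eqP ->; rewrite summxE; apply: eq_bigr => l _.
by rewrite !mxE mulrC.
Qed.

Lemma smooth_chart v0 :
  (forall x e Z, irreducible_chain U k X x e Z -> (e <= N)%N) ->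
  nonsingular U k X (chart b c (Phi v0)).
Proof.
move=> bound; exists N; split; last exact: smooth_tangent.
split; first by eexists; apply: flat_chain.
by move=> e Z; apply: bound.
Qed.

End SmoothChart.

(** * The variety of reductions *)

Section LinearAutomorphisms.
Variables (K : numFieldType) (vT : vectType K) (U : {vspace vT}) (k : nat).
Variable g : 'End(vT).
Hypotheses (ginj : lker g == 0%VS) (gU : (g @: U)%VS = U).
Local Open Scope classical_set_scope.

Lemma limg_chart m (b : k.-tuple vT) (c : m.-tuple vT) A :
  (g @: chart b c A)%VS = chart [tuple of map g b] [tuple of map g c] A.
Proof.
rewrite !chartE limg_span -map_comp; congr <<_>>%VS; apply: eq_map => i /=.
rewrite /rows linearD linear_sum !tnth_map; congr (_ + _).
by apply: eq_bigr => j _; rewrite linearZ tnth_map.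
Qed.

Lemma limg_basis m (b : k.-tuple vT) (c : m.-tuple vT) :
  basis_of U (b ++ c) -> basis_of U ([tuple of map g b] ++ [tuple of map g c]).
Proof.
move=> bcU; rewrite basisEdim /= -map_cat -limg_span (span_basis bcU) gU subvv /=.
by have /andP [/eqP <- /eqP ->] := bcU; rewrite size_map.
Qed.

Lemma limg_grassmannian W : grassmannian U k (g @: W)%VS <-> grassmannian U k W.
Proof.
have E : ((g @: W)%VS <= U)%VS = (W <= U)%VS by rewrite -[in LHS]gU limg_ker0.
have D : \dim (g @: W) = \dim W by rewrite limg_dim_eq // (eqP ginj) capv0.
by rewrite /grassmannian /= E D.
Qed.

Lemma limg_closed Z : zariski_closed U k Z -> zariski_closed U k [set W | Z (g @: W)%VS].
Proof.
move=> [ZG Zc]; split=> [W /ZG /limg_grassmannian //|m b c bcU].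
have [I HI] := Zc m _ _ (limg_basis bcU); exists I => A.
by rewrite /= limg_chart.
Qed.

Lemma limg_closure X : (forall W, X W -> X (g @: W)%VS) ->
  forall W, zariski_closure U k X W -> zariski_closure U k X (g @: W)%VS.
Proof.
move=> Xg W [WG H]; split; first exact/limg_grassmannian.
move=> Z Zc XZ; apply: (H [set W | Z (g @: W)%VS]); first exact: limg_closed.
by move=> W' /Xg /XZ.
Qed.

(** The automorphism carries a chart to a chart with the same coordinate matrices, so the same space
    [E] serves at both points. *)
Lemma limg_tangent_dim X x d : (forall W, X (g @: W)%VS <-> X W) ->
  tangent_dim U k X x d -> tangent_dim U k X (g @: x)%VS d.
Proof.
move=> Xg [m [b [c [bcU bx [E [HE dE]]]]]].
exists m, [tuple of map g b], [tuple of map g c]; split.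
- exact: limg_basis.
- by rewrite -bx limg_span.
exists E; split=> //; rewrite HE; apply/seteqP.
by split=> D HD p pX; apply: HD => A XA; apply: pX;
  [rewrite -limg_chart; apply/Xg|apply/Xg; rewrite limg_chart].
Qed.

End LinearAutomorphisms.

(** * Cartan subalgebras and the symmetries of Red(4) *)

Section Reductions.
Variable K : numClosedFieldType.
Local Open Scope classical_set_scope.
Local Notation M4 := 'M[K]_4.
Local Notation sl4 := (sl K 4).
Local Notation Red4 := (Red K 4).
Implicit Types (P : M4) (W : {vspace M4}).

Definition conj P : 'End(M4) := linfun (mulmxr (invmx P) \o mulmx P).

Lemma conjE P x : conj P x = P *m x *m invmx P.
Proof. by rewrite lfunE. Qed.

Lemma conj_tr P x : P \in unitmx -> \tr (conj P x) = \tr x.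
Proof. by move=> Pu; rewrite conjE mxtrace_mulC mulmxA mulVmx // mul1mx. Qed.

Lemma conjM P Q x : P \in unitmx -> Q \in unitmx -> conj (P *m Q) x = conj P (conj Q x).
Proof.
move=> Pu Qu; rewrite !conjE.
have -> : invmx (P *m Q) = invmx Q *m invmx P by exact: (@invrM M4 P Q Pu Qu).
by rewrite !mulmxA.
Qed.

Lemma conjKV P x : P \in unitmx -> conj P (conj (invmx P) x) = x.
Proof. by move=> Pu; rewrite !conjE invmxK !mulmxA mulmxV // mul1mx -mulmxA mulmxV // mulmx1. Qed.

Lemma conjK P x : P \in unitmx -> conj (invmx P) (conj P x) = x.
Proof. by move=> Pu; have := @conjKV (invmx P) x; rewrite invmxK unitmx_inv; apply. Qed.

Lemma conj_ker P : P \in unitmx -> lker (conj P) == 0%VS.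
Proof. by move=> Pu; apply/lker0P => x y /(congr1 (conj (invmx P))); rewrite !conjK. Qed.

Lemma conj_sl P : P \in unitmx -> (conj P @: sl4)%VS = sl4.
Proof.
move=> Pu; apply/vspaceP => x; apply/memv_imgP/idP => [[y]|xs].
  by rewrite !mem_sl => ys ->; rewrite conj_tr.
exists (conj (invmx P) x); last by rewrite conjKV.
by rewrite mem_sl conj_tr ?unitmx_inv // -mem_sl.
Qed.

Lemma conj_limgK P W : P \in unitmx -> (conj (invmx P) @: (conj P @: W))%VS = W.
Proof.
move=> Pu; apply/vspaceP => x; apply/memv_imgP/idP => [[_ /memv_imgP [y yW ->] ->]|xW].
  by rewrite conjK.
by exists (conj P x); rewrite ?memv_img ?conjK.
Qed.

Definition transp : 'End(M4) := linfun (@trmx K 4 4).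

Lemma transpE x : transp x = x^T.
Proof. by rewrite lfunE. Qed.

Lemma transpK W : (transp @: (transp @: W))%VS = W.
Proof.
apply/vspaceP => x; apply/memv_imgP/idP => [[_ /memv_imgP [y yW ->] ->]|xW].
  by rewrite !transpE trmxK.
by exists (transp x); rewrite ?memv_img ?transpE ?trmxK.
Qed.

Lemma transp_ker : lker transp == 0%VS.
Proof. by apply/lker0P => x y; rewrite !transpE => /trmx_inj. Qed.

Lemma transp_sl : (transp @: sl4)%VS = sl4.
Proof.
apply/vspaceP => x; apply/memv_imgP/idP => [[y]|xs].
  by rewrite !mem_sl => ys ->; rewrite transpE mxtrace_tr.
exists (transp x); last by rewrite !transpE trmxK.
by rewrite mem_sl transpE mxtrace_tr -mem_sl.
Qed.

(** The traceless parts of the first three diagonal idempotents, a basis of the diagonal Cartan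
    subalgebra; [lift ord_max] enumerates the indices other than the last. *)
Definition dgen (j : 'I_3) : M4 :=
  delta_mx (lift ord_max j) (lift ord_max j) - (4%:R^-1)%:M.

Lemma dgenE j a b : dgen j a b =
  (a == lift ord_max j)%:R * (b == lift ord_max j)%:R - (a == b)%:R / 4%:R.
Proof. by rewrite !mxE -mulnb natrM; congr (_ - _); rewrite mulr_natl. Qed.

Lemma dgen_sl j : dgen j \in sl4.
Proof.
rewrite mem_sl linearB /= mxtrace_scalar /mxtrace (bigD1 (lift ord_max j)) //=.
rewrite mxE !eqxx big1 ?addr0 ?subr_eq0 => [|i /negPf ij]; last by rewrite mxE ij.
by rewrite -[X in _ == X]mulr_natl mulfV ?pnatr_eq0.
Qed.

Lemma dgen_diag j : is_diag_mx (dgen j).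
Proof.
apply/is_diag_mxP => a b ab; rewrite dgenE.
have {}ab : (a == b) = false by apply/negP => /eqP E; rewrite E eqxx in ab.
rewrite ab mul0r subr0; case: eqP => [<-|]; last by rewrite mul0r.
by rewrite eq_sym ab mulr0.
Qed.

Lemma diag_dgen (D : M4) : is_diag_mx D -> D \in sl4 ->
  D = \sum_j (D (lift ord_max j) (lift ord_max j) - D ord_max ord_max) *: dgen j.
Proof.
move=> /is_diag_mxP Dd; rewrite mem_sl /mxtrace big_ord_recr /= => /eqP trD.
have {trD} trD : D ord_max ord_max = - \sum_(j < 3) D (lift ord_max j) (lift ord_max j).
  apply/eqP; rewrite -addr_eq0 addrC -[X in _ == X]trD; apply/eqP; congr (_ + _).
  by apply: eq_bigr => j _; congr (D _ _); apply: val_inj; rewrite /= /bump leqNgt ltn_ord.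
have n4 : 4%:R != 0 :> K by rewrite pnatr_eq0.
apply/matrixP => a b; rewrite summxE.
under eq_bigr do rewrite mxE dgenE.
have [<-|ab] := eqVneq a b; last first.
  rewrite Dd // big1 // => j _; rewrite mul0r subr0.
  have [aj|] := eqVneq a; last by rewrite mul0r mulr0.
  by rewrite -aj eq_sym (negPf ab) mulr0 mulr0.
have [j ->|->] := unliftP ord_max a.
  rewrite (bigD1 j) //= !eqxx mulr1.
  rewrite (eq_bigr (fun i => - ((D (lift ord_max i) (lift ord_max i) - D ord_max ord_max) / 4%:R))).
    move: trD; rewrite [in X in X -> _](bigD1 j) //= => trD.
    rewrite sumrN -mulr_suml sumrB sumr_const.
    have -> : #|[pred i : 'I_3 | i != j]| = 2.
      by have := cardC1 j; rewrite card_ord => E; rewrite -[RHS]E; apply: eq_card.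
    move: trD; set s := \sum_(_ | _) _ => trD; rewrite trD.
    by field.
  move=> i ij; rewrite (inj_eq (@lift_inj _ _)) eq_sym (negPf ij) mul0r sub0r mulrN.
  by rewrite mul1r.
rewrite (eq_bigr (fun i => - ((D (lift ord_max i) (lift ord_max i) - D ord_max ord_max) / 4%:R))).
  rewrite sumrN -mulr_suml sumrB sumr_const card_ord.
  have -> : \sum_(i < 3) D (lift ord_max i) (lift ord_max i) = - D ord_max ord_max.
    by rewrite trD opprK.
  by rewrite [4.-1]/=; field.
by move=> i _; rewrite (negPf (neq_lift _ _)) mul0r sub0r mulrN mul1r.
Qed.

Definition cartan P : {vspace M4} := <<[seq conj P (dgen j) | j : 'I_3]>>%VS.

Lemma mem_cartan P x : P \in unitmx ->
  (x \in cartan P) = (x \in sl4) && is_diag_mx (invmx P *m x *m P).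
Proof.
move=> Pu; apply/span_famP/andP => [[l ->]|[xs xd]].
  split.
    by apply: memv_suml => j _; rewrite memvZ // mem_sl conj_tr // -mem_sl dgen_sl.
  have -> : invmx P *m (\sum_i l i *: conj P (dgen i)) *m P = \sum_i l i *: dgen i.
    rewrite mulmx_sumr mulmx_suml; apply: eq_bigr => j _.
    rewrite -scalemxAr -scalemxAl; congr (_ *: _).
    by have := conjK (dgen j) Pu; rewrite [LHS]conjE invmxK.
  apply/is_diag_mxP => a b ab; rewrite summxE big1 // => j _; rewrite mxE.
  by have /is_diag_mxP -> := dgen_diag j; rewrite ?mulr0.
have Es : invmx P *m x *m P = conj (invmx P) x by rewrite conjE invmxK.
rewrite Es in xd; have ds : conj (invmx P) x \in sl4.
  by rewrite mem_sl conj_tr ?unitmx_inv // -mem_sl.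
pose D := conj (invmx P) x.
exists (fun j => D (lift ord_max j) (lift ord_max j) - D ord_max ord_max).
rewrite -[LHS](conjKV x Pu) (diag_dgen xd ds) linear_sum.
by apply: eq_bigr => j _; rewrite linearZ.
Qed.

Lemma cartanP W : cartan_subalgebra K 4 W <-> exists2 P, P \in unitmx & W = cartan P.
Proof.
split=> [[P Pu HW]|[P Pu ->]]; exists P => //; last by move=> x; apply: mem_cartan.
by apply/vspaceP => x; rewrite HW mem_cartan.
Qed.

Lemma dgen_free (l : 'I_3 -> K) : \sum_j l j *: dgen j = 0 -> forall j, l j = 0.
Proof.
move=> l0; have n4 : 4%:R != 0 :> K by rewrite pnatr_eq0.
have E a : \sum_j l j * (a == lift ord_max j)%:R = (\sum_j l j) / 4%:R.
  have := congr1 (fun A : M4 => A a a) l0; rewrite summxE mxE.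
  under eq_bigr do rewrite mxE dgenE eqxx mulrBr.
  rewrite sumrB -mulr_suml => /eqP; rewrite subr_eq0 mul1r => /eqP <-.
  by apply: eq_bigr => j _; case: eqP; rewrite ?mulr1 ?mulr0.
have s0 : (\sum_j l j) / 4%:R = 0.
  by rewrite -(E ord_max) big1 // => j _; rewrite (negPf (neq_lift _ _)) mulr0.
move=> j; have := E (lift ord_max j); rewrite s0 (bigD1 j) //= eqxx mulr1 big1 ?addr0 //.
by move=> i ij; rewrite (inj_eq (@lift_inj _ _)) eq_sym (negPf ij) mulr0.
Qed.

Lemma cartan_free P : P \in unitmx -> free [tuple conj P (dgen j) | j < 3].
Proof.
move=> Pu; apply/freeP => l; under eq_bigr do rewrite nth_mktuple -linearZ.
rewrite -linear_sum => /(congr1 (conj (invmx P))); rewrite conjK // linear0.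
exact: dgen_free.
Qed.

Lemma cartan_grassmannian : cartan_subalgebra K 4 `<=` grassmannian sl4 3.
Proof.
move=> _ /cartanP [P Pu ->]; split.
  by apply: span_fam_sub => j; rewrite mem_sl conj_tr // -mem_sl dgen_sl.
by have /eqP H := cartan_free Pu; rewrite [LHS]H size_tuple.
Qed.

Definition commuting W := forall x y, x \in W -> y \in W -> x *m y = y *m x.

Lemma commuting_span n (w : 'I_n -> M4) :
  (forall i j, w i *m w j = w j *m w i) -> commuting <<[seq w i | i : 'I_n]>>%VS.
Proof.
move=> ww x y /span_famP [l ->] /span_famP [l' ->].
rewrite !mulmx_suml; under [RHS]eq_bigr do rewrite mulmx_sumr.
rewrite exchange_big; apply: eq_bigr => i _; rewrite mulmx_sumr; apply: eq_bigr => j _.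
by rewrite -!scalemxAl -!scalemxAr ww !scalerA mulrC.
Qed.

Lemma commuting_closed :
  zariski_closed sl4 3 [set W | grassmannian sl4 3 W /\ commuting W].
Proof.
split=> [W []//|m b c bcU].
pose w (A : 'M[K]_(3, m)) := rows b c A.
exists [set p | exists i j r s, forall A,
  mxeval p A = (w A i *m w A j - w A j *m w A i) r s] => A; split.
  move=> [_ H] p [i [j [r [s ->]]]]; rewrite (H _ _ (mem_span_fam _ i) (mem_span_fam _ j)).
  by rewrite subrr mxE.
move=> H; split; first exact: chart_grassmannian.
apply: commuting_span => i j; apply/eqP; rewrite -subr_eq0; apply/eqP/matrixP => r s.
have SA := mxfun_alg K 3 m.
have SE i' r' s' : mxfun (fun A => w A i' r' s').
  apply: (@funalg_ext _ _ _ (fun A : 'M[K]_(3, m) =>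
    tnth b i' r' s' + \sum_j A i' j * tnth c j r' s')) => [B|].
    by rewrite /w /rows mxE summxE; congr (_ + _); apply: eq_bigr => l _; rewrite mxE.
  apply: (funalgD SA (funalgC SA _)); apply: (funalg_sum SA) => l _.
  by apply: (funalgM SA) (funalgC SA _); apply: mxfun_entry.
have [p Hp] : mxfun (fun A => (w A i *m w A j - w A j *m w A i) r s).
  apply: (@funalg_ext _ _ _ (fun A => (w A i *m w A j) r s - (w A j *m w A i) r s)) => [B|].
    by rewrite [RHS]mxE; congr (_ + _); rewrite [RHS]mxE.
  by apply: (funalgB SA); apply: (funalg_mulmx SA) => *; apply: SE.
by rewrite [RHS]mxE; apply: (etrans (Hp A)); apply: H; exists i, j, r, s.
Qed.

Lemma cartan_commuting P : P \in unitmx -> commuting (cartan P).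
Proof.
move=> Pu; apply: commuting_span => i j.
have E x y : conj P x *m conj P y = conj P (x *m y).
  by rewrite !conjE !mulmxA mulmxKV.
rewrite !E; congr (conj P _).
have /diag_mxP [d ->] := dgen_diag i; have /diag_mxP [e ->] := dgen_diag j.
exact: diag_mxC.
Qed.

Lemma Red_closed : zariski_closed sl4 3 Red4.
Proof. exact: zariski_closureP. Qed.

Lemma cartan_Red P : P \in unitmx -> Red4 (cartan P).
Proof.
move=> Pu; apply: sub_zariski_closure; first exact: cartan_grassmannian.
by apply/cartanP; exists P.
Qed.

Lemma Red_min Z : zariski_closed sl4 3 Z ->
  (forall P, P \in unitmx -> Z (cartan P)) -> Red4 `<=` Z.
Proof. by move=> Zc H; apply: zariski_closure_min => // W /cartanP [P Pu ->]; apply: H. Qed.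

Lemma Red_grassmannian : Red4 `<=` grassmannian sl4 3.
Proof. by case: Red_closed. Qed.

Lemma Red_commuting W : Red4 W -> commuting W.
Proof.
move: W; suff H : Red4 `<=` [set W | grassmannian sl4 3 W /\ commuting W].
  by move=> W /H [].
apply: Red_min => [|P Pu]; first exact: commuting_closed.
by split; [apply/cartan_grassmannian/cartanP; exists P|apply: cartan_commuting].
Qed.

Lemma Red_conj P W : P \in unitmx -> Red4 (conj P @: W)%VS <-> Red4 W.
Proof.
have H Q V : Q \in unitmx -> Red4 V -> Red4 (conj Q @: V)%VS.
  move=> Qu; apply: (limg_closure (conj_ker Qu) (conj_sl Qu)) => _ /cartanP [P' Pu' ->].
  apply/cartanP; exists (Q *m P'); first by rewrite unitmx_mul Qu.
  rewrite /cartan limg_span -map_comp; congr <<_>>%VS; apply: eq_map => j /=.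
  by rewrite conjM.
move=> Pu; split; last exact: H.
by move=> /(H (invmx P)); rewrite unitmx_inv conj_limgK //; apply.
Qed.

(** Each [dgen j] is symmetric, so transposing the Cartan subalgebra of [P] gives that of the
    inverse transpose of [P]. *)
Lemma Red_transp W : Red4 (transp @: W)%VS <-> Red4 W.
Proof.
have H V : Red4 V -> Red4 (transp @: V)%VS.
  apply: (limg_closure transp_ker transp_sl) => _ /cartanP [P Pu ->].
  have Pu' : (invmx P)^T \in unitmx by rewrite unitmx_tr unitmx_inv.
  apply/cartanP; exists (invmx P)^T => //.
  rewrite /cartan limg_span -map_comp; congr <<_>>%VS; apply: eq_map => j /=.
  rewrite transpE !conjE !trmx_mul -[invmx _^T]trmx_inv invmxK mulmxA; congr (_ *m _ *m _).
  by rewrite linearB /= trmx_delta tr_scalar_mx.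
by split; [move=> /H; rewrite transpK|apply: H].
Qed.

End Reductions.

(** * The chart centred at E13, E14, E24 *)

Section GammaEquations.
Variable K : numClosedFieldType.
Local Notation M4 := 'M[K]_4.

Definition mx4 (s : seq (seq K)) : M4 := \matrix_(i, j) nth 0 (nth [::] s i) j.

Local Notation o4 k := (@Ordinal 4 k isT).

(* The rows list the chart coordinates of the basis matrices x, y, z congruent to
   E13, E14, E24, normalized to have entry (4, 4) equal to 0 instead of trace 0.
   With h = (3, 1, -1, -3), give the coordinate along E_ij of the basis matrix
   attached to E_ab the weight (h_a - h_b) - (h_i - h_j), which is always
   positive: the commutation equations are homogeneous, and solving them by
   increasing weight yields the formulas below. *)
Definition gamma_rows (x12 x23 x34 z12 z23 x11 x33 y23 z11 z22 x43 y11 : K) : seq (seq K) :=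
  let z34 := - x12 in
  let y34 := - x11 in
  let y12 := z11 in
  let x22 := - (x23 * z34) + x34 * z23 in
  let z33 := - (x12 * z23) + x23 * z12 + z11 in
  let x21 := - (x23 * y34) + x34 * y23 in
  let x32 := - (x33 * z34) + x34 * z33 in
  let z43 := - (y12 * z23) + y23 * z12 in
  let y33 := - (x12 * y23) + x23 * y12 + x43 + y11 in
  let z32 := - (x11 * z12) + x12 * z11 - x12 * z22 + x22 * z12 in
  let z21 := x22 * z23 - x23 * z22 + x23 * z33 - x33 * z23 - x43 in
  let y22 := - (y23 * z34) + y34 * z23 + z21 in
  let x31 := - (x33 * y34) + x34 * y33 in
  let z31 := - (x12 * z21) + x21 * z12 in
  let x42 := x34 * z43 - x43 * z34 in
  let y32 := - (y33 * z34) + y34 * z33 + z31 in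
  let y21 := x22 * y23 - x23 * y22 + x23 * y33 - x33 * y23 in
  let z42 := - (y11 * z12) + y12 * z11 - y12 * z22 + y22 * z12 in
  let y43 := y22 * z23 - y23 * z22 + y23 * z33 - y33 * z23 in
  let x41 := x34 * y43 - x43 * y34 in
  let z41 := - (y12 * z21) + y21 * z12 in
  let y31 := - (x12 * y21) + x21 * y12 + x41 in
  let y42 := y34 * z43 - y43 * z34 + z41 in
  let y41 := - (x23 * y42) - x33 * y43 + x42 * y23 + x43 * y33 in
  [:: [:: x11; x22; x33; x12; x21; x23; x32; x31; x41; x42; x43; x34];
      [:: y11; y22; y33; y12; y21; y23; y32; y31; y41; y42; y43; y34];
      [:: z11; z22; z33; z12; z21; z23; z32; z31; z41; z42; z43; z34]].

Lemma eq_of_subr (l r a b : K) : l = r -> a - b = l - r -> a = b.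
Proof. by move=> ->; rewrite subrr => /eqP; rewrite subr_eq0 => /eqP. Qed.

Ltac comm_entry H i j :=
  have := congr1 (fun M : M4 => M (o4 i) (o4 j)) H;
  rewrite !mxE !big_ord_recl !big_ord0 !mxE /=.
Ltac commE H i j :=
  comm_entry H i j; let h := fresh in intro h; apply: (eq_of_subr h); ring.
Ltac commN H i j :=
  comm_entry H i j; let h := fresh in intro h; apply: (eq_of_subr (esym h)); ring.

(** In the commutator entry used at each step the new unknown has coefficient 1 or -1, because it is
    multiplied by an entry 1 of a basis matrix; hence there are no divisions. The 24 entries chosen
    leave 12 of the 36 coordinates free. *)
Lemma gamma_solve (x11 x22 x33 x12 x21 x23 x32 x31 x41 x42 x43 x34
    y11 y22 y33 y12 y21 y23 y32 y31 y41 y42 y43 y34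
    z11 z22 z33 z12 z21 z23 z32 z31 z41 z42 z43 z34 : K) :
  let X := mx4 [:: [:: x11; x12; 1; 0]; [:: x21; x22; x23; 0];
    [:: x31; x32; x33; x34]; [:: x41; x42; x43; 0]] in
  let Y := mx4 [:: [:: y11; y12; 0; 1]; [:: y21; y22; y23; 0];
    [:: y31; y32; y33; y34]; [:: y41; y42; y43; 0]] in
  let Z := mx4 [:: [:: z11; z12; 0; 0]; [:: z21; z22; z23; 1];
    [:: z31; z32; z33; z34]; [:: z41; z42; z43; 0]] in
  X *m Y = Y *m X -> X *m Z = Z *m X -> Y *m Z = Z *m Y ->
  [:: [:: x11; x22; x33; x12; x21; x23; x32; x31; x41; x42; x43; x34];
      [:: y11; y22; y33; y12; y21; y23; y32; y31; y41; y42; y43; y34];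
      [:: z11; z22; z33; z12; z21; z23; z32; z31; z41; z42; z43; z34]] =
  gamma_rows x12 x23 x34 z12 z23 x11 x33 y23 z11 z22 x43 y11.
Proof.
move=> X Y Z Hxy Hxz Hyz.
have Ez34 : z34 = - x12 by commE Hxz 0%N 3%N.
have Ey34 : y34 = - x11 by commE Hxy 0%N 3%N.
have Ey12 : y12 = z11 by commE Hyz 0%N 3%N.
have Ex22 : x22 = - (x23 * z34) + x34 * z23 by commE Hxz 1%N 3%N.
have Ez33 : z33 = - (x12 * z23) + x23 * z12 + z11 by commE Hxz 0%N 2%N.
have Ex21 : x21 = - (x23 * y34) + x34 * y23 by commE Hxy 1%N 3%N.
have Ex32 : x32 = - (x33 * z34) + x34 * z33 by commE Hxz 2%N 3%N.
have Ez43 : z43 = - (y12 * z23) + y23 * z12 by commE Hyz 0%N 2%N.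
have Ey33 : y33 = - (x12 * y23) + x23 * y12 + x43 + y11 by commE Hxy 0%N 2%N.
have Ez32 : z32 = - (x11 * z12) + x12 * z11 - x12 * z22 + x22 * z12 by commE Hxz 0%N 1%N.
have Ez21 : z21 = x22 * z23 - x23 * z22 + x23 * z33 - x33 * z23 - x43 by commN Hxz 1%N 2%N.
have Ey22 : y22 = - (y23 * z34) + y34 * z23 + z21 by commE Hyz 1%N 3%N.
have Ex31 : x31 = - (x33 * y34) + x34 * y33 by commE Hxy 2%N 3%N.
have Ez31 : z31 = - (x12 * z21) + x21 * z12 by commE Hxz 0%N 0%N.
have Ex42 : x42 = x34 * z43 - x43 * z34 by commE Hxz 3%N 3%N.
have Ey32 : y32 = - (y33 * z34) + y34 * z33 + z31 by commE Hyz 2%N 3%N.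
have Ey21 : y21 = x22 * y23 - x23 * y22 + x23 * y33 - x33 * y23 by commN Hxy 1%N 2%N.
have Ez42 : z42 = - (y11 * z12) + y12 * z11 - y12 * z22 + y22 * z12 by commE Hyz 0%N 1%N.
have Ey43 : y43 = y22 * z23 - y23 * z22 + y23 * z33 - y33 * z23 by commN Hyz 1%N 2%N.
have Ex41 : x41 = x34 * y43 - x43 * y34 by commE Hxy 3%N 3%N.
have Ez41 : z41 = - (y12 * z21) + y21 * z12 by commE Hyz 0%N 0%N.
have Ey31 : y31 = - (x12 * y21) + x21 * y12 + x41 by commE Hxy 0%N 0%N.
have Ey42 : y42 = y34 * z43 - y43 * z34 + z41 by commE Hyz 3%N 3%N.
have Ey41 : y41 = - (x23 * y42) - x33 * y43 + x42 * y23 + x43 * y33 by commN Hxy 3%N 2%N.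
by subst z34 y34 y12 x22 z33 x21 x32 z43 y33 z32 z21 y22 x31 z31 x42 y32
  y21 z42 y43 x41 z41 y31 y42 y41.
Qed.

(** The converse of [gamma_solve]: the 24 selected equations force all 48 entries of the three
    commutators to vanish, as polynomial identities in the free coordinates. *)
Lemma gamma_commute (x11 x22 x33 x12 x21 x23 x32 x31 x41 x42 x43 x34
    y11 y22 y33 y12 y21 y23 y32 y31 y41 y42 y43 y34
    z11 z22 z33 z12 z21 z23 z32 z31 z41 z42 z43 z34 : K) :
  let X := mx4 [:: [:: x11; x12; 1; 0]; [:: x21; x22; x23; 0];
    [:: x31; x32; x33; x34]; [:: x41; x42; x43; 0]] in
  let Y := mx4 [:: [:: y11; y12; 0; 1]; [:: y21; y22; y23; 0];
    [:: y31; y32; y33; y34]; [:: y41; y42; y43; 0]] in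
  let Z := mx4 [:: [:: z11; z12; 0; 0]; [:: z21; z22; z23; 1];
    [:: z31; z32; z33; z34]; [:: z41; z42; z43; 0]] in
  z34 = - x12 ->
  y34 = - x11 ->
  y12 = z11 ->
  x22 = - (x23 * z34) + x34 * z23 ->
  z33 = - (x12 * z23) + x23 * z12 + z11 ->
  x21 = - (x23 * y34) + x34 * y23 ->
  x32 = - (x33 * z34) + x34 * z33 ->
  z43 = - (y12 * z23) + y23 * z12 ->
  y33 = - (x12 * y23) + x23 * y12 + x43 + y11 ->
  z32 = - (x11 * z12) + x12 * z11 - x12 * z22 + x22 * z12 ->
  z21 = x22 * z23 - x23 * z22 + x23 * z33 - x33 * z23 - x43 ->
  y22 = - (y23 * z34) + y34 * z23 + z21 ->
  x31 = - (x33 * y34) + x34 * y33 ->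
  z31 = - (x12 * z21) + x21 * z12 ->
  x42 = x34 * z43 - x43 * z34 ->
  y32 = - (y33 * z34) + y34 * z33 + z31 ->
  y21 = x22 * y23 - x23 * y22 + x23 * y33 - x33 * y23 ->
  z42 = - (y11 * z12) + y12 * z11 - y12 * z22 + y22 * z12 ->
  y43 = y22 * z23 - y23 * z22 + y23 * z33 - y33 * z23 ->
  x41 = x34 * y43 - x43 * y34 ->
  z41 = - (y12 * z21) + y21 * z12 ->
  y31 = - (x12 * y21) + x21 * y12 + x41 ->
  y42 = y34 * z43 - y43 * z34 + z41 ->
  y41 = - (x23 * y42) - x33 * y43 + x42 * y23 + x43 * y33 ->
  [/\ X *m Y = Y *m X, X *m Z = Z *m X & Y *m Z = Z *m Y].
Proof.
move=> X Y Z Ez34 Ey34 Ey12 Ex22 Ez33 Ex21 Ex32 Ez43 Ey33 Ez32 Ez21 Ey22 Ex31 Ez31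
  Ex42 Ey32 Ey21 Ez42 Ey43 Ex41 Ez41 Ey31 Ey42 Ey41.
split; apply/matrixP => -[[|[|[|[|//]]]] ?] -[[|[|[|[|//]]]] ?];
  rewrite !mxE !big_ord_recl !big_ord0 !mxE /= {X Y Z};
  subst; ring.
Qed.

End GammaEquations.

Section GammaChart.
Variable K : numClosedFieldType.
Local Notation M4 := 'M[K]_4.
Local Notation o3 k := (@Ordinal 3 k isT).
Local Notation o12 k := (@Ordinal 12 k isT).

Definition gamma (v : 'I_12 -> K) : 'M[K]_(3, 12) :=
  \matrix_(i, j) nth 0 (nth [::] (gamma_rows (v (o12 0)) (v (o12 1)) (v (o12 2))
    (v (o12 3)) (v (o12 4)) (v (o12 5)) (v (o12 6)) (v (o12 7)) (v (o12 8))
    (v (o12 9)) (v (o12 10)) (v (o12 11))) i) j.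

(** Together with [free_col], the place in [gamma v] at which the parameter [v l] stands
    unchanged. *)
Definition free_row (l : 'I_12) : 'I_3 :=
  nth ord0 [:: o3 0; o3 0; o3 0; o3 2; o3 2; o3 0; o3 0; o3 1; o3 2; o3 2; o3 0; o3 1] l.
Definition free_col (l : 'I_12) : 'I_12 :=
  nth ord0 [:: o12 3; o12 5; o12 11; o12 3; o12 5; o12 0; o12 2; o12 5; o12 0; o12 1;
               o12 10; o12 0] l.

Lemma gamma_coord v l : gamma v (free_row l) (free_col l) = v l.
Proof.
by rewrite mxE; case: l; do 12 ?[case=> [?|]; first by congr v; apply: val_inj].
Qed.

Lemma gamma_mpolyfun i j : mpolyfun (fun v => gamma v i j).
Proof.
have SA := mpolyfun_alg K 12.
apply: (@funalg_ext _ _ _ (fun v => nth 0 (nth [::] (gamma_rows (v (o12 0)) (v (o12 1)) (v (o12 2))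
    (v (o12 3)) (v (o12 4)) (v (o12 5)) (v (o12 6)) (v (o12 7)) (v (o12 8))
    (v (o12 9)) (v (o12 10)) (v (o12 11))) i) j)) => [v|]; first by rewrite mxE.
case: i => -[|[|[|//]]] ? /=; case: j; do 12 ?[case=> [?|] /=;
  first by repeat first [exact: mpolyfun_coord | apply: (funalgD SA) | apply: (funalgN SA)
                        | apply: (funalgM SA)]];
  by [].
Qed.

Definition chart_mx (A : 'M[K]_(3, 12)) (i : 'I_3) : M4 := mx4
  [:: [:: A i (o12 0); A i (o12 3); (i == 0%N :> nat)%:R; (i == 1%N :> nat)%:R];
      [:: A i (o12 4); A i (o12 1); A i (o12 5); (i == 2%N :> nat)%:R];
      [:: A i (o12 7); A i (o12 6); A i (o12 2); A i (o12 11)];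
      [:: A i (o12 8); A i (o12 9); A i (o12 10); 0]].

Lemma commuting_gamma A :
  (forall i j, chart_mx A i *m chart_mx A j = chart_mx A j *m chart_mx A i) ->
  A = gamma (fun l => A (free_row l) (free_col l)).
Proof.
move=> H; have E := gamma_solve (H (o3 0) (o3 1)) (H (o3 0) (o3 2)) (H (o3 1) (o3 2)).
apply/matrixP => i j; rewrite mxE.
have := congr1 (fun s => nth 0 (nth [::] s i) j) E; set g := gamma_rows _ _ _ _ _ _ _ _ _ _ _ _.
move=> h; rewrite -[RHS]h {E h g}.
by case: i => -[|[|[|//]]] p; case: j; do 12 ?[case=> [?|];
  first by congr (A _ _); apply: val_inj].
Qed.

Lemma gamma_commuting v i j :
  chart_mx (gamma v) i *m chart_mx (gamma v) j = chart_mx (gamma v) j *m chart_mx (gamma v) i.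
Proof.
have := @gamma_commute K (v (o12 5)) _ (v (o12 6)) (v (o12 0)) _ (v (o12 1)) _ _ _ _
  (v (o12 10)) (v (o12 2)) (v (o12 11)) _ _ _ _ (v (o12 7)) _ _ _ _ _ _
  (v (o12 8)) (v (o12 9)) _ (v (o12 3)) _ (v (o12 4)) _ _ _ _ _ _
  erefl erefl erefl erefl erefl erefl erefl erefl erefl erefl erefl erefl
  erefl erefl erefl erefl erefl erefl erefl erefl erefl erefl erefl erefl.
rewrite /chart_mx !mxE => -[HXY HXZ HYZ].
case: i => -[|[|[|//]]] p; case: j => -[|[|[|//]]] q //.
Qed.

End GammaChart.

Section GammaBasis.
Variable K : numClosedFieldType.
Local Notation M4 := 'M[K]_4.
Local Notation sl4 := (sl K 4).
Local Notation Red4 := (Red K 4).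
Local Notation o4 k := (@Ordinal 4 k isT).
Local Notation o3 k := (@Ordinal 3 k isT).
Local Notation o12 k := (@Ordinal 12 k isT).

Lemma ord3_ind (P : 'I_3 -> Prop) : P (o3 0) -> P (o3 1) -> P (o3 2) -> forall i, P i.
Proof.
move=> P0 P1 P2 [[|[|[|//]]] p].
- by have -> : Ordinal p = o3 0 by apply: val_inj.
- by have -> : Ordinal p = o3 1 by apply: val_inj.
- by have -> : Ordinal p = o3 2 by apply: val_inj.
Qed.

Lemma ord4_ind (P : 'I_4 -> Prop) :
  P (o4 0) -> P (o4 1) -> P (o4 2) -> P (o4 3) -> forall i, P i.
Proof.
move=> P0 P1 P2 P3 [[|[|[|[|//]]]] p].
- by have -> : Ordinal p = o4 0 by apply: val_inj.
- by have -> : Ordinal p = o4 1 by apply: val_inj.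
- by have -> : Ordinal p = o4 2 by apply: val_inj.
- by have -> : Ordinal p = o4 3 by apply: val_inj.
Qed.

Lemma sum3 (F : 'I_3 -> K) : \sum_i F i = F (o3 0) + F (o3 1) + F (o3 2).
Proof.
rewrite !big_ord_recl big_ord0 addr0 !addrA.
by congr (_ + _ + _); congr F; apply: val_inj.
Qed.

Lemma sum4 (F : 'I_4 -> K) : \sum_i F i = F (o4 0) + F (o4 1) + F (o4 2) + F (o4 3).
Proof.
rewrite !big_ord_recl big_ord0 addr0 !addrA.
by congr (_ + _ + _ + _); congr F; apply: val_inj.
Qed.

Lemma sum12 (F : 'I_12 -> K) : \sum_i F i = F (o12 0) + F (o12 1) + F (o12 2) + F (o12 3)
  + F (o12 4) + F (o12 5) + F (o12 6) + F (o12 7) + F (o12 8) + F (o12 9) + F (o12 10)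
  + F (o12 11).
Proof.
rewrite !big_ord_recl big_ord0 addr0 !addrA.
by do 11 ?[congr (_ + _)]; congr F; apply: val_inj.
Qed.

Definition brow (i : 'I_3) : 'I_4 := nth ord0 [:: o4 0; o4 0; o4 1] i.
Definition bcol (i : 'I_3) : 'I_4 := nth ord0 [:: o4 2; o4 3; o4 3] i.
Definition crow (j : 'I_12) : 'I_4 :=
  nth ord0 [:: o4 0; o4 1; o4 2; o4 0; o4 1; o4 1; o4 2; o4 2; o4 3; o4 3; o4 3; o4 2] j.
Definition ccol (j : 'I_12) : 'I_4 :=
  nth ord0 [:: o4 0; o4 1; o4 2; o4 1; o4 0; o4 2; o4 1; o4 0; o4 0; o4 1; o4 2; o4 3] j.

Definition b0 : 3.-tuple M4 := [tuple delta_mx (brow i) (bcol i) | i < 3].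
Definition c0 : 12.-tuple M4 :=
  [tuple delta_mx (crow j) (ccol j) - (if (j < 3)%N then 4%:R^-1 else 0)%:M | j < 12].

Lemma rows_chart_mx A i : rows b0 c0 A i =
  chart_mx A i - ((A i (o12 0) + A i (o12 1) + A i (o12 2)) / 4%:R)%:M.
Proof.
apply/matrixP => p q; rewrite /rows !mxE summxE sum12 !tnth_mktuple !mxE.
elim/ord3_ind: i; elim/ord4_ind: p; elim/ord4_ind: q => /=; ring.
Qed.

Lemma sl_decomp x : x \in sl4 -> x =
  \sum_i x (brow i) (bcol i) *: tnth b0 i +
  \sum_j (x (crow j) (ccol j) - (if (j < 3)%N then x (o4 3) (o4 3) else 0)) *: tnth c0 j.
Proof.
rewrite mem_sl /mxtrace sum4 => /eqP tr0.
have n4 : 4%:R != 0 :> K by rewrite pnatr_eq0.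
have x33 : x (o4 3) (o4 3) = - (x (o4 0) (o4 0) + x (o4 1) (o4 1) + x (o4 2) (o4 2)).
  by apply/eqP; rewrite -addr_eq0 addrC tr0.
apply/matrixP => p q; rewrite mxE !summxE sum12 sum3 !mxE !tnth_mktuple !mxE.
elim/ord4_ind: p; elim/ord4_ind: q => /=; rewrite ?x33; by field.
Qed.

Lemma dim_sl : (15 <= \dim sl4)%N.
Proof.
set f := linfun (@mxtrace K 4 : M4 -> K^o).
have : (\dim (limg f) <= 1)%N by apply: leq_trans (dimvS (subvf _)) _; rewrite dimvf.
have : (\dim (lker f) + \dim (limg f) = 16)%N.
  by have := limg_ker_dim f fullv; rewrite capfv => ->; rewrite dimvf.
move=> E L; change (15 <= \dim (lker f))%N.
by rewrite -(leq_add2r (\dim (limg f))) E -[16%N]/(15 + 1)%N leq_add2l.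
Qed.

Lemma bc0_basis : basis_of sl4 (b0 ++ c0).
Proof.
rewrite basisEdim; apply/andP; split; last first.
  by rewrite size_cat !size_tuple dim_sl.
apply/subvP => x /sl_decomp ->; apply: memvD; apply: memv_suml => i _; apply: memvZ;
  by apply: memv_span; rewrite mem_cat mem_tnth ?orbT.
Qed.

Lemma bmx0E (w : 'I_3 -> M4) i j : w i \in sl4 -> bmx b0 c0 w i j = w i (brow j) (bcol j).
Proof.
move=> /(bc_decomp bc0_basis); move: (bmx b0 c0 w) (cmx b0 c0 w) => B C ->.
rewrite [RHS]mxE !summxE sum12 sum3 !mxE !tnth_mktuple !mxE.
by elim/ord3_ind: j => /=; rewrite !mulr0n !subr0 !mulr0 !addr0 mulr1 ?add0r.
Qed.

Lemma chart_commuting A : commuting (chart b0 c0 A) <->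
  forall i j, chart_mx A i *m chart_mx A j = chart_mx A j *m chart_mx A i.
Proof.
have E x y (s t : K) : (x - s%:M) *m (y - t%:M) - (y - t%:M) *m (x - s%:M) =
    x *m y - y *m x :> M4.
  rewrite !mulmxBl !mulmxBr !mul_scalar_mx !mul_mx_scalar.
  move: (x *m y) (y *m x) => a b; apply/matrixP => p q; rewrite !mxE; ring.
split=> [H i j|H].
  have := H _ _ (mem_span_fam _ i) (mem_span_fam _ j); rewrite -/(rows _ _).
  rewrite -!/(rows b0 c0 A _) !rows_chart_mx => /eqP; rewrite -subr_eq0 E subr_eq0.
  by move/eqP.
apply: commuting_span => i j; rewrite -!/(rows b0 c0 A _) !rows_chart_mx.
by apply/eqP; rewrite -subr_eq0 E H subrr.
Qed.

Lemma Red_chart_gamma A : Red4 (chart b0 c0 A) ->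
  A = gamma (fun l => A (free_row l) (free_col l)).
Proof. by move=> /Red_commuting /chart_commuting /commuting_gamma. Qed.

End GammaBasis.

(** * Centralizers of matrices with distinct eigenvalues *)

Section RedGamma.
Variable K : numClosedFieldType.
Local Notation M4 := 'M[K]_4.
Local Notation sl4 := (sl K 4).

Lemma char_poly_conj (P A : M4) : P \in unitmx ->
  char_poly (P *m A *m invmx P) = char_poly A.
Proof.
move=> Pu; rewrite /char_poly.
have -> : char_poly_mx (P *m A *m invmx P) =
    map_mx polyC P *m char_poly_mx A *m map_mx polyC (invmx P).
  rewrite /char_poly_mx mulmxBr mulmxBl !map_mxM; congr (_ - _).
  rewrite mul_mx_scalar -scalemxAl -map_mxM mulmxV // map_mx1.
  by rewrite scalemx1.
rewrite !det_mulmx mulrAC -det_mulmx -map_mxM mulmxV // map_mx1 det1 mul1r.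
by [].
Qed.

Lemma separable_diag (X : M4) : separable_poly (char_poly X) ->
  exists2 P : M4, P \in unitmx & exists2 d : 'rV[K]_4,
    X = conj P (diag_mx d) & injective (fun i => d 0 i).
Proof.
move=> sepX; have [rs Hrs] := closed_field_poly_normal (char_poly X).
rewrite (eqP (char_poly_monic X)) scale1r in Hrs.
have urs : uniq rs by rewrite -separable_prod_XsubC -Hrs.
have [P0 P0u /(diagonalizable_forLR P0u) [d Xd]] : diagonalizable X.
  by apply/diagonalizableP; exists rs => //; rewrite -Hrs mxminpoly_dvd_char.
have Pu : invmx P0 \in unitmx by rewrite unitmx_inv.
have E : X = conj (invmx P0) (diag_mx d) by rewrite Xd conjE mxpoly.conjumx.
exists (invmx P0) => //; exists d => // i j dij.
have cd : char_poly X = \prod_(x <- [seq d 0 i | i : 'I_4]) ('X - x%:P).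
  rewrite E conjE char_poly_conj // char_poly_trig ?diag_mx_is_trig //.
  rewrite big_image /=; apply: eq_bigr => l _; rewrite mxE eqxx mulr1n //.
move: sepX; rewrite cd separable_prod_XsubC.
by move=> /fintype.injectiveP; apply.
Qed.
(** The centralizer of [X] consists of the matrices diagonal in its eigenbasis, and the dimension 3
    of [W] leaves only the Cartan subalgebra. [X] is not taken in [W], since the normalized matrices
    [chart_mx] to which this is applied need not be traceless. *)
Lemma cartan_of_separable W (X : M4) : grassmannian sl4 3 W -> separable_poly (char_poly X) ->
  (forall w, w \in W -> w *m X = X *m w) -> exists2 P, P \in unitmx & W = cartan P.
Proof.
move=> [WU dW] /separable_diag [P Pu [d XE dinj]] WX; exists P => //.
apply/eqP; rewrite eqEdim dW; apply/andP; split; last first.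
  by have [_ ->] := cartan_grassmannian (proj2 (cartanP _) (ex_intro2 _ _ P Pu erefl)).
apply/subvP => w wW; rewrite mem_cartan // (subvP WU) //=.
set D := invmx P *m w *m P; have wE : w = conj P D.
  by rewrite conjE /D !mulmxA mulmxV // mul1mx mulmxK.
have /matrixP comm : D *m diag_mx d = diag_mx d *m D.
  have := WX w wW; rewrite XE wE !conjE !mulmxA !(mulmxKV Pu) => /(congr1 (mulmx^~ P)).
  rewrite !mulmxKV // -!mulmxA => /(congr1 (mulmx (invmx P))).
  by rewrite !mulKmx.
apply/is_diag_mxP => i j ij; have := comm i j.
rewrite mul_mx_diag mul_diag_mx !mxE => /eqP.
rewrite mulrC -subr_eq0 -mulrBl mulf_eq0 subr_eq0 => /orP [/eqP /dinj ji|/eqP //].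
by rewrite ji eqxx in ij.
Qed.

Lemma curve_matrix (F : K -> M4) : (forall i j, poly1fun (fun t => F t i j)) ->
  exists G : 'M[{poly K}]_4, forall t, map_mx (horner_eval t) G = F t.
Proof.
move=> H; have /fin_all_exists [G HG] : forall i, exists G : 'I_4 -> {poly K},
    forall j t, F t i j = (G j).[t].
  move=> i; apply: (@fin_all_exists _ (fun=> {poly K})
      (fun j p => forall t, F t i j = p.[t])) => j; exact: H.
by exists (\matrix_(i, j) G i j) => t; apply/matrixP => i j; rewrite !mxE HG.
Qed.

(** Up to a nonzero factor, the discriminant of the characteristic polynomial along the curve
    [G]. *)
Definition disc (G : 'M[{poly K}]_4) : {poly K} :=
  resultant (char_poly G) (char_poly G)^`().

Lemma discE (G : 'M[{poly K}]_4) t :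
  ((disc G).[t] != 0) = separable_poly (char_poly (map_mx (horner_eval t) G)).
Proof.
(* The resultant commutes with evaluation at [t] because the two leading coefficients, 1 and 4, stay
   nonzero there. *)
have lead : lead_coef (char_poly G) = 1 by apply/monicP/char_poly_monic.
have n4 : 4%:R != 0 :> K by rewrite pnatr_eq0.
have slead : lead_coef (char_poly G)^`() = 4%:R.
  have := size_char_poly G; move: lead; rewrite !lead_coefE => lead sG.
  have G4 : (char_poly G)^`()`_3 = 4%:R.
    by rewrite coef_deriv; move: lead; rewrite sG /= => ->.
  have sd : size (char_poly G)^`() = 4%N.
    apply/eqP; rewrite eqn_leq; apply/andP; split.
      by have := lt_size_deriv (monic_neq0 (char_poly_monic G)); rewrite sG.
    rewrite ltnNge; apply/negP => s3; have := nth_default 0 s3; rewrite G4.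
    by apply/eqP; rewrite -polyC_natr polyC_eq0.
  by rewrite sd.
have := map_resultant (f := horner_eval t) (p := char_poly G) (q := (char_poly G)^`()).
rewrite lead slead rmorph1 rmorph_nat oner_eq0 n4 => /(_ isT isT) E.
rewrite -[(disc G).[t]]/(horner_eval t (disc G)) /disc E resultant_eq0.
rewrite -deriv_map map_char_poly unlock /separable_poly /coprimep -leqNgt.
by rewrite leq_eqVlt ltnS leqn0 size_poly_eq0 gcdp_eq0 -size_poly_eq0 size_char_poly orbF.
Qed.

End RedGamma.

(** * Red(4) inside the chart, and density of the chart *)

Section RedChart.
Variable K : numClosedFieldType.
Local Open Scope classical_set_scope.
Local Notation M4 := 'M[K]_4.
Local Notation sl4 := (sl K 4).
Local Notation Red4 := (Red K 4).
Local Notation o3 k := (@Ordinal 3 k isT).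
Local Notation b0 := (b0 K).
Local Notation c0 := (c0 K).

Lemma gamma_cartan v : separable_poly (char_poly (chart_mx (@gamma K v) (o3 0))) ->
  exists2 P, P \in unitmx & chart b0 c0 (gamma v) = cartan P.
Proof.
move=> sep; apply: (cartan_of_separable _ sep).
  exact: chart_grassmannian (bc0_basis K) _.
move=> w /span_famP [l ->]; rewrite mulmx_suml mulmx_sumr; apply: eq_bigr => i _.
rewrite -scalemxAl -scalemxAr -/(rows b0 c0 (gamma v) i) rows_chart_mx.
by rewrite mulmxBl mulmxBr gamma_commuting mul_scalar_mx mul_mx_scalar.
Qed.

(* A point of the chart at which the first basis matrix is upper triangular with
   diagonal (2, 1, 3, 0). *)
Definition gamma_pt (l : 'I_12) : K :=
  nth 0 [:: 1; 1; 1; 0; 0; 2%:R; 3%:R; - 2%:R; - 3%:R; - 3%:R; 0; - 5%:R] l.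

Lemma gamma_pt_separable : separable_poly (char_poly (chart_mx (gamma gamma_pt) (o3 0))).
Proof.
set X := chart_mx _ _.
(* The values -2, -3, -5, -3 of the coordinates y23, z11, y11, z22 in [gamma_pt] are the ones that
   make x21, x32, x31, x41 vanish in turn. *)
have XE : X = mx4 [:: [:: 2%:R; 1; 1; 0]; [:: 0; 1; 1; 0]; [:: 0; 0; 3%:R; 1]; [:: 0; 0; 0; 0]].
  apply/matrixP => p q; rewrite /X /chart_mx !mxE /gamma_pt.
  by elim/ord4_ind: p; elim/ord4_ind: q => /=; ring.
have <- : char_poly X^T = char_poly X.
  rewrite /char_poly -[RHS]det_tr; congr (\det _); rewrite /char_poly_mx linearB /=.
  by rewrite tr_scalar_mx map_trmx.
rewrite char_poly_trig; last first.
  apply/is_trig_mxP => p q; rewrite XE !mxE.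
  by elim/ord4_ind: p; elim/ord4_ind: q.
have -> : \prod_(i < 4) ('X - (X^T i i)%:P) =
    \prod_(x <- [:: 2%:R; 1%:R; 3%:R; 0%:R]) ('X - x%:P) :> {poly K}.
  rewrite !big_cons big_nil !big_ord_recl big_ord0.
  by rewrite XE !mxE /=.
rewrite separable_prod_XsubC /= !inE !eqr_nat //.
Qed.

(* On the line joining [v] to [gamma_pt], the matrices of the family generically
   have distinct eigenvalues. *)
Lemma gamma_Red v : Red4 (chart b0 c0 (gamma v)).
Proof.
have gm i j := @gamma_mpolyfun K i j.
pose d l := gamma_pt l - v l.
have [|G HG] := @curve_matrix _ (fun t => chart_mx (gamma (fun l => v l + t * d l)) (o3 0)).
  have S1 := poly1fun_alg K.
  have Sg i j : poly1fun (fun t => gamma (fun l => v l + t * d l) i j).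
    exact: (mpolyfun_line v d (gm i j)).
  move=> p q; rewrite /chart_mx.
  elim/ord4_ind: p; elim/ord4_ind: q;
  (apply: (@funalg_ext _ _ _ (fun t => nth 0 (nth [::] _ _) _)) => [t|];
    [by rewrite mxE|] => /=); first [exact: Sg | exact: (funalgC S1)].
apply: (closed_chart_line (bc0_basis K) gm (Red_closed K) (q := disc G) (d := d)).
  apply: contraTneq gamma_pt_separable => G0.
  have := discE G 1; rewrite G0 horner0 eqxx => /esym/negbT; rewrite HG.
  have -> : (fun l => v l + 1 * d l) = gamma_pt; last by [].
  by apply/funext => l; rewrite mul1r addrC subrK.
move=> t; rewrite discE HG => /gamma_cartan [P Pu ->].
exact: cartan_Red.
Qed.

Lemma Red_chart A : Red4 (chart b0 c0 A) <-> exists v, A = gamma v.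
Proof.
split=> [/Red_chart_gamma ->|[v ->]]; last exact: gamma_Red.
by eexists.
Qed.

(* The conjugators of a given Cartan subalgebra and of one lying in the chart are
   joined by a line, and the Cartan subalgebras along it are generically in the
   chart. *)
Lemma Red_gamma_min Y : zariski_closed sl4 3 Y ->
  (forall v, Y (chart b0 c0 (gamma v))) -> Red4 `<=` Y.
Proof.
move=> Yc Yg; apply: Red_min => // P Pu.
have [P1 P1u E1] := gamma_cartan gamma_pt_separable.
pose Pt : 'M[{poly K}]_4 := \matrix_(i, j) ((P i j)%:P + (P1 i j - P i j) *: 'X).
have PtE t : map_mx (horner_eval t) Pt = P + t *: (P1 - P).
  apply/matrixP => i j; rewrite !mxE /horner_eval hornerD hornerC hornerZ hornerX.
  by rewrite mulrC.
(* The adjugate keeps the conjugates polynomial in [t]; the resulting factor is the same determinant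
   for all three and does not change the span. *)
pose G j : 'M[{poly K}]_4 := Pt *m map_mx polyC (dgen K j) *m \adj Pt.
have GE t j : map_mx (horner_eval t) (G j) =
    (P + t *: (P1 - P)) *m dgen K j *m \adj (P + t *: (P1 - P)).
  rewrite /G !map_mxM map_mx_adj PtE -map_mx_comp; congr (_ *m _ *m _).
  by apply/matrixP => a b; rewrite mxE /= /horner_eval hornerC.
pose L := (\max_j \max_a \max_b size (G j a b))%N.
have GL j a b : (size (G j a b) <= L.+2)%N.
  apply: leqW; apply: leqW.
  apply: leq_trans (leq_bigmax (F := fun j => \max_a \max_b size (G j a b))%N j).
  apply: leq_trans (leq_bigmax (F := fun a => \max_b size (G j a b))%N a).
  exact: (leq_bigmax (F := fun b => size (G j a b)) b).
pose w j s : M4 := map_mx (coefp s) (G j).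
have wt t j : curve L w t j = map_mx (horner_eval t) (G j).
  apply/matrixP => a b; rewrite summxE mxE /horner_eval (horner_coef_wide t (GL j a b)).
  by apply: eq_bigr => s _; rewrite !mxE mulrC.
have Gadj t j : P + t *: (P1 - P) \in unitmx ->
    curve L w t j = \det (P + t *: (P1 - P)) *: conj (P + t *: (P1 - P)) (dgen K j).
  move=> Ptu; rewrite wt GE conjE scalemxAr; congr (_ *m _).
  rewrite /invmx Ptu scalerA mulfV ?scale1r //.
  by rewrite -unitfE -unitmxE.
have span_t t : P + t *: (P1 - P) \in unitmx ->
    curve_span L w t = cartan (P + t *: (P1 - P)).
  move=> Ptu; apply: (@span_fam_unit _ _ _ (\det (P + t *: (P1 - P)))%:M).
    by rewrite unitmxE det_scalar unitfE expf_neq0 // -unitfE -unitmxE.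
  move=> i; rewrite Gadj // (bigD1 i) //= big1 ?addr0 ?mxE ?eqxx ?mulr1n //.
  by move=> j ij; rewrite mxE eq_sym (negPf ij) mulr0n scale0r.
have wU j s : w j s \in sl4.
  rewrite mem_sl; have -> : \tr (w j s) = coefp s (\tr (G j)).
    by rewrite /mxtrace linear_sum; apply: eq_bigr => i _; rewrite mxE.
  rewrite /G mxtrace_mulC mulmxA mul_adj_mx mul_scalar_mx mxtraceZ.
  have -> : \tr (map_mx polyC (dgen K j)) = (\tr (dgen K j))%:P.
    by rewrite /mxtrace rmorph_sum; apply: eq_bigr => i _; rewrite mxE.
  have := dgen_sl K j; rewrite mem_sl => /eqP ->.
  by rewrite polyC0 mulr0 linear0.
have P0E : P + 0 *: (P1 - P) = P by rewrite scale0r addr0.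
have P1E : P + 1 *: (P1 - P) = P1 by rewrite scale1r addrC subrK.
(* [\det M] is nonzero at [t] exactly when the span at [t] is in the chart; at 1 this span is the
   Cartan subalgebra belonging to [gamma_pt], which is. *)
pose M : 'M[{poly K}]_3 := \matrix_(i, j) G i (brow j) (bcol j).
have ME t : map_mx (horner_eval t) M = bmx b0 c0 (curve L w t).
  apply/matrixP => i j; rewrite bmx0E ?curve_in // wt !mxE //.
have detE n (A : 'M[{poly K}]_n) t : (\det A).[t] = \det (map_mx (horner_eval t) A).
  by rewrite det_map_mx.
pose q := \det Pt * \det M.
have q0 : q != 0.
  suff: q.[1] != 0 by apply: contraNneq => ->; rewrite horner0.
  rewrite hornerM mulf_neq0 // detE.
    by rewrite PtE P1E -unitfE -unitmxE.
  have P1u' : P + 1 *: (P1 - P) \in unitmx by rewrite P1E.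
  have := span_t 1 P1u'; rewrite P1E -E1 => /(span_chart_inv (bc0_basis K) (curve_in L wU 1)) [Mu _].
  by rewrite ME -unitfE -unitmxE.
have := curve_closed (L := L) wU Yc q0; rewrite span_t P0E //; apply.
  move=> t; rewrite hornerM mulf_eq0 negb_or !detE PtE ME => /andP [dP dM].
  have Ptu : P + t *: (P1 - P) \in unitmx by rewrite unitmxE unitfE.
  have Mu : bmx b0 c0 (curve L w t) \in unitmx by rewrite unitmxE unitfE.
  have E := span_chart (bc0_basis K) (curve_in L wU t) Mu.
  rewrite /curve_span E; have : Red4 (curve_span L w t).
    by rewrite span_t //; apply: cartan_Red.
  by rewrite /curve_span E => /Red_chart [v ->].
apply/freeP => l; under eq_bigr do rewrite nth_mktuple -(curve0 L w) Gadj ?P0E // scalerA mulrC.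
under eq_bigr do rewrite -scalerA.
rewrite -scaler_sumr => /eqP; rewrite scaler_eq0 -[_ == 0 :> K]negbK -unitfE -unitmxE Pu /=.
move=> /eqP l0; have /freeP := cartan_free Pu; apply; rewrite -[RHS]l0.
by apply: eq_bigr => j _; rewrite nth_mktuple.
Qed.

Lemma Red_chain_bound x e Z : irreducible_chain sl4 3 Red4 x e Z -> (e <= 12)%N.
Proof.
apply: (@chain_bound _ _ _ _ _ _ b0 c0 (@gamma K)); first exact: bc0_basis.
  by move=> i j; apply/mpolyfun_polyfun/gamma_mpolyfun.
exact: Red_gamma_min.
Qed.

Lemma Red_smooth P A : P \in unitmx -> Red4 (chart b0 c0 A) ->
  nonsingular sl4 3 Red4 (conj P @: chart b0 c0 A)%VS.
Proof.
move=> Pu /Red_chart [v ->]; rewrite limg_chart.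
apply: (smooth_chart (limg_basis (conj_sl Pu) (bc0_basis K)) (@gamma_mpolyfun K)
         (@gamma_coord K) (Red_closed K)); last exact: Red_chain_bound.
by move=> B; rewrite -limg_chart; split=> [/(Red_conj _ Pu)/Red_chart //|H];
  apply/(Red_conj _ Pu)/Red_chart.
Qed.

End RedChart.

(** * Commuting spaces outside the conjugates of the chart *)

Section Orbits.
Variable K : numClosedFieldType.
Local Notation M4 := 'M[K]_4.
Local Notation sl4 := (sl K 4).
Local Notation b0 := (b0 K).
Local Notation c0 := (c0 K).
Local Notation o4 k := (@Ordinal 4 k isT).
Local Notation o3 k := (@Ordinal 3 k isT).
Implicit Types (W : {vspace M4}) (x y z : M4) (u v : 'cV[K]_4).

(* Some conjugate of [W] has E13, E14, E24 as leading entries, so that it lies in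
   the chart centred at their span. *)
Definition in_cell W := exists2 P : M4, P \in unitmx & forall x, x \in W ->
  conj P x (o4 0) (o4 2) = 0 -> conj P x (o4 0) (o4 3) = 0 -> conj P x (o4 1) (o4 3) = 0 ->
  x = 0.

Lemma unitmx_inj n (T : 'M[K]_n) : (forall a : 'rV_n, a *m T = 0 -> a = 0) -> T \in unitmx.
Proof. by move=> /inj_row_free; rewrite row_free_unit. Qed.

Lemma in_cell_chart W : grassmannian sl4 3 W -> in_cell W ->
  exists2 P : M4, P \in unitmx & exists A, (conj P @: W)%VS = chart b0 c0 A.
Proof.
move=> [WU dW] [P Pu HP]; exists P => //.
have sW : size (vbasis W) == 3 by rewrite size_tuple dW.
pose w := tnth (Tuple sW).
have wW i : w i \in W by apply/vbasis_mem/mem_tnth.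
pose pw i := conj P (w i).
have WE : (conj P @: W)%VS = <<[seq pw i | i : 'I_3]>>%VS.
  rewrite -{1}(span_basis (vbasisP W)) -[X in <<X>>%VS]/(tval (Tuple sW)) -span_fam_tuple.
  by rewrite limg_span -map_comp.
have pU i : pw i \in sl4.
  by rewrite /pw mem_sl conj_tr // -mem_sl (subvP WU).
exists (invmx (bmx b0 c0 pw) *m cmx b0 c0 pw).
rewrite WE; apply: (span_chart (bc0_basis K) pU); apply: unitmx_inj => a aT.
have xW : \sum_i a 0 i *: w i \in W by apply: memv_suml => i _; rewrite memvZ.
have E j : conj P (\sum_i a 0 i *: w i) (brow j) (bcol j) = 0.
  have := congr1 (fun B : 'rV_3 => B 0 j) aT; rewrite !mxE => H; rewrite -[RHS]H.
  rewrite linear_sum summxE; apply: eq_bigr => i _.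
  by rewrite linearZ mxE bmx0E.
have /freeP fw : free (Tuple sW) by rewrite /= (basis_free (vbasisP W)).
apply/rowP => i; rewrite mxE.
apply: (fw (fun i => a 0 i)); rewrite -[RHS](HP _ xW (E (o3 0)) (E (o3 1)) (E (o3 2))).
by apply: eq_bigr => j _; rewrite /w (tnth_nth 0).
Qed.

(** Transposition combined with reversal of the basis ([J]) fixes the position of E14 and exchanges
    those of E13 and E24. *)
Lemma in_cell_transp W : in_cell (transp K @: W)%VS -> in_cell W.
Proof.
move=> [P Pu HP]; pose J : M4 := \matrix_(i, j) (j == rev_ord i)%:R.
have JJ : J *m J = 1%:M.
  apply/matrixP => i j; rewrite !mxE sum4 !mxE.
  by elim/ord4_ind: i; elim/ord4_ind: j => /=; ring.
have [Ju _] := mulmx1_unit JJ.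
have JV : invmx J = J by rewrite -[LHS]mulmx1 -JJ mulKmx.
have Pu' : (invmx P)^T \in unitmx by rewrite unitmx_tr unitmx_inv.
exists (J *m (invmx P)^T); first by rewrite unitmx_mul Ju.
move=> x xW; have -> : conj (J *m (invmx P)^T) x = J *m (conj P x^T)^T *m J.
  rewrite conjM // !conjE JV !trmx_mul trmxK -[invmx _^T]trmx_inv invmxK.
  by rewrite !mulmxA.
have xT : x^T \in (transp K @: W)%VS by rewrite -transpE memv_img.
move: (HP _ xT); move: (conj P x^T) => B H.
have E i j : (J *m B^T *m J) i j = B (rev_ord j) (rev_ord i).
  rewrite !mxE !sum4 !mxE !sum4 !mxE.
  by elim/ord4_ind: i; elim/ord4_ind: j => /=;
    rewrite !(mul0r, mulr0, mul1r, mulr1, add0r, addr0); congr (B _ _); apply: val_inj.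
rewrite !E => H1 H2 H3; apply: trmx_inj; rewrite linear0; apply: H => //.
- by rewrite -[RHS]H3; congr (B _ _); apply: val_inj.
- by rewrite -[RHS]H2; congr (B _ _); apply: val_inj.
- by rewrite -[RHS]H1; congr (B _ _); apply: val_inj.
Qed.

(** In the basis [y *m U], [e], [U], [V], the vanishing of the entries (1, 4) and (2, 4) puts
    [x *m V] in the span of [U] and [V], so that [x] is [d%:M + g *: y]. Its entry (1, 3), the
    coefficient of [y *m U] in [x *m U], is then [g]. Hence [g = 0], and [x] is a traceless
    scalar. *)
Lemma frame_in_cell W (U V : 'cV[K]_4) y : (W <= sl4)%VS -> free [:: y *m U; U; V] ->
  (forall x, x \in W -> x *m V \in <<[:: U; V]>>%VS -> exists d g, x = d%:M + g *: y) ->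
  in_cell W.
Proof.
move=> WU fr HW.
have [||m [c bc]] := @basis_completion _ _ fullv _ [tuple y *m U; U; V].
- exact: fr.
- exact: subvf.
have m1 : m = 1%N.
  have /andP [/eqP E /eqP] := bc; rewrite E dimvf size_cat size_tuple /=.
  by rewrite -[dim _]/4%N size_tuple => -[/esym].
move: c bc; rewrite {}m1 => c bc; pose e := tnth c 0.
have cE : tval c = [:: e] by rewrite /e; case: (c) => -[|a [|? ?]] //= i; rewrite (tnth_nth a).
pose col_of j := nth 0 [:: y *m U; e; U; V] j.
pose P : M4 := \matrix_(i, j) col_of j i 0.
have Pa (a : 'cV[K]_4) : P *m a = a (o4 0) 0 *: (y *m U) + a (o4 1) 0 *: e
     + a (o4 2) 0 *: U + a (o4 3) 0 *: V.
  apply/colP => i; rewrite !mxE sum4 !mxE /col_of /=; ring.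
have Pu : P \in unitmx.
  rewrite -unitmx_tr; apply: unitmx_inj => a /(congr1 trmx).
  rewrite trmx_mul trmxK linear0 Pa !mxE => E.
  have /freeP : free [tuple y *m U; U; V; e] by have := basis_free bc; rewrite /= cE.
  move=> /(_ (fun i => nth 0 [:: a 0 (o4 0); a 0 (o4 2); a 0 (o4 3); a 0 (o4 1)] i)) H.
  have {}H : forall i : 'I_4, nth 0 [:: a 0 (o4 0); a 0 (o4 2); a 0 (o4 3); a 0 (o4 1)] i = 0.
    apply: H; rewrite !big_ord_recl big_ord0 /= addr0 -[RHS]E.
    by rewrite !addrA addrAC; congr (_ + _); apply: addrAC.
  apply/rowP => i; rewrite mxE; elim/ord4_ind: i.
  - exact: (H (o4 0)).
  - exact: (H (o4 3)).
  - exact: (H (o4 1)).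
  - exact: (H (o4 2)).
exists (invmx P); first by rewrite unitmx_inv.
have cP x i j : conj (invmx P) x i j = (invmx P *m (x *m col j P)) i 0.
  rewrite conjE invmxK mulmxA [LHS]mxE [RHS]mxE; apply: eq_bigr => l _.
  by congr (_ * _); rewrite [RHS]mxE.
have colP j : col j P = col_of j by apply/colP => i; rewrite !mxE.
move=> x xW; rewrite !cP !colP /col_of /= => z02 z03 z13.
have /HW : x *m V \in <<[:: U; V]>>%VS.
  rewrite -(mulKVmx Pu (x *m V)) Pa z03 z13 !scale0r !add0r.
  by rewrite memvD // memvZ // memv_span // !inE eqxx ?orbT.
move=> /(_ xW) [d [g xE]].
have gU : (invmx P *m U) (o4 0) 0 = 0.
  have -> : U = P *m delta_mx (o4 2) 0.
    by rewrite Pa !mxE /= !scale0r !add0r scale1r addr0.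
  by rewrite mulKmx // mxE.
have gyU : (invmx P *m (y *m U)) (o4 0) 0 = 1.
  have -> : y *m U = P *m delta_mx (o4 0) 0.
    by rewrite Pa !mxE /= !scale0r !addr0 scale1r.
  by rewrite mulKmx // mxE.
move: z02; rewrite xE mulmxDl mul_scalar_mx mulmxDr -scalemxAl -!scalemxAr.
rewrite mxE [X in X + _]mxE [X in _ + X]mxE gU gyU mulr0 add0r mulr1 => g0.
move: xE; rewrite g0 scale0r addr0 => xE.
have := subvP WU x xW; rewrite mem_sl xE mxtrace_scalar -mulr_natr mulf_eq0 pnatr_eq0 orbF.
by move=> /eqP ->; rewrite raddf0.
Qed.

End Orbits.

(** * Annihilators and orbits of vectors *)

Section CommutingSpaces.
Variable K : numClosedFieldType.
Local Notation M4 := 'M[K]_4.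
Local Notation sl4 := (sl K 4).
Local Notation o4 k := (@Ordinal 4 k isT).
Implicit Types (W : {vspace M4}) (x y z : M4) (u v w : 'cV[K]_4).

Section Free.
Variable vT : vectType K.
Implicit Types (p q r : vT).

Lemma free3P p q r : (forall a b c, a *: p + b *: q + c *: r = 0 -> [/\ a = 0, b = 0 & c = 0]) ->
  free [:: p; q; r].
Proof.
move=> H; apply/(freeP (X := [tuple p; q; r])) => l.
rewrite !big_ord_recl big_ord0 addr0 addrA => /H [h0 h1 h2] i.
elim/ord3_ind: i; [rewrite -[RHS]h0|rewrite -[RHS]h1|rewrite -[RHS]h2];
  by congr l; apply: val_inj.
Qed.

Lemma mem_span2 p q t : t \in <<[:: p; q]>>%VS -> exists a b, t = a *: p + b *: q.
Proof.
rewrite span_cons span_seq1 => /memv_addP [_ /vlineP [a ->] [_ /vlineP [b ->] ->]].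
by exists a, b.
Qed.

Lemma free3_dim p q r (S : {vspace vT}) :
  free [:: p; q; r] -> p \in S -> q \in S -> r \in S -> (3 <= \dim S)%N.
Proof.
move=> /eqP E pS qS rS; rewrite -[3%N]E; apply: dimvS; apply/span_subvP => t.
by rewrite !inE => /or3P [] /eqP ->.
Qed.

End Free.

Definition unital W : {vspace M4} := (<[1%:M]> + W)%VS.

Definition evv v : 'Hom(M4, 'cV[K]_4) := linfun (mulmxr v).

Lemma evvE v x : evv v x = x *m v.
Proof. by rewrite lfunE. Qed.

(** [ann W v] and [orb W v] are the kernel and the image of evaluation at [v], so their dimensions
    add up to 4. The cases are separated by whether some [v] has an annihilator of dimension at most
    1. *)
Definition ann W v : {vspace M4} := (unital W :&: lker (evv v))%VS.
Definition orb W v : {vspace 'cV[K]_4} := (evv v @: unital W)%VS.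

Lemma mem_unital W x : x \in unital W <-> exists s y, y \in W /\ x = s%:M + y.
Proof.
split=> [/memv_addP [_ /vlineP [s ->] [y yW ->]]|[s [y [yW ->]]]].
  by exists s, y; rewrite scalemx1.
by rewrite -scalemx1; apply/memv_addP; exists (s *: 1%:M); rewrite ?memvZ ?memv_line //; exists y.
Qed.

Lemma sub_unital W x : x \in W -> x \in unital W.
Proof. by move=> xW; apply/mem_unital; exists 0, x; rewrite raddf0 add0r. Qed.

Lemma scalar_unital W s : s%:M \in unital W.
Proof. by apply/mem_unital; exists s, 0; rewrite mem0v addr0. Qed.

Lemma mem_ann W v x : (x \in ann W v) = (x \in unital W) && (x *m v == 0).
Proof. by rewrite memv_cap memv_ker evvE. Qed.

Lemma mem_orb W v x : x \in unital W -> x *m v \in orb W v.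
Proof. by move=> xA; rewrite -evvE memv_img. Qed.

Lemma orbP W v u : u \in orb W v -> exists2 x, x \in unital W & u = x *m v.
Proof. by move=> /memv_imgP [x xA ->]; exists x => //; rewrite evvE. Qed.

Lemma mx4_eq0 x : (forall v, x *m v = 0) -> x = 0.
Proof.
move=> H; apply/matrixP => i j; have := congr1 (fun u : 'cV_4 => u i 0) (H (delta_mx j 0)).
by rewrite -colE !mxE.
Qed.

Lemma unital_transp W x : x \in unital W -> x^T \in unital (transp K @: W)%VS.
Proof.
move=> /mem_unital [s [y [yW ->]]]; rewrite linearD /= tr_scalar_mx.
by apply/mem_unital; exists s, y^T; rewrite -transpE memv_img.
Qed.

Lemma scalar4_eq0 s : s%:M = 0 :> M4 -> s = 0.
Proof. by move=> /matrixP/(_ (o4 0) (o4 0)); rewrite !mxE. Qed.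

Lemma scalar_sl s : s%:M \in sl4 -> s = 0.
Proof.
rewrite mem_sl mxtrace_scalar -mulr_natr mulf_eq0 pnatr_eq0 orbF.
by move=> /eqP.
Qed.

Section Fixed.
Variable W : {vspace M4}.
Hypotheses (WU : (W <= sl4)%VS) (dW : \dim W = 3) (Wc : commuting W).

Lemma dim_unital : \dim (unital W) = 4.
Proof.
rewrite dimv_disjoint_sum.
  rewrite dim_vline dW; have -> // : (1%:M : M4) != 0.
  by apply/eqP => /scalar4_eq0 /eqP; rewrite oner_eq0.
apply/eqP; rewrite -subv0; apply/subvP => x.
rewrite memv_cap memv0 => /andP [/vlineP [s ->] sW].
have := subvP WU _ sW; rewrite scalemx1 => /scalar_sl ->.
by rewrite raddf0.
Qed.

Lemma dim_ann_orb v : (\dim (ann W v) + \dim (orb W v) = 4)%N.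
Proof. by rewrite limg_ker_dim dim_unital. Qed.

Lemma unital_comm x y : x \in unital W -> y \in unital W -> x *m y = y *m x.
Proof.
move=> /mem_unital [s [a [aW ->]]] /mem_unital [t [b [bW ->]]].
rewrite !mulmxDl !mulmxDr !mul_scalar_mx !mul_mx_scalar (Wc aW bW).
by rewrite !scale_scalar_mx [t * s]mulrC -!addrA; congr (_ + _); rewrite addrCA.
Qed.

Lemma nonscalar x s : x \in W -> x = s%:M -> x = 0.
Proof. by move=> xW xs; move: (subvP WU _ xW); rewrite xs => /scalar_sl ->; rewrite raddf0. Qed.

Section Cyclic.
Variable v : 'cV[K]_4.
Hypothesis v_cyclic : forall x, x \in unital W -> x *m v = 0 -> x = 0.

Lemma cyclic_onto u : exists2 x, x \in unital W & u = x *m v.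
Proof.
apply: orbP; have := dim_ann_orb v.
have -> : ann W v = 0%VS.
  apply/eqP; rewrite -subv0; apply/subvP => x; rewrite mem_ann memv0.
  by move=> /andP [xA /eqP xv]; apply/eqP; apply: v_cyclic.
rewrite dimv0 add0n => dO; have -> : orb W v = fullv; last exact: memvf.
by apply/eqP; rewrite eqEdim subvf dO dimvf.
Qed.

Lemma cyclic_kill (p : M4) : (forall x, x \in unital W -> p *m x = x *m p) -> p *m v = 0 -> p = 0.
Proof.
move=> pc pv; apply: mx4_eq0 => u; have [x xA ->] := cyclic_onto u.
by rewrite mulmxA pc // -mulmxA pv mulmx0.
Qed.

(** A relation between the vectors z z v, z v and v holds for the matrices by [cyclic_kill], so
    these vectors are independent. They form a frame with U = z v, V = v and y = z: if x v = a z v +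
    b v, then x - b - a z is in [unital W] and kills v. *)
Lemma cyclic_in_cell z : z \in W -> (forall a b, z *m z <> a *: z + b%:M) -> in_cell W.
Proof.
move=> zW nq; have zA := sub_unital zW.
apply: (@frame_in_cell _ W (z *m v) v z WU).
  apply: free3P => a b c E.
  have p0 : a *: (z *m z) + b *: z + c%:M = 0.
    apply: cyclic_kill => [x xA|]; last first.
      by rewrite !mulmxDl mul_scalar_mx -!scalemxAl -mulmxA.
    rewrite !mulmxDl !mulmxDr mul_scalar_mx mul_mx_scalar -!scalemxAl -!scalemxAr.
    by rewrite -mulmxA (unital_comm zA xA) mulmxA (unital_comm zA xA) mulmxA.
  have a0 : a = 0.
    apply/eqP/negPn/negP => an0; apply: (nq (- (a^-1 * b)) (- (a^-1 * c))).
    apply/eqP; rewrite -subr_eq0; apply/eqP.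
    rewrite -[RHS](scaler0 _ a^-1) -[in RHS]p0 !scalerDr !scalerA mulVf // scale1r.
    by rewrite opprD -scaleNr opprK -raddfN opprK addrA scale_scalar_mx.
  rewrite a0 scale0r add0r in p0.
  have b0 : b = 0.
    apply/eqP/negPn/negP => bn0.
    have z0 : z = 0.
      apply: (@nonscalar z (- (b^-1 * c)) zW); apply/eqP; rewrite -subr_eq0; apply/eqP.
      rewrite -[RHS](scaler0 _ b^-1) -[in RHS]p0 !scalerDr !scalerA mulVf // scale1r.
      by rewrite -raddfN opprK scale_scalar_mx.
    by apply: (nq 0 0); rewrite z0 mulmx0 scaler0 raddf0 addr0.
  move: p0; rewrite b0 scale0r add0r => /scalar4_eq0 c0.
  by [].
move=> x xW /mem_span2 [a [b E]]; exists b, a.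
apply/eqP; rewrite -subr_eq0; apply/eqP/v_cyclic.
  apply: memvB; first exact: sub_unital.
  by apply: memvD; [apply: scalar_unital|apply: memvZ].
by rewrite mulmxBl mulmxDl mul_scalar_mx -scalemxAl E [X in _ - X]addrC subrr.
Qed.

End Cyclic.
End Fixed.
End CommutingSpaces.

(** * Commuting spaces all of whose elements are quadratic *)

Section QuadraticSpaces.
Variable K : numClosedFieldType.
Local Notation M4 := 'M[K]_4.
Local Notation sl4 := (sl K 4).
Local Notation o3 k := (@Ordinal 3 k isT).
Implicit Types (W : {vspace M4}).

(** With [xy] the product of x and y, the left-hand side is the product of x - a/2 and y - a'/2.
    Comparing the squares of x + y and x - y gives p = a + a' by independence, after which the terms
    in x and y cancel. *)
Lemma polarization (x y xx xy yy : M4) (a b a' b' p q r s : K) :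
  xx = a *: x + b%:M -> yy = a' *: y + b'%:M ->
  xx + xy + xy + yy = p *: (x + y) + q%:M ->
  xx - xy - xy + yy = r *: (x - y) + s%:M ->
  (forall c c' d, c *: x + c' *: y + d%:M = 0 -> c = 0 /\ c' = 0) ->
  xy - (a' / 2%:R) *: x - (a / 2%:R) *: y + (a * a' / 4%:R)%:M =
  ((q - b - b') / 2%:R + a * a' / 4%:R)%:M.
Proof.
move=> -> -> E1 E2 ind.
have [h1 h2] : 2%:R * a - p - r = 0 /\ 2%:R * a' - p + r = 0.
  apply: (ind _ _ (2%:R * b + 2%:R * b' - q - s)); apply/matrixP => i j.
  have := congr1 (fun M : M4 => M i j) E1; have := congr1 (fun M : M4 => M i j) E2.
  rewrite !mxE; move: (i == j) => e e2 e1.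
  by apply: (eq_of_subr (congr2 +%R e1 e2)); ring.
have pE : p = a + a'.
  apply: (mulfI (_ : 2%:R != 0)); first by rewrite pnatr_eq0.
  by apply: (eq_of_subr (esym (congr2 +%R h1 h2))); ring.
apply/matrixP => i j; have := congr1 (fun M : M4 => M i j) E1.
rewrite pE !mxE; move: (i == j) => e e1.
apply: (mulfI (_ : 2%:R != 0)); first by rewrite pnatr_eq0.
by apply: (eq_of_subr e1); field.
Qed.

Section Fixed.
Variable W : {vspace M4}.
Hypotheses (WU : (W <= sl4)%VS) (dW : \dim W = 3) (Wc : commuting W).
Variable v : 'cV[K]_4.
Hypothesis v_cyclic : forall x, x \in unital W -> x *m v = 0 -> x = 0.
Hypothesis Wquad : forall x, x \in W -> exists a b, x *m x = a *: x + b%:M.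

(** Completing squares ([X i]) makes all products [X i *m X j] scalar, and independence makes these
    scalars 0. For a row [f] that annihilates the three vectors [X i *m v], each [X i] is then a
    multiple of [X i *m v *m f]. It has trace 0, so the shift vanishes and [X i] is [w i]. *)
Lemma quadratic_common_row : exists2 f : 'rV[K]_4, f != 0 &
  forall x, x \in W -> exists u : 'cV[K]_4, x = u *m f.
Proof.
have n2 : 2%:R != 0 :> K by rewrite pnatr_eq0.
have n4 : 4%:R != 0 :> K by rewrite pnatr_eq0.
have sW : size (vbasis W) == 3 by rewrite size_tuple dW.
pose w := tnth (Tuple sW).
have wW i : w i \in W by apply/vbasis_mem/mem_tnth.
have /freeP fw : free (Tuple sW) by rewrite /= (basis_free (vbasisP W)).
have {}fw (l : 'I_3 -> K) : \sum_i l i *: w i = 0 -> forall i, l i = 0.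
  move=> E; apply: fw; rewrite -[RHS]E; apply: eq_bigr => i _.
  by rewrite /w (tnth_nth 0).
have ind i j c c' d : i != j -> c *: w i + c' *: w j + d%:M = 0 -> c = 0 /\ c' = 0.
  move=> ij E; have d0 : d = 0.
    apply: (@scalar_sl K); rewrite -[d%:M]opprK -[X in - X]add0r -[in X in - (X - _)]E addrK.
    by rewrite memvN memvD ?memvZ // (subvP WU).
  move: E; rewrite d0 raddf0 addr0 => E.
  have H := fw (fun k => c * (k == i)%:R + c' * (k == j)%:R).
  have {}H : forall k, c * (k == i)%:R + c' * (k == j)%:R = 0.
    apply: H; rewrite -[RHS]E (eq_bigr (fun k => (c * (k == i)%:R) *: w k + (c' * (k == j)%:R) *: w k)).
      rewrite big_split /=; congr (_ + _); [rewrite (bigD1 i)|rewrite (bigD1 j)] => //=;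
        by rewrite eqxx mulr1 big1 ?addr0 // => k /negPf ->; rewrite mulr0 scale0r.
    by move=> k _; rewrite scalerDl.
  have := H i; have := H j; rewrite !eqxx [j == i]eq_sym (negPf ij).
  by rewrite !mulr0 !mulr1 add0r addr0.
have /fin_all_exists [al /fin_all_exists [be sq]] : forall i, exists a b,
    w i *m w i = a *: w i + b%:M by move=> i; apply: Wquad.
pose X i : M4 := w i - (al i / 2%:R)%:M.
have Xprod i j : exists c, X i *m X j = c%:M.
  have XX : X i *m X j = w i *m w j - (al j / 2%:R) *: w i - (al i / 2%:R) *: w j
      + (al i * al j / 4%:R)%:M.
    rewrite /X mulmxBl !mulmxBr !mul_scalar_mx !mul_mx_scalar.
    move: (w i *m w j) => ww; apply/matrixP => p q; rewrite !mxE; move: (p == q) => e.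
    by field.
  rewrite XX; have [<-|ij] := eqVneq i j.
    exists (be i + al i * al i / 4%:R); rewrite sq.
    by apply/matrixP => p q; rewrite !mxE; move: (p == q) => e; field.
  have [p [q Ep]] := Wquad (memvD (wW i) (wW j)).
  have [r [s Er]] := Wquad (memvB (wW i) (wW j)).
  eexists; apply: (@polarization _ _ _ _ _ _ _ _ _ p q r s (sq i) (sq j) _ _ (fun c c' d => @ind i j c c' d ij)).
  - by rewrite -[RHS]Ep mulmxDl !mulmxDr (Wc (wW j) (wW i)) !addrA.
  - rewrite -[RHS]Er mulmxBl !mulmxBr (Wc (wW j) (wW i)) opprB !addrA.
    by rewrite [RHS]addrAC.
have Xcomm i j : X i *m X j = X j *m X i.
  by rewrite /X !mulmxBl !mulmxBr !mul_scalar_mx !mul_mx_scalar (Wc (wW i) (wW j));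
    apply/matrixP => p q; move: (w j *m w i) => ww; rewrite !mxE; ring.
have X0 i j : X i *m X j = 0.
  have [c Ec] := Xprod i j; rewrite Ec; have [->|cn0] := eqVneq c 0.
    by rewrite raddf0.
  (* A nonzero [c] makes [X i] invertible. For any index [k] other than [j], the matrix
     [c *: X k - d *: X j] is killed by [X i], hence is 0, against independence. *)
  pose k := if j == o3 0 then o3 1 else o3 0.
  have kj : k != j by rewrite /k; elim/ord3_ind: j {Ec k}.
  have [d Ed] := Xprod i k.
  have E : c *: X k - d *: X j = 0.
    have H : X i *m (c *: X k - d *: X j) = 0.
      rewrite mulmxBr -!scalemxAr Ec Ed; apply/matrixP => p q; rewrite !mxE; ring.
    have {}H : X j *m (X i *m (c *: X k - d *: X j)) = 0 by rewrite H mulmx0.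
    move: H; rewrite mulmxA Xcomm Ec mul_scalar_mx => /eqP.
    by rewrite scaler_eq0 (negPf cn0) => /eqP.
  have [|c0 _] := @ind k j c (- d) (d * (al j / 2%:R) - c * (al k / 2%:R)) kj.
    rewrite -[RHS]E /X; apply/matrixP => p q; rewrite !mxE; ring.
  by rewrite c0 eqxx in cn0.
have XA i : X i \in unital W.
  by apply: memvB; [apply/sub_unital|apply: scalar_unital].
have decomp u : exists s c, u = s *: v + \sum_i c i *: (X i *m v).
  have [x /mem_unital [s [y [yW ->]]] ->] := cyclic_onto WU dW v_cyclic u.
  have yE : y = \sum_i coord (Tuple sW) i y *: w i.
    rewrite {1}(coord_basis (X := Tuple sW) (vbasisP W) yW).
    by apply: eq_bigr => i _; rewrite /w (tnth_nth 0).
  pose c i := coord (Tuple sW) i y.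
  exists (s + \sum_i c i * (al i / 2%:R)), c.
  rewrite mulmxDl mul_scalar_mx scalerDl -addrA; congr (_ + _).
  rewrite scaler_suml -big_split yE mulmx_suml; apply: eq_bigr => i _ /=.
  rewrite -/(c i) /X mulmxBl mul_scalar_mx scalerBr -scalemxAl scalerA.
  by rewrite addrC subrK.
have [f [fn0 fX]] := @kernel_vector K 4 3 (\matrix_(a, i) (X i *m v) a 0) isT.
have {}fX i : f *m (X i *m v) = 0.
  apply/matrixP => a b; rewrite !ord1.
  have := congr1 (fun B : 'rV_3 => B 0 i) fX; rewrite !mxE => H; rewrite -[RHS]H.
  by apply: eq_bigr => l _; rewrite [in RHS]mxE.
pose t := (f *m v) 0 0.
have fvE : f *m v = t%:M by apply/matrixP => a b; rewrite !ord1 [RHS]mxE eqxx mulr1n.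
have fuE s c : f *m (s *: v + \sum_i c i *: (X i *m v)) = (s * t)%:M.
  rewrite mulmxDr -scalemxAr fvE mulmx_sumr big1 ?addr0 ?scale_scalar_mx //.
  by move=> i _; rewrite -scalemxAr fX scaler0.
have tn0 : t != 0.
  apply: contraNneq fn0 => t0; apply/eqP/rowP => a; rewrite mxE.
  have [s [c E]] := decomp (delta_mx a 0).
  have := congr1 (fun u => (f *m u) 0 0) E; rewrite -colE fuE t0 mulr0 raddf0 [RHS]mxE.
  by rewrite mxE.
have XE i : X i = (t^-1 *: (X i *m v)) *m f.
  apply/eqP; rewrite -subr_eq0; apply/eqP/mx4_eq0 => u.
  have [s [c ->]] := decomp u.
  rewrite mulmxBl -mulmxA fuE mul_mx_scalar scalerA mulfK // mulmxDr -scalemxAr.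
  rewrite mulmx_sumr big1 ?addr0 ?subrr // => j _.
  by rewrite -scalemxAr mulmxA X0 mul0mx scaler0.
have al0 i : al i / 2%:R = 0.
  apply: (@scalar_sl K); have -> : (al i / 2%:R)%:M = w i - X i.
    by rewrite /X opprB addrC subrK.
  apply: memvB; first exact: (subvP WU).
  by rewrite mem_sl XE mxtrace_mulC -scalemxAr fX scaler0 linear0.
exists f => // x xW; exists (\sum_i coord (Tuple sW) i x *: (t^-1 *: (X i *m v))).
rewrite {1}(coord_basis (X := Tuple sW) (vbasisP W) xW) mulmx_suml.
apply: eq_bigr => i _; rewrite -scalemxAl -XE /X al0 raddf0 subr0.
by rewrite /w (tnth_nth 0).
Qed.

End Fixed.
End QuadraticSpaces.

(** * Vectors with annihilator of dimension at most one *)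

Section LargeOrbits.
Variable K : numClosedFieldType.
Local Notation M4 := 'M[K]_4.
Local Notation sl4 := (sl K 4).
Implicit Types (W : {vspace M4}).

Lemma notin_subv (vT : vectType K) (S T : {vspace vT}) :
  (\dim T < \dim S)%N -> exists2 u, u \in S & u \notin T.
Proof.
by move=> d; apply/subvPn; apply: contraL d => /dimvS; rewrite -leqNgt.
Qed.

Lemma dim1_line (vT : vectType K) (S : {vspace vT}) : \dim S = 1%N ->
  exists y, [/\ y \in S, y != 0 & forall x, x \in S -> exists c, x = c *: y].
Proof.
move=> dS; have Sn0 : S != 0%VS by rewrite -dimv_eq0 dS.
exists (vpick S); split; rewrite ?memv_pick ?vpick0 //.
have E : <[vpick S]>%VS = S.
  by apply/eqP; rewrite eqEdim dS dim_vline vpick0 Sn0 -memvE memv_pick.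
by move=> x; rewrite -{1}E => /vlineP.
Qed.

Lemma dim2_pair (vT : vectType K) (S : {vspace vT}) : (1 < \dim S)%N ->
  exists p q, [/\ p \in S, q \in S & forall a b, a *: p + b *: q = 0 -> a = 0 /\ b = 0].
Proof.
move=> dS; have [p pS pn0] : exists2 p, p \in S & p \notin (0%VS : {vspace vT}).
  by apply: notin_subv; rewrite dimv0; apply: ltnW.
have [q qS qp] : exists2 q, q \in S & q \notin <[p]>%VS.
  apply: notin_subv; apply: leq_ltn_trans dS; rewrite dim_vline; by case: (p != 0).
exists p, q; split=> // a b E.
have b0 : b = 0.
  apply/eqP/negPn/negP => bn0; case/negP: qp; apply/vlineP; exists (- (b^-1 * a)).
  apply/eqP; rewrite -subr_eq0; apply/eqP; rewrite scaleNr opprK.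
  by rewrite -[RHS](scaler0 _ b^-1) -[in RHS]E scalerDr !scalerA mulVf // scale1r addrC.
split=> //; move: E; rewrite b0 scale0r addr0 => /eqP; rewrite scaler_eq0.
by rewrite memv0 in pn0; rewrite (negPf pn0) orbF => /eqP.
Qed.

Section Fixed.
Variable W : {vspace M4}.
Hypotheses (WU : (W <= sl4)%VS) (dW : \dim W = 3) (Wc : commuting W).

(** The generator [y] of the annihilator kills the 3-dimensional orbit of [v]. A vector [U] outside
    the orbit with [y *m U] outside the span of [U] and [v] gives a frame: if [x *m v] lies in that
    span, it has no component along [U], and [x - b%:M] kills [v], so is a multiple of [y]. If there
    is no such [U], comparing [U0] with [U0 + w] shows that [y *m U0] is a nonzero multiple of [v];
    commutation with [y] then makes [v] a common eigenvector, and its orbit would be a line. *)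
Lemma corank1_in_cell v : \dim (ann W v) = 1%N -> in_cell W.
Proof.
move=> dA; have [y [yA yn0 yline]] := dim1_line dA.
have dO : \dim (orb W v) = 3 by have := dim_ann_orb WU dW v; rewrite dA => -[].
move: yA; rewrite mem_ann => /andP [yA /eqP yv].
have vO : v \in orb W v.
  by have := mem_orb v (scalar_unital W 1); rewrite mul1mx.
have vn0 : v != 0.
  apply/eqP => v0; have : (orb W v <= 0)%VS.
    by apply/subvP => u /orbP [x _ ->]; rewrite v0 mulmx0 mem0v.
  by move=> /dimvS; rewrite dO dimv0.
have annE x : x \in unital W -> x *m v = 0 -> exists c, x = c *: y.
  by move=> xA xv; apply: yline; rewrite mem_ann xA xv eqxx.
have yorb u : u \in orb W v -> y *m u = 0.
  move=> /orbP [x xA ->]; rewrite mulmxA (unital_comm Wc yA xA) -mulmxA yv.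
  by rewrite mulmx0.
have [[U UO yU]|nU] := pselect (exists2 U, U \notin orb W v & y *m U \notin <<[:: U; v]>>%VS).
  apply: (@frame_in_cell _ W U v y WU).
    apply: free3P => a b c E.
    have a0 : a = 0.
      apply/eqP/negPn/negP => an0; case/negP: yU.
      have -> : y *m U = - (a^-1 * b) *: U + - (a^-1 * c) *: v.
        apply/eqP; rewrite -subr_eq0; apply/eqP.
        rewrite -[RHS](scaler0 _ a^-1) -[in RHS]E !scalerDr !scalerA mulVf // scale1r.
        by rewrite !scaleNr opprD !opprK addrA.
      by rewrite memvD // memvZ // memv_span // !inE eqxx ?orbT.
    have b0 : b = 0.
      apply/eqP/negPn/negP => bn0; case/negP: UO.
      have -> : U = - (b^-1 * c) *: v.
        apply/eqP; rewrite -subr_eq0; apply/eqP.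
        rewrite -[RHS](scaler0 _ b^-1) -[in RHS]E a0 scale0r add0r scalerDr !scalerA.
        by rewrite mulVf // scale1r scaleNr opprK.
      by rewrite memvZ.
    move: E; rewrite a0 b0 !scale0r !add0r => /eqP; rewrite scaler_eq0 (negPf vn0) orbF.
    by move=> /eqP.
  move=> x xW /mem_span2 [a [b E]].
  have xA := sub_unital xW.
  have a0 : a = 0.
    apply/eqP/negPn/negP => an0; case/negP: UO.
    have -> : U = a^-1 *: (x *m v - b *: v).
      by rewrite E addrK scalerA mulVf // scale1r.
    by rewrite memvZ // memvB ?memvZ // mem_orb.
  have [|c Ec] := annE (x - b%:M) (memvB xA (scalar_unital W b)).
    by rewrite mulmxBl mul_scalar_mx E a0 scale0r add0r subrr.
  by exists b, c; rewrite -Ec addrC subrK.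
have {}nU U : U \notin orb W v -> exists a b, y *m U = a *: U + b *: v.
  move=> UO; apply: mem_span2; apply/negPn/negP => h; apply: nU.
  by exists U.
have [U0 _ U0O] : exists2 u, u \in (fullv : {vspace 'cV[K]_4}) & u \notin orb W v.
  by apply: notin_subv; rewrite dO dimvf.
have [w wO wv] : exists2 w, w \in orb W v & w \notin <[v]>%VS.
  by apply: notin_subv; rewrite dO dim_vline vn0.
have [al [be E0]] := nU _ U0O.
have U1O : U0 + w \notin orb W v.
  by apply: contra U0O => h; rewrite -(addrK w U0) memvB.
have [al1 [be1 E1]] := nU _ U1O.
have E2 : (al - al1) *: U0 = al1 *: w + (be1 - be) *: v.
  have : al *: U0 + be *: v = al1 *: (U0 + w) + be1 *: v.
    by rewrite -E0 -E1 mulmxDr (yorb w wO) addr0.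
  move=> h; apply/eqP; rewrite -subr_eq0; apply/eqP.
  move/eqP: h; rewrite -subr_eq0 => /eqP h; rewrite -[RHS]h.
  by apply/colP => i; rewrite !mxE; ring.
have alE : al1 = al.
  apply/eqP; rewrite eq_sym -subr_eq0; apply/negPn/negP => an0; case/negP: U0O.
  have -> : U0 = (al - al1)^-1 *: (al1 *: w + (be1 - be) *: v).
    by rewrite -E2 scalerA mulVf // scale1r.
  by rewrite memvZ // memvD // memvZ.
have al0 : al = 0.
  apply/eqP/negPn/negP => an0; case/negP: wv; apply/vlineP.
  exists (- (al^-1 * (be1 - be))); apply/eqP; rewrite -subr_eq0 scaleNr opprK; apply/eqP.
  rewrite -[RHS](scaler0 _ al^-1) -(_ : al *: w + (be1 - be) *: v = 0).
    by rewrite scalerDr !scalerA mulVf // scale1r.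
  by rewrite -alE -E2 alE subrr scale0r.
rewrite al0 scale0r add0r in E0.
have decomp u : exists c w', w' \in orb W v /\ u = c *: U0 + w'.
  have : u \in (orb W v + <[U0]>)%VS.
    suff -> : (orb W v + <[U0]>)%VS = fullv by apply: memvf.
    apply/eqP; rewrite eqEdim subvf dimvf; have -> : dim 'cV[K]_4 = 4%N by [].
    change (3 < \dim (orb W v + <[U0]>))%N.
    have le3 : (3 <= \dim (orb W v + <[U0]>))%N.
      by rewrite -[X in (X <= _)%N]dO dimvS // addvSl.
    rewrite ltn_neqAle le3 andbT; apply: contra U0O => /eqP dE.
    have /eqP -> : orb W v == (orb W v + <[U0]>)%VS.
      by rewrite eqEdim addvSl -dE dO.
    by rewrite memvE addvSr.
  by move=> /memv_addP [w' w'O [_ /vlineP [c ->] ->]]; exists c, w'; rewrite addrC.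
have be0 : be != 0.
  apply: contraNneq yn0 => b0; apply/eqP/mx4_eq0 => u.
  have [c [w' [w'O ->]]] := decomp u.
  by rewrite mulmxDr -scalemxAr E0 b0 scale0r scaler0 add0r yorb.
have line x : x \in unital W -> exists c, x *m v = c *: v.
  move=> xA; have [c [w' [w'O Ex]]] := decomp (x *m U0).
  exists c; apply: (scalerI be0).
  rewrite scalemxAr -E0 mulmxA -(unital_comm Wc yA xA) -mulmxA Ex mulmxDr -scalemxAr.
  by rewrite (yorb w') // addr0 E0 !scalerA mulrC.
have : (orb W v <= <[v]>)%VS.
  by apply/subvP => u /orbP [x xA ->]; apply/vlineP; apply: line.
by move=> /dimvS; rewrite dO dim_vline vn0.
Qed.

Lemma corank0 v : \dim (ann W v) = 0%N -> in_cell W \/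
  exists2 f : 'rV[K]_4, f != 0 & forall x, x \in W -> exists u : 'cV[K]_4, x = u *m f.
Proof.
move=> /eqP; rewrite dimv_eq0 => /eqP a0.
have cyc x : x \in unital W -> x *m v = 0 -> x = 0.
  by move=> xA xv; apply/eqP; rewrite -memv0 -a0 mem_ann xA xv eqxx.
have [[z zW nq]|H] := pselect (exists2 z, z \in W & forall a b, z *m z <> a *: z + b%:M).
  by left; apply: (cyclic_in_cell WU dW Wc cyc zW nq).
right; apply: (quadratic_common_row WU dW Wc cyc) => x xW.
apply: contrapT => h; apply: H; exists x => // a b E; apply: h.
by exists a, b.
Qed.

Lemma eigen_scalar (x : M4) :
  (forall u : 'cV[K]_4, exists c, x *m u = c *: u) -> exists c, x = c%:M.
Proof.
move=> H; have [c Hc] := H (const_mx 1); exists c.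
have offd i j : i != j -> x i j = 0.
  move=> ij; have [d] := H (delta_mx j 0); rewrite -colE => /colP/(_ i).
  by rewrite !mxE (negPf ij) mulr0.
apply/matrixP => i j; rewrite mxE; have [<-|ij] := eqVneq i j; last exact: offd.
move/colP/(_ i): Hc; rewrite !mxE (bigD1 i) //= mxE mulr1 big1 ?addr0 ?mulr1 //.
by move=> k ki; rewrite offd ?mul0r // eq_sym.
Qed.

(** Any nonzero [s] that is not an eigenvalue of [- B] gives [t = s^-1]. This serves to move an
    independent triple along a line while keeping it independent. *)
Lemma exists_nonroot (B : 'M[K]_3) : exists2 t : K, t != 0 & 1%:M + t *: B \in unitmx.
Proof.
pose p := char_poly (- B).
have pn0 : p != 0 by apply/monic_neq0/char_poly_monic.
have [s sn0 ps] : exists2 s : K, s != 0 & ~~ root p s.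
  apply: contrapT => H; have : all (root p) [seq n.+1%:R | n <- iota 0 (size p)].
    apply/allP => _ /mapP [n _ ->]; apply/negPn/negP => nr; apply: H.
    by exists n.+1%:R; rewrite ?pnatr_eq0.
  move=> /(max_poly_roots pn0); rewrite size_map size_iota ltnn.
  rewrite map_inj_uniq ?iota_uniq => [/(_ isT) //|a b /eqP].
  by rewrite eqr_nat => /eqP [].
exists s^-1; first by rewrite invr_eq0.
have E : s *: (1%:M + s^-1 *: B) = s%:M - (- B).
  by rewrite scalerDr scalerA mulfV // scale1r scalemx1 opprK.
rewrite unitmxE unitfE; apply: contraNneq ps => d0; rewrite /root /p /char_poly.
rewrite -[_.[s]]/(horner_eval s _) -det_map_mx.
have -> : map_mx (horner_eval s) (char_poly_mx (- B)) = s *: (1%:M + s^-1 *: B).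
  rewrite E; apply/matrixP => i j; rewrite !mxE /horner_eval hornerD hornerN hornerC.
  by rewrite hornerMn hornerX.
by rewrite detZ d0 mulr0.
Qed.

End Fixed.
End LargeOrbits.

(** * All orbits of dimension at most two: passage to the transpose *)

Section SmallOrbits.
Variable K : numClosedFieldType.
Local Notation M4 := 'M[K]_4.
Local Notation sl4 := (sl K 4).
Local Notation o3 k := (@Ordinal 3 k isT).
Implicit Types (W : {vspace M4}) (p q r u v w : 'cV[K]_4).

Definition rows3 p q r : 'M[K]_(3, 4) := \matrix_(i, j) (nth 0 [:: p; q; r] i) j 0.

Lemma mul_rows3 (l : 'rV[K]_3) p q r : l *m rows3 p q r =
  (l 0 (o3 0) *: p + l 0 (o3 1) *: q + l 0 (o3 2) *: r)^T.
Proof. by apply/rowP => j; rewrite !mxE sum3 !mxE. Qed.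

Lemma rows3_free p q r :
  (forall a b c, a *: p + b *: q + c *: r = 0 -> [/\ a = 0, b = 0 & c = 0]) ->
  row_free (rows3 p q r).
Proof.
move=> H; apply: inj_row_free => l; rewrite mul_rows3 => /(congr1 trmx).
rewrite trmxK linear0 => /H [h0 h1 h2]; apply/rowP => i; rewrite mxE.
by elim/ord3_ind: i.
Qed.

Lemma rows3_ind p q r : row_free (rows3 p q r) ->
  forall a b c, a *: p + b *: q + c *: r = 0 -> [/\ a = 0, b = 0 & c = 0].
Proof.
move=> /row_freeP [S HS] a b c E.
pose l : 'rV[K]_3 := \row_i nth 0 [:: a; b; c] i.
have l0 : l = 0.
  by rewrite -[l]mulmx1 -HS mulmxA mul_rows3 !mxE /= E linear0 mul0mx.
have H i : l 0 i = 0 by rewrite l0 mxE.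
by split; [move: (H (o3 0))|move: (H (o3 1))|move: (H (o3 2))]; rewrite mxE.
Qed.

Lemma generic_rows3 p q r p' q' : row_free (rows3 p q r) ->
  exists2 t : K, t != 0 & row_free (rows3 (p + t *: p') (q + t *: q') r).
Proof.
move=> /row_freeP [S HS]; have [t tn0 tu] := exists_nonroot (rows3 p' q' 0 *m S).
exists t => //; apply/row_freeP; exists (S *m invmx (1%:M + t *: (rows3 p' q' 0 *m S))).
rewrite mulmxA; have -> : rows3 (p + t *: p') (q + t *: q') r = rows3 p q r + t *: rows3 p' q' 0.
  by apply/matrixP => i j; rewrite !mxE; elim/ord3_ind: i; rewrite /= !mxE ?mulr0 ?addr0.
by rewrite mulmxDl HS -scalemxAl mulmxV.
Qed.

Section Fixed.
Variable W : {vspace M4}.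
Hypotheses (WU : (W <= sl4)%VS) (dW : \dim W = 3) (Wc : commuting W).

Lemma transp_hyps : [/\ ((transp K @: W)%VS <= sl4)%VS, \dim (transp K @: W) = 3 &
  commuting (transp K @: W)%VS].
Proof.
split.
- by rewrite -[X in (_ <= X)%VS](transp_sl K) limgS.
- by rewrite limg_dim_eq // (eqP (transp_ker K)) capv0.
- move=> _ _ /memv_imgP [x xW ->] /memv_imgP [y yW ->].
  by rewrite !transpE -!trmx_mul (Wc xW yW).
Qed.

(** All orbits have dimension at most 2. This forces the elements of [ann W v] to map into
    [orb W v], which they kill, and any two of them to have dependent values at each vector. Two
    independent ones, [n1] and [n3], then take values on a common line at suitable [w1] and [w2].
    For a row [f] nonzero on that line, [f], [f *m n1] and [f *m n3] are independent, so [f^T] has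
    an orbit of dimension at least 3 under the transposed space. *)
Lemma corank2_transp : (forall v, (1 < \dim (ann W v))%N) ->
  exists v, (\dim (ann (transp K @: W) v) <= 1)%N.
Proof.
move=> H2; have dO v : (\dim (orb W v) <= 2)%N.
  rewrite -(leq_add2l (\dim (ann W v))) (dim_ann_orb WU dW).
  by rewrite -[4%N]/(2 + 2)%N leq_add2r; apply: H2.
have no3 v p q r : p \in orb W v -> q \in orb W v -> r \in orb W v ->
    ~ (forall a b c, a *: p + b *: q + c *: r = 0 -> [/\ a = 0, b = 0 & c = 0]).
  move=> pO qO rO /free3P fr; have := free3_dim fr pO qO rO.
  by move=> h; have := leq_trans h (dO v).
have [x xW xn0] : exists2 x, x \in W & x \notin (0%VS : {vspace M4}).
  by apply: notin_subv; rewrite dW dimv0.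
have xA := sub_unital xW.
have [v xv] : exists v, ~ exists c, x *m v = c *: v.
  apply/existsNP => H; have [c xc] := eigen_scalar H.
  by case/negP: xn0; rewrite memv0 (nonscalar WU xW xc).
have vO : v \in orb W v by have := mem_orb v (scalar_unital W 1); rewrite mul1mx.
have xvO : x *m v \in orb W v by apply: mem_orb.
have ind2 a b : a *: v + b *: (x *m v) = 0 -> a = 0 /\ b = 0.
  have b0 : a *: v + b *: (x *m v) = 0 -> b = 0.
    move=> E; apply/eqP/negPn/negP => bn0; apply: xv; exists (- (b^-1 * a)).
    apply/eqP; rewrite -subr_eq0; apply/eqP; rewrite scaleNr opprK.
    by rewrite -[RHS](scaler0 _ b^-1) -[in RHS]E scalerDr !scalerA mulVf // scale1r addrC.
  move=> E; split; last exact: b0.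
  move: (E); rewrite (b0 E) scale0r addr0 => /eqP; rewrite scaler_eq0 => /orP [/eqP //|/eqP v0].
  by case: xv; exists 0; rewrite v0 mulmx0 scaler0.
have annO n w : n \in ann W v -> n *m w \in orb W v.
  rewrite mem_ann => /andP [nA /eqP nv].
  have [//|nO] := boolP (n *m w \in orb W v).
  (* If [n *m w] were outside, then for a suitable nonzero [t] the orbit of v + t w would contain
     three independent vectors: v + t w, x (v + t w), and n w, which is n (v + t w) divided by t. *)
  have fr : row_free (rows3 v (x *m v) (n *m w)).
    apply: rows3_free => a b c E.
    have c0 : c = 0.
      apply/eqP/negPn/negP => cn0; case/negP: nO.
      have -> : n *m w = - c^-1 *: (a *: v + b *: (x *m v)).
        apply/eqP; rewrite -subr_eq0; apply/eqP; rewrite scaleNr opprK.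
        by rewrite -[RHS](scaler0 _ c^-1) -[in RHS]E [in RHS]scalerDr [c^-1 *: (c *: _)]scalerA
           mulVf // scale1r addrC.
      by rewrite memvZ // memvD // memvZ.
    by move: E; rewrite c0 scale0r addr0 => /ind2 [].
  have [t tn0 /rows3_ind ft] := generic_rows3 w (x *m w) fr.
  case: (no3 (v + t *: w) (v + t *: w) (x *m v + t *: (x *m w)) (n *m w)) => //.
  - by have := mem_orb (v + t *: w) (scalar_unital W 1); rewrite mul1mx.
  - by rewrite scalemxAr -mulmxDr mem_orb.
  - have := mem_orb (v + t *: w) nA; rewrite mulmxDr nv add0r -scalemxAr => h.
    by have := memvZ t^-1 h; rewrite scalerA mulVf // scale1r.
have annK n u : n \in ann W v -> u \in orb W v -> n *m u = 0.
  rewrite mem_ann => /andP [nA /eqP nv] /orbP [z zA ->].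
  by rewrite mulmxA (unital_comm Wc nA zA) -mulmxA nv mulmx0.
have rel n n' w : n \in ann W v -> n' \in ann W v ->
    exists b c, b *: (n *m w) + c *: (n' *m w) = 0 /\ (b != 0 \/ c != 0).
  move=> nN n'N; have nA : n \in unital W by move: nN; rewrite mem_ann => /andP [].
  have n'A : n' \in unital W by move: n'N; rewrite mem_ann => /andP [].
  have [wO|wO] := boolP (w \in orb W v).
    exists 1, 0; rewrite (annK n w) // (annK n' w) // !scaler0 addr0; split=> //.
    by left; rewrite oner_eq0.
  apply: contrapT => H.
  have wOw : w \in orb W w by have := mem_orb w (scalar_unital W 1); rewrite mul1mx.
  apply: (no3 w w (n *m w) (n' *m w)); rewrite ?mem_orb //.
  move=> a b c E.
  have a0 : a = 0.
    apply/eqP/negPn/negP => an0; case/negP: wO.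
    have -> : w = - a^-1 *: (b *: (n *m w) + c *: (n' *m w)).
      apply/eqP; rewrite -subr_eq0; apply/eqP; rewrite scaleNr opprK.
      rewrite -[RHS](scaler0 _ a^-1) -[in RHS]E -addrA [in RHS]scalerDr.
      by rewrite [a^-1 *: (a *: _)]scalerA mulVf // scale1r.
    by rewrite memvZ // memvD // memvZ // annO.
  move: E; rewrite a0 scale0r add0r => E.
  have [b0|bn0] := eqVneq b 0; last by case: H; exists b, c; split=> //; left.
  have [c0|cn0] := eqVneq c 0; last by case: H; exists b, c; split=> //; right.
  by [].
have [n1 [n2 [n1N n2N n12]]] := dim2_pair (H2 v).
have [w1 w1n] : exists w, n1 *m w != 0.
  apply: contrapT => h; have n10 : n1 = 0.
    by apply: mx4_eq0 => u; apply/eqP/negPn/negP => nz; apply: h; exists u.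
  have h0 : 1 *: n1 + 0 *: n2 = 0 by rewrite n10 scaler0 scale0r addr0.
  by have [/eqP] := n12 _ _ h0; rewrite oner_eq0.
have [g n2w1] : exists g, n2 *m w1 = g *: (n1 *m w1).
  have [b [c [E bc]]] := rel n1 n2 w1 n1N n2N.
  have cn0 : c != 0.
    apply/eqP => c0; move: E; rewrite c0 scale0r addr0 => /eqP.
    rewrite scaler_eq0 (negPf w1n) orbF => /eqP b0.
    by case: bc; rewrite ?b0 ?c0 eqxx.
  exists (- (c^-1 * b)); apply/eqP; rewrite -subr_eq0; apply/eqP; rewrite scaleNr opprK.
  by rewrite -[RHS](scaler0 _ c^-1) -[in RHS]E scalerDr !scalerA mulVf // scale1r addrC.
pose n3 := n2 - g *: n1.
have n3N : n3 \in ann W v by rewrite memvB // memvZ.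
have n3w1 : n3 *m w1 = 0 by rewrite mulmxBl -scalemxAl n2w1 subrr.
have [w2 w2n] : exists w, n3 *m w != 0.
  apply: contrapT => h; have n30 : n3 = 0.
    by apply: mx4_eq0 => u; apply/eqP/negPn/negP => nz; apply: h; exists u.
  have h0 : - g *: n1 + 1 *: n2 = 0 by rewrite -[RHS]n30 /n3 scaleNr scale1r addrC.
  by have [_ /eqP] := n12 _ _ h0; rewrite oner_eq0.
pose a := n3 *m w2.
have aO : a \in orb W v by apply: annO.
have lead b c u : u != 0 -> forall u', b *: u' + c *: u = 0 -> b != 0 \/ c != 0 ->
    exists d, u' = d *: u.
  move=> un0 u' E bc; have bn0 : b != 0.
    apply/eqP => b0; move: E; rewrite b0 scale0r add0r => /eqP.
    rewrite scaler_eq0 (negPf un0) orbF => /eqP c0.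
    by case: bc; rewrite ?b0 ?c0 eqxx.
  exists (- (b^-1 * c)); apply/eqP; rewrite -subr_eq0; apply/eqP; rewrite scaleNr opprK.
  by rewrite -[RHS](scaler0 _ b^-1) -[in RHS]E scalerDr !scalerA mulVf // scale1r.
have [c1 n1w2] : exists c, n1 *m w2 = c *: a.
  by have [b [c [E bc]]] := rel n1 n3 w2 n1N n3N; apply: (lead b c a w2n _ E bc).
(* At [w1] itself [rel] gives no information, since [n3] kills [w1]; at [w1 + w2] the value of [n3]
   is [a], which places [n1 *m w1] on the line of [a]. *)
have [c2 n1w12] : exists c, n1 *m (w1 + w2) = c *: a.
  have [b [c [E bc]]] := rel n1 n3 (w1 + w2) n1N n3N.
  by rewrite [n3 *m _]mulmxDr n3w1 add0r in E; apply: (lead b c a w2n _ E bc).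
pose d := c2 - c1.
have n1w1 : n1 *m w1 = d *: a by rewrite scalerBl -n1w12 -n1w2 mulmxDr addrK.
have dn0 : d != 0 by apply: contraNneq w1n => d0; rewrite n1w1 d0 scale0r.
have [i ai] : exists i, a i 0 != 0.
  apply: contrapT => h; case/negP: w2n; apply/eqP/colP => i; rewrite [RHS]mxE.
  by apply/eqP/negPn/negP => nz; apply: h; exists i.
pose f : 'rV[K]_4 := (a i 0)^-1 *: delta_mx 0 i.
have fa : f *m a = 1%:M.
  by apply/matrixP => j l; rewrite !ord1 /f -scalemxAl -rowE [LHS]mxE [row _ _ _ _]mxE mulVf // mxE.
clearbody n3 f d.
have mulTE (z : M4) : z^T *m f^T = (f *m z)^T by rewrite trmx_mul.
have [WU' dW' _] := transp_hyps.
exists f^T; have dS := dim_ann_orb WU' dW' f^T.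
have n1A : n1 \in unital W by move: n1N; rewrite mem_ann => /andP [].
have n3A : n3 \in unital W by move: n3N; rewrite mem_ann => /andP [].
suff : (3 <= \dim (orb (transp K @: W) f^T))%N.
  by rewrite -(leq_add2l (\dim (ann (transp K @: W) f^T))) dS addnC -[4%N]/(3 + 1)%N leq_add2l.
apply: (@free3_dim _ _ f^T (n1^T *m f^T) (n3^T *m f^T)); last first.
- exact: mem_orb (unital_transp n3A).
- exact: mem_orb (unital_transp n1A).
- by have := mem_orb f^T (scalar_unital (transp K @: W) 1); rewrite mul1mx.
apply: free3P => x0 x1 x2 E.
have {}E u : x0 *: (f *m u) + x1 *: (f *m (n1 *m u)) + x2 *: (f *m (n3 *m u)) = 0.
  have := congr1 (fun z : 'cV[K]_4 => z^T *m u) E; rewrite linear0 mul0mx => H.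
  rewrite -[RHS]H !mulTE !linearD /= !linearZ /= !trmxK !mulmxDl -!scalemxAl.
  by rewrite !mulmxA.
(* Evaluation of the relation at [a], [w1] and [w2] isolates the three coefficients one after the
   other. *)
have x00 : x0 = 0.
  have := E a; rewrite (annK n1) // (annK n3) // mulmx0 !scaler0 !addr0 fa.
  by rewrite scale_scalar_mx mulr1 => /matrixP/(_ 0 0); rewrite !mxE.
have x10 : x1 = 0.
  have := E w1; rewrite x00 scale0r add0r n3w1 mulmx0 scaler0 addr0 n1w1 -scalemxAr fa.
  rewrite !scale_scalar_mx mulr1 => /matrixP/(_ 0 0); rewrite !mxE => /eqP.
  by rewrite mulr1n mulf_eq0 (negPf dn0) orbF => /eqP.
split=> //; have := E w2; rewrite x00 x10 !scale0r !add0r fa.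
by rewrite scale_scalar_mx mulr1 => /matrixP/(_ 0 0); rewrite !mxE.
Qed.

Lemma commuting_trichotomy : in_cell W \/
  (exists2 f : 'rV[K]_4, f != 0 & forall x, x \in W -> exists u : 'cV[K]_4, x = u *m f) \/
  (exists2 v : 'cV[K]_4, v != 0 & forall x, x \in W -> exists f : 'rV[K]_4, x = v *m f).
Proof.
have [[v Hv]|H] := pselect (exists v, (\dim (ann W v) <= 1)%N).
  move: Hv; rewrite leq_eqVlt => /orP [/eqP dA|].
    by left; apply: (corank1_in_cell WU dW Wc dA).
  rewrite ltnS leqn0 => /eqP /(corank0 WU dW Wc) [|h]; first by left.
  by right; left.
have [|v Hv] := corank2_transp.
  by move=> v; rewrite ltnNge; apply/negP => h; apply: H; exists v.
have [WU' dW' Wc'] := transp_hyps.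
move: Hv; rewrite leq_eqVlt => /orP [/eqP dA|].
  by left; apply: in_cell_transp; apply: (corank1_in_cell WU' dW' Wc' dA).
rewrite ltnS leqn0 => /eqP /(corank0 WU' dW' Wc') [h|[f fn0 Hf]].
  by left; apply: in_cell_transp.
right; right; exists f^T; first by rewrite trmx_eq0.
move=> x xW; have [|u xu] := Hf x^T; first by rewrite -transpE memv_img.
by exists u^T; rewrite -trmx_mul -xu trmxK.
Qed.

End Fixed.
End SmallOrbits.

(** * Tangent directions at the minimal orbits *)

Section SingularPoints.
Variable K : numClosedFieldType.
Local Notation M4 := 'M[K]_4.
Local Notation sl4 := (sl K 4).
Local Notation Red4 := (Red K 4).
Local Notation dgen := (dgen K).

Definition egen (j : 'I_3) : M4 := delta_mx (lift ord_max j) ord_max.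

(** The point a(V) for V the hyperplane on which the last coordinate vanishes. *)
Definition vertex : {vspace M4} := <<[seq egen j | j : 'I_3]>>%VS.

Lemma egen_sl j : egen j \in sl4.
Proof.
rewrite mem_sl /mxtrace big1 // => i _; rewrite mxE.
by case: eqP => // ->; rewrite eq_sym (negPf (neq_lift _ _)).
Qed.

Lemma egen_free : free [tuple egen j | j < 3].
Proof.
apply/freeP => l; under eq_bigr do rewrite nth_mktuple.
move=> E j; have := congr1 (fun A : M4 => A (lift ord_max j) ord_max) E.
rewrite summxE mxE (bigD1 j) //= !mxE !eqxx mulr1 big1 ?addr0 //.
by move=> i ij; rewrite !mxE (inj_eq (@lift_inj _ _)) eq_sym (negPf ij) mulr0.
Qed.

(* In the basis [e_0 / s_0, e_1 / s_1, e_2 / s_2, e_3 - sum_j e_j / s_j] of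
   idempotents, multiplication by [e_j] in the algebra with unit [e_3] and
   [e_i e_j = s_j e_j] if [i = j], [0] otherwise, is diagonal. *)
Definition idem_mx (s : 'I_3 -> K) : M4 := 1%:M - \sum_j (s j)^-1 *: egen j.

Lemma egen_mul i j : egen i *m egen j = 0.
Proof.
by rewrite /egen mul_delta_mx_cond (negPf (neq_lift _ _)) mulr0n.
Qed.

Lemma idem_mx_inv s : idem_mx s *m (1%:M + \sum_j (s j)^-1 *: egen j) = 1%:M.
Proof.
rewrite /idem_mx mulmxBl mulmxDr !mul1mx mulmxDr mulmx1.
rewrite (_ : (\sum_j _) *m (\sum_j _) = 0) ?addr0 ?addrK //.
rewrite mulmx_suml big1 // => i _; rewrite mulmx_sumr big1 // => j _.
by rewrite -scalemxAl -scalemxAr egen_mul !scaler0.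
Qed.

Lemma idem_mx_unit s : idem_mx s \in unitmx.
Proof. by have [] := mulmx1_unit (idem_mx_inv s). Qed.

Lemma conj_idem s j : s j != 0 -> conj (idem_mx s) (s j *: dgen j) = egen j + s j *: dgen j.
Proof.
move=> sj; have sE : conj (idem_mx s) (dgen j) = dgen j + (s j)^-1 *: egen j.
  pose D : M4 := delta_mx (lift ord_max j) (lift ord_max j).
  have eD k : egen k *m D = 0.
    by rewrite /egen mul_delta_mx_cond (negPf (neq_lift _ _)) mulr0n.
  have De k : D *m egen k = (j == k)%:R *: egen j.
    rewrite /egen mul_delta_mx_cond (inj_eq (@lift_inj _ _)) -scaler_nat.
    by case: eqP => [->|]; rewrite ?scale0r.
  have PD : conj (idem_mx s) D = D + (s j)^-1 *: egen j.
    apply: (can_inj (mulmxK (idem_mx_unit s))); rewrite conjE mulmxKV ?idem_mx_unit //.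
    rewrite /idem_mx mulmxBl mul1mx mulmx_suml big1 ?subr0; last first.
      by move=> k _; rewrite -scalemxAl eD scaler0.
    rewrite mulmxBr mulmx1 mulmxDl !mulmx_sumr [X in _ - (_ + X)]big1 ?addr0; last first.
      by move=> k _; rewrite -scalemxAl -scalemxAr egen_mul !scaler0.
    rewrite (bigD1 j) //= big1 ?addr0 => [|k /negPf kj].
      by rewrite -scalemxAr De eqxx scale1r addrK.
    by rewrite -scalemxAr De eq_sym kj scale0r scaler0.
  rewrite -[dgen j]/(D - (4%:R^-1)%:M) linearB /= PD conjE mul_mx_scalar -scalemxAl mulmxV ?idem_mx_unit //.
  by rewrite scalemx1 addrAC.
by rewrite linearZ /= sE scalerDr scalerA mulfV // scale1r addrC.
Qed.

Section CartanCurve.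
Variables (g : M4) (L : 'M[K]_3) (j0 : 'I_3).
Hypotheses (gu : g \in unitmx) (Lu : L \in unitmx).
Hypothesis gL : forall i, \sum_j L i j *: conj g (egen j) = egen i.

(** By [gL], conjugation by [g] preserves [vertex] and [L] undoes its action there, so all these
    curves start at the same family [egen]. They come from s_j = t for j = j0 and s_j = t^2
    otherwise: only [j0] contributes to first order, while every s_j is nonzero when t is. *)
Definition cartan_curve (i : 'I_3) (s : nat) : M4 :=
  if s == 0%N then egen i else if s == 1%N then L i j0 *: conj g (dgen j0) else
  \sum_(j | j != j0) L i j *: conj g (dgen j).

Lemma cartan_curve_sl i s : cartan_curve i s \in sl4.
Proof.
have cs j : conj g (dgen j) \in sl4 by rewrite mem_sl conj_tr // -mem_sl dgen_sl.
rewrite /cartan_curve; case: eqP => _; first exact: egen_sl.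
case: eqP => _; first by rewrite memvZ.
by apply: memv_suml => j _; rewrite memvZ.
Qed.

Lemma cartan_curve_span (t : K) : t != 0 ->
  exists2 P, P \in unitmx & curve_span 1 cartan_curve t = cartan P.
Proof.
move=> tn0; pose s j := if j == j0 then t else t ^+ 2.
have sn0 j : s j != 0 by rewrite /s; case: ifP => _ //; rewrite expf_neq0.
have Pu : g *m idem_mx s \in unitmx by rewrite unitmx_mul gu idem_mx_unit.
exists (g *m idem_mx s) => //.
pose Q : 'M[K]_3 := \matrix_(i, j) (L i j * s j).
have QE : Q = L *m diag_mx (\row_j s j).
  by apply/matrixP => i j; rewrite mul_mx_diag !mxE.
apply: (span_fam_unit (Q := Q)) => [|i].
  rewrite QE unitmx_mul Lu unitmxE det_diag unitfE; apply/prodf_neq0 => j _.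
  by rewrite mxE.
have -> : curve 1 cartan_curve t i = egen i + (t *: (L i j0 *: conj g (dgen j0)) +
    t ^+ 2 *: \sum_(j | j != j0) L i j *: conj g (dgen j)).
  rewrite /curve !big_ord_recl big_ord0 addr0 /cartan_curve /= expr0 scale1r.
  by rewrite /bump /= expr1.
transitivity (\sum_j L i j *: conj g (egen j + s j *: dgen j)); last first.
  apply: eq_bigr => j _; rewrite -conj_idem // -conjM ?idem_mx_unit //.
  by rewrite [Q i j]mxE linearZ /= scalerA.
under [RHS]eq_bigr do rewrite linearD /= linearZ /= scalerDr.
rewrite big_split /= gL; congr (_ + _); rewrite [RHS](bigD1 j0) //=; congr (_ + _).
  by rewrite /s eqxx !scalerA mulrC.
rewrite scaler_sumr; apply: eq_bigr => j /negPf jj0.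
by rewrite /s jj0 !scalerA mulrC.
Qed.

Lemma cartan_curve0 : curve_span 1 cartan_curve 0 = vertex.
Proof. by rewrite /curve_span /vertex; congr <<_>>%VS; apply: eq_map => i; rewrite curve0. Qed.

Lemma cartan_curve_Red t : 'X.[t] != 0 -> Red4 (curve_span 1 cartan_curve t).
Proof. by rewrite hornerX => /cartan_curve_span [P Pu ->]; apply: cartan_Red. Qed.

Lemma vertex_Red_of_curve : Red4 vertex.
Proof.
rewrite -cartan_curve0; apply: (curve_closed cartan_curve_sl (Red_closed K) _ cartan_curve_Red).
  by rewrite polyX_eq0.
exact: egen_free.
Qed.

Lemma vertex_tangent m (b : 3.-tuple M4) (c : m.-tuple M4) : basis_of sl4 (b ++ c) ->
  <<b>>%VS = vertex ->
  tangent_space Red4 b c (\adj (bmx b c egen) *m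
    cmx b c (fun i => L i j0 *: conj g (dgen j0))).
Proof.
move=> bc bv; have := curve_tangent (L := 1) cartan_curve_sl bc _ _ cartan_curve_Red.
rewrite cartan_curve0 bv => /(_ erefl); rewrite polyX_eq0; exact.
Qed.

End CartanCurve.

End SingularPoints.

(** * Thirteen independent tangent directions *)

Section VertexTangent.
Variable K : numClosedFieldType.
Local Open Scope classical_set_scope.
Local Notation M4 := 'M[K]_4.
Local Notation sl4 := (sl K 4).
Local Notation Red4 := (Red K 4).
Local Notation dgen := (dgen K).
Local Notation egen := (egen K).
Local Notation vertex := (vertex K).
Local Notation le j := (lift (@ord_max 3) j).

Lemma free_family_dim (I : finType) (vT : vectType K) (D : I -> vT) (E : {vspace vT}) :
  (forall x, D x \in E) -> (forall l : I -> K, \sum_x l x *: D x = 0 -> forall x, l x = 0) ->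
  (#|I| <= \dim E)%N.
Proof.
move=> DE ind; have /eqP : free [tuple D (enum_val i) | i < #|I|].
  apply/freeP => l; under eq_bigr do rewrite nth_mktuple.
  move=> E0 i; have := ind (fun x => l (enum_rank x)) _ (enum_val i).
  rewrite enum_valK; apply; rewrite -[RHS]E0 (reindex (@enum_val _ (mem I))) /=.
    by apply: eq_bigr => j _; rewrite enum_valK.
  by exists enum_rank => x _; rewrite ?enum_valK ?enum_rankK.
rewrite size_tuple => <-; apply: dimvS; apply/span_subvP => _ /tnthP [i ->].
by rewrite tnth_mktuple.
Qed.

(** Conjugation by this elementary matrix sends [egen b] to [egen b + egen a] and fixes the other
    [egen j]; [shearL] is the inverse change of family. *)
Definition shear (a b : 'I_3) : M4 := 1%:M + delta_mx (le a) (le b).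
Definition shearL (a b : 'I_3) : 'M[K]_3 := 1%:M - delta_mx b a.

Section Shear.
Variables a b : 'I_3.
Hypothesis ab : a != b.

Let Eab : M4 := delta_mx (le a) (le b).

Let leE i j : (le i == le j) = (i == j).
Proof. by rewrite (inj_eq (@lift_inj _ _)). Qed.

Let EE : Eab *m Eab = 0.
Proof. by rewrite /Eab mul_delta_mx_cond leE eq_sym (negPf ab) mulr0n. Qed.

Lemma shear_mul : shear a b *m (1%:M - Eab) = 1%:M.
Proof. by rewrite /shear mulmxDl mul1mx mulmxBr mulmx1 -/Eab EE subr0 subrK. Qed.

Lemma shear_unit : shear a b \in unitmx.
Proof. by have [] := mulmx1_unit shear_mul. Qed.

Lemma shear_inv : invmx (shear a b) = 1%:M - Eab.
Proof. by rewrite -[LHS]mulmx1 -[X in _ *m X = _]shear_mul mulKmx ?shear_unit. Qed.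

Lemma shearL_unit : shearL a b \in unitmx.
Proof.
have : shearL a b *m (1%:M + delta_mx b a) = 1%:M.
  rewrite /shearL mulmxBl mul1mx mulmxDr mulmx1 mul_delta_mx_cond (negPf ab) mulr0n.
  by rewrite addr0 addrK.
by move=> /mulmx1_unit [].
Qed.

Lemma shear_delta (i j : 'I_4) : conj (shear a b) (delta_mx i j) =
  delta_mx i j + (le b == i)%:R *: delta_mx (le a) j - (j == le a)%:R *: delta_mx i (le b)
  - ((le b == i) && (j == le a))%:R *: Eab.
Proof.
rewrite conjE shear_inv /shear mulmxDl mul1mx mul_delta_mx_cond -scaler_nat.
rewrite mulmxBr mulmx1 mulmxDl -scalemxAl /Eab !mul_delta_mx_cond -!scaler_nat.
by rewrite scalerA -natrM mulnb opprD addrA.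
Qed.

Lemma shear_egen i : \sum_j shearL a b i j *: conj (shear a b) (egen j) = egen i.
Proof.
have cE j : conj (shear a b) (egen j) = egen j + (b == j)%:R *: egen a.
  rewrite -[egen j]/(delta_mx (le j) ord_max) shear_delta leE (negPf (neq_lift _ _)).
  by rewrite andbF !scale0r !subr0 //.
have LE j : shearL a b i j = (j == i)%:R - (i == b)%:R * (j == a)%:R.
  by rewrite !mxE eq_sym -mulnb natrM.
under eq_bigr do rewrite cE scalerDr LE scalerA scalerBl.
rewrite big_split sumrB /= (bigD1 i) //= eqxx scale1r big1 ?addr0; last first.
  by move=> j /negPf ->; rewrite scale0r.
rewrite [X in _ - X](bigD1 a) //= eqxx mulr1 [X in _ - (_ + X)]big1 ?addr0; last first.
  by move=> j /negPf ->; rewrite mulr0 scale0r.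
rewrite [X in _ + X](bigD1 b) //= eqxx mulr1 [X in _ + (_ + X)]big1 ?addr0; last first.
  by move=> j; rewrite eq_sym => /negPf ->; rewrite mulr0 scale0r.
by rewrite eq_sym [b == a]eq_sym (negPf ab) mulr0 subr0 subrK.
Qed.

Let dgen_def j : dgen j = delta_mx (le j) (le j) - (4%:R^-1)%:M.
Proof. by []. Qed.

Lemma shear_dgen j : conj (shear a b) (dgen j) = dgen j +
  (b == j)%:R *: Eab - (j == a)%:R *: Eab.
Proof.
have -> : conj (shear a b) (dgen j) =
    conj (shear a b) (delta_mx (le j) (le j)) - (4%:R^-1)%:M.
  rewrite dgen_def linearB /=; congr (_ - _).
  by rewrite conjE mul_mx_scalar -scalemxAl mulmxV ?shear_unit // scalemx1.
rewrite shear_delta !leE dgen_def.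
have -> : (b == j) && (j == a) = false.
  by apply/negP => /andP [/eqP bj /eqP ja]; have := ab; rewrite bj ja eqxx.
rewrite scale0r subr0.
have -> : (b == j)%:R *: delta_mx (le a) (le j) = (b == j)%:R *: Eab.
  by case: eqP => [<-|]; rewrite ?scale0r.
have -> : (j == a)%:R *: delta_mx (le j) (le b) = (j == a)%:R *: Eab.
  by case: eqP => [->|]; rewrite ?scale0r.
by rewrite addrAC; congr (_ - _); rewrite addrAC.
Qed.

End Shear.
Lemma vertex_Red : Red4 vertex.
Proof.
apply: (@vertex_Red_of_curve K 1%:M 1%:M ord0); rewrite ?unitmx1 // => i.
rewrite (bigD1 i) //= big1 => [|j /negPf ij]; rewrite mxE ?eqxx ?scale1r ?addr0.
  by rewrite conjE mul1mx invmx1 mulmx1.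
by rewrite eq_sym ij scale0r.
Qed.

(* Tangent directions: the first-order deformations [e_b^2 = t e_a], [e_a e_b = t e_a]
   and [e_0^2 = t e_0] of the algebra with unit [e_3] and [e_i e_j = 0]. *)
Definition square_dir (a b i : 'I_3) : M4 := (i == b)%:R *: delta_mx (le a) (le b).
Definition cross_dir (a b i : 'I_3) : M4 :=
  (i == a)%:R *: delta_mx (le a) (le b) + (i == b)%:R *: dgen a.
Definition idem_dir (a i : 'I_3) : M4 := (i == a)%:R *: dgen a.

Definition dirs (x : option ('I_3 * 'I_2 * bool)) (i : 'I_3) : M4 :=
  match x with
  | Some (a, b, false) => square_dir a (lift a b) i
  | Some (a, b, true) => cross_dir a (lift a b) i
  | None => idem_dir ord0 i
  end.

(** With [dirs_row] and [dirs_col], this locates for each [x] other than [None] an entry that is 1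
    in the direction [x] and 0 in all the others. For [None] the entry is diagonal and other
    directions contribute to it, so its coefficient is treated last. *)
Definition dirs_ix (x : option ('I_3 * 'I_2 * bool)) : 'I_3 :=
  match x with
  | Some (a, b, false) => lift a b
  | Some (a, b, true) => a
  | None => ord0
  end.
Definition dirs_row (x : option ('I_3 * 'I_2 * bool)) : 'I_3 :=
  if x is Some (a, b, _) then a else ord0.
Definition dirs_col (x : option ('I_3 * 'I_2 * bool)) : 'I_3 :=
  if x is Some (a, b, _) then lift a b else ord0.

Lemma dgen_offdiag j p q : p != q -> dgen j (le p) (le q) = 0.
Proof.
move=> /negPf pq; have /is_diag_mxP := dgen_diag K j; apply.
by rewrite (inj_eq val_inj) (inj_eq (@lift_inj _ _)) pq.
Qed.

Lemma dirs_entry x y : y != None -> x != None ->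
  dirs y (dirs_ix x) (le (dirs_row x)) (le (dirs_col x)) = (x == y)%:R.
Proof.
have leE i j : (le i == le j) = (i == j) by rewrite (inj_eq (@lift_inj _ _)).
case: y => [[[a' b'] s']|//] _; case: x => [[[a b] s]|//] _.
have ab : (a == lift a b) = false by rewrite (negPf (neq_lift _ _)).
have dg (j : 'I_3) : dgen j (le a) (le (lift a b)) = 0.
  by rewrite dgen_offdiag ?neq_lift.
have E : (Some (a, b, s) == Some (a', b', s')) = [&& a == a', lift a b == lift a' b' & s == s'].
  rewrite -[LHS]/((a, b, s) == (a', b', s')) -pair_eqE /= -pair_eqE /= -andbA.
  by case: (a =P a') => //= ->; rewrite (inj_eq (@lift_inj _ _)).
have sqE (c d i p q : 'I_3) : square_dir c d i (le p) (le q) =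
    [&& i == d, p == c & q == d]%:R.
  by rewrite /square_dir mxE [delta_mx _ _ _ _]mxE !leE -natrM mulnb.
have crE (c d i p q : 'I_3) : cross_dir c d i (le p) (le q) =
    [&& i == c, p == c & q == d]%:R + (i == d)%:R * dgen c (le p) (le q).
  rewrite /cross_dir [LHS]mxE [X in X + _]mxE [X in _ + X]mxE [delta_mx _ _ _ _]mxE !leE.
  by rewrite -natrM mulnb.
rewrite E; case: s' {E}; case: s => /=; rewrite ?sqE ?crE ?dg ?mulr0 ?addr0 ?andbT ?andbF.
- by rewrite andbA andbb.
- case: (a =P a') => [<-|]; rewrite ?andbF //=.
  by rewrite [lift a b == a]eq_sym ab.
- suff -> : [&& a == lift a' b', a == a' & lift a b == lift a' b'] = false by [].
  by apply/negP => /and3P [/eqP <- _]; rewrite eq_sym ab.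
- by rewrite andbCA andbb.
Qed.

Lemma dirs_entry_None x : x != None -> idem_dir ord0 (dirs_ix x) (le (dirs_row x))
  (le (dirs_col x)) = 0.
Proof.
case: x => [[[a b] s]|//] _; rewrite /idem_dir mxE /=.
by rewrite dgen_offdiag ?neq_lift // mulr0.
Qed.

Lemma dirs_independent (l : option ('I_3 * 'I_2 * bool) -> K) :
  (forall i, \sum_x l x *: dirs x i \in vertex) -> forall x, l x = 0.
Proof.
move=> H.
have vE (y : M4) (p q : 'I_3) : y \in vertex -> y (le p) (le q) = 0.
  move=> /span_famP [c ->]; rewrite summxE big1 // => j _.
  by rewrite !mxE [_ == ord_max]eq_sym (negPf (neq_lift _ _)) andbF mulr0.
have lS x : x != None -> l x = 0.
  move=> xN; have := vE _ (dirs_row x) (dirs_col x) (H (dirs_ix x)).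
  rewrite summxE (bigD1 x) //= mxE dirs_entry // eqxx mulr1 big1 ?addr0 // => y yx.
  rewrite mxE; have [->|yN] := eqVneq y None; first by rewrite dirs_entry_None ?mulr0.
  by rewrite dirs_entry // eq_sym (negPf yx) mulr0.
case=> [x|]; first exact: lS.
have := vE _ ord0 ord0 (H ord0); rewrite summxE (bigD1 None) //= big1 ?addr0 => [|x xN].
  have v00 : dgen ord0 (le ord0) (le ord0) = 3%:R / 4%:R.
    by rewrite dgenE !eqxx /= ; field.
  rewrite mxE [idem_dir _ _]/idem_dir mxE eqxx mul1r v00 => /eqP.
  by rewrite !mulf_eq0 invr_eq0 !pnatr_eq0 !orbF => /eqP.
by rewrite mxE lS ?mul0r.
Qed.

(** [D] turns a first-order deformation of [egen] into its tangent matrix, up to a common factor,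
    and on deformations inside sl4 it kills only those with values in [vertex]. Independence modulo
    [vertex] therefore suffices. A shear for (p, q) contributes the idempotent plus the square
    direction at index q, and the idempotent plus the square minus the cross direction at index
    p. *)
Lemma vertex_tangent_dim d : tangent_dim sl4 3 Red4 vertex d -> (13 <= d)%N.
Proof.
move=> [m [b [c [bc bv [E [HE <-]]]]]].
pose D (be : 'I_3 -> M4) := \adj (bmx b c egen) *m cmx b c be.
have ET A : tangent_space Red4 b c A -> A \in E.
  by move=> TA; have : [set A | A \in E] A by rewrite HE.
have DD be be' : D (fun i => be i + be' i) = D be + D be'.
  rewrite /D -mulmxDr; congr (_ *m _); apply/matrixP => i j.
  by rewrite !mxE linearD.
have DZ t be : D (fun i => t *: be i) = t *: D be.
  rewrite /D scalemxAr; congr (_ *m _); apply/matrixP => i j.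
  by rewrite !mxE linearZ.
have Dext be be' : be =1 be' -> D be = D be' by move=> /funext ->.
have idE j : D (idem_dir j) \in E.
  apply: ET; have := @vertex_tangent K 1%:M 1%:M j (unitmx1 _ _) (unitmx1 _ _) _ m b c bc bv.
  rewrite -/(D _) (Dext _ (idem_dir j)); first apply.
    move=> i; rewrite (bigD1 i) //= big1 => [|k /negPf ik]; rewrite mxE ?eqxx ?scale1r ?addr0.
      by rewrite conjE mul1mx invmx1 mulmx1.
    by rewrite eq_sym ik scale0r.
  by move=> i; rewrite /idem_dir mxE conjE mul1mx invmx1 mulmx1.
have shE p q j : p != q -> D (fun i => shearL p q i j *: conj (shear p q) (dgen j)) \in E.
  move=> pq; apply: ET.
  exact: (@vertex_tangent K _ _ j (shear_unit pq) (shearL_unit pq) (shear_egen pq) m b c bc bv).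
have sqE p q : p != q -> D (square_dir p q) \in E.
  move=> pq; have -> : D (square_dir p q) =
      D (fun i => shearL p q i q *: conj (shear p q) (dgen q)) - D (idem_dir q).
    rewrite -scaleN1r -DZ -DD; apply: Dext => i.
    rewrite shear_dgen // eqxx eq_sym (negPf pq) scale0r subr0 scale1r /square_dir /idem_dir.
    have -> : shearL p q i q = (i == q)%:R.
      by rewrite !mxE [q == p]eq_sym (negPf pq) andbF subr0.
    by rewrite scalerDr scaleN1r addrAC subrr add0r.
  by apply: memvB; [apply: shE|apply: idE].
have crE p q : p != q -> D (cross_dir p q) \in E.
  move=> pq; have -> : D (cross_dir p q) = D (idem_dir p) + D (square_dir p q) -
      D (fun i => shearL p q i p *: conj (shear p q) (dgen p)).
    rewrite -scaleN1r -DZ -!DD; apply: Dext => i.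
    rewrite shear_dgen // eqxx [q == p]eq_sym (negPf pq) scale0r addr0 scale1r.
    have -> : shearL p q i p = (i == p)%:R - (i == q)%:R.
      by rewrite !mxE eqxx andbT.
    rewrite /cross_dir /idem_dir /square_dir; move: (dgen p) (delta_mx _ _) => X Y.
    by apply/matrixP => r s; rewrite !mxE; ring.
  by rewrite memvB ?shE // memvD ?idE ?sqE.
have dE x : D (dirs x) \in E.
  case: x => [[[p q] [|]]|] /=; last exact: idE.
    by apply: crE; apply: neq_lift.
  by apply: sqE; apply: neq_lift.
have card : #|{: option ('I_3 * 'I_2 * bool)}| = 13%N.
  by rewrite card_option !card_prod !card_ord card_bool.
rewrite -card; apply: (free_family_dim dE) => l l0; apply: dirs_independent => i.
have Du : bmx b c egen \in unitmx.
  have := span_chart_inv (A := 0) bc (@egen_sl K); rewrite chart0 bv => /(_ erefl).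
  by case.
have C0 : cmx b c (fun i => \sum_x l x *: dirs x i) = 0.
  have : D (fun i => \sum_x l x *: dirs x i) = 0.
    rewrite -[RHS]l0 /D; under [RHS]eq_bigr do rewrite -DZ /D.
    rewrite -mulmx_sumr; congr (_ *m _); apply/matrixP => p q.
    rewrite summxE mxE linear_sum; apply: eq_bigr => x _; by rewrite mxE.
  move=> /(congr1 (mulmx (bmx b c egen))); rewrite /D mulmxA mul_mx_adj mulmx0.
  rewrite mul_scalar_mx => /eqP; rewrite scaler_eq0 => /orP [|/eqP //].
  by rewrite -[_ == 0]negbK -unitfE -unitmxE Du.
have : \sum_x l x *: dirs x i \in sl4.
  apply: memv_suml => x _; apply: memvZ.
  have dd (p q : 'I_3) : p != q -> delta_mx (le p) (le q) \in sl4.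
    move=> pq; rewrite mem_sl /mxtrace big1 // => k _; rewrite mxE.
    by case: eqP => // ->; rewrite (inj_eq (@lift_inj _ _)) (negPf pq).
  case: x => [[[p q] [|]]|] /=.
  - apply: memvD; apply: memvZ; [apply: dd; apply: neq_lift|apply: dgen_sl].
  - apply: memvZ; apply: dd; apply: neq_lift.
  - apply: memvZ; apply: dgen_sl.
move=> xs; rewrite (bc_decomp bc (w := fun i => \sum_x l x *: dirs x i) xs) C0.
rewrite [X in _ + X]big1 ?addr0 => [|j _]; last by rewrite mxE scale0r.
rewrite -bv; apply: memv_suml => j _; apply: memvZ; apply: memv_span; exact: mem_tnth.
Qed.

End VertexTangent.

(** * The spaces a(V) as points of the Grassmannian *)

Section MinimalOrbits.
Variable K : numClosedFieldType.
Local Open Scope classical_set_scope.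
Local Notation M4 := 'M[K]_4.
Local Notation sl4 := (sl K 4).
Local Notation vertex := (vertex K).
Implicit Types (W : {vspace M4}) (f : 'rV[K]_4) (v : 'cV[K]_4).

Definition row_ker f : {vspace 'cV[K]_4} := lker (linfun (mulmx f : 'cV[K]_4 -> 'M[K]_1)).
Definition col_ker v : {vspace 'rV[K]_4} := lker (linfun (mulmxr v : 'rV[K]_4 -> 'M[K]_1)).

Lemma mem_row_ker f v : (v \in row_ker f) = (f *m v == 0).
Proof. by rewrite memv_ker lfunE. Qed.

Lemma mem_col_ker f v : (f \in col_ker v) = (f *m v == 0).
Proof. by rewrite memv_ker lfunE. Qed.

Lemma row_dual f : f != 0 -> exists e : 'cV[K]_4, f *m e = 1%:M.
Proof.
move=> /rV0Pn [i fi]; exists ((f 0 i)^-1 *: delta_mx i 0).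
by apply/matrixP => a b; rewrite !ord1 -scalemxAr -colE [LHS]mxE [col _ _ _ _]mxE mulVf // mxE.
Qed.

Lemma col_dual v : v != 0 -> exists e : 'rV[K]_4, e *m v = 1%:M.
Proof.
rewrite -trmx_eq0 => /row_dual [e He]; exists e^T.
by rewrite -[v]trmxK -trmx_mul He trmx1.
Qed.

Lemma dim_lker_form (aT : vectType K) (g : 'Hom(aT, 'M[K]_1)) x : dim aT = 4 -> g x != 0 ->
  \dim (lker g) = 3.
Proof.
move=> d4 gx; have := limg_ker_dim g fullv; rewrite capfv dimvf d4.
have le1 : (\dim (limg g) <= 1)%N.
  by apply: leq_trans (dimvS (subvf _)) _; rewrite dimvf.
have ge1 : (0 < \dim (limg g))%N.
  rewrite lt0n dimv_eq0; apply: contraNneq gx => l0.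
  by rewrite -memv0 -l0 memv_img ?memvf.
by have -> : \dim (limg g) = 1%N by [apply/eqP; rewrite eqn_leq le1 ge1]; rewrite addn1 => -[].
Qed.

Lemma dim_row_ker f : f != 0 -> \dim (row_ker f) = 3.
Proof.
move=> /row_dual [e fe]; apply: (dim_lker_form (x := e)) => //.
by rewrite lfunE /= fe; apply/eqP => /matrixP/(_ 0 0); rewrite !mxE => /eqP; rewrite oner_eq0.
Qed.

Lemma dim_col_ker v : v != 0 -> \dim (col_ker v) = 3.
Proof.
move=> /col_dual [e ev]; apply: (dim_lker_form (x := e)) => //.
by rewrite lfunE /= ev; apply/eqP => /matrixP/(_ 0 0); rewrite !mxE => /eqP; rewrite oner_eq0.
Qed.

Lemma frak_aP (V : {vspace 'cV[K]_4}) x :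
  frak_a V x <-> (forall u, x *m u \in V) /\ (forall u, u \in V -> x *m u = 0).
Proof.
rewrite /frak_a /=; split=> [[h1 h2]|[h1 h2]]; split.
- move=> u; apply: (subvP h1); apply/memv_imgP; exists u; rewrite ?memvf //.
  by rewrite lfunE.
- by move=> u /(subvP h2); rewrite memv_ker lfunE => /eqP.
- by apply/subvP => _ /memv_imgP [u _ ->]; rewrite lfunE; apply: h1.
- by apply/subvP => u uV; rewrite memv_ker lfunE; apply/eqP/h2.
Qed.

Lemma frak_a_row_ker f x : f != 0 ->
  frak_a (row_ker f) x <-> exists2 u, u \in row_ker f & x = u *m f.
Proof.
move=> /row_dual [e fe]; rewrite frak_aP; split=> [[h1 h2]|[u uV ->]].
  exists (x *m e) => //; apply/eqP; rewrite -subr_eq0; apply/eqP/mx4_eq0 => y.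
  have yV : y - e *m (f *m y) \in row_ker f.
    by rewrite mem_row_ker mulmxBr [f *m (e *m _)]mulmxA fe mul1mx subrr.
  by rewrite mulmxBl -!mulmxA -mulmxBr h2.
move: uV; rewrite mem_row_ker => /eqP fu; split=> y.
  by rewrite mem_row_ker !mulmxA fu !mul0mx.
by rewrite mem_row_ker => /eqP fy; rewrite -mulmxA fy mulmx0.
Qed.

Lemma frak_a_line v x : v != 0 ->
  frak_a <[v]>%VS x <-> exists2 f, f \in col_ker v & x = v *m f.
Proof.
move=> /col_dual [e ev]; rewrite frak_aP; split=> [[h1 h2]|[f fV ->]].
  exists (e *m x); first by rewrite mem_col_ker -mulmxA h2 ?memv_line // mulmx0.
  apply/eqP; rewrite -subr_eq0; apply/eqP/mx4_eq0 => y.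
  have /vlineP [c xy] := h1 y.
  by rewrite mulmxBl -!mulmxA xy -scalemxAr ev -scalemxAr mulmx1 subrr.
move: fV; rewrite mem_col_ker => /eqP fv; split=> [y|y /vlineP [c ->]].
  by apply/vlineP; exists ((f *m y) 0 0); rewrite -mulmxA [f *m y]mx11_scalar mul_mx_scalar !mxE eqxx mulr1n.
by rewrite -scalemxAr -mulmxA fv mulmx0 scaler0.
Qed.

Lemma Omin3_row W : Omin K 4 3 W ->
  exists2 f, f != 0 & forall x, x \in W <-> exists2 u, u \in row_ker f & x = u *m f.
Proof.
move=> [V dV WV].
have [f [fn0 fC]] := @kernel_vector K 4 3 (\matrix_(a < 4, i < 3) (vbasis V)`_i a 0) isT.
have VE : V = row_ker f.
  apply/eqP; rewrite eqEdim dim_row_ker // dV leqnn andbT -(span_basis (vbasisP V)).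
  apply/span_subvP => _ /tnthP [i ->]; have i3 : (i < 3)%N by rewrite -[X in (_ < X)%N]dV.
  rewrite (tnth_nth 0).
  rewrite mem_row_ker; apply/eqP/matrixP => a b; rewrite !ord1.
  have := congr1 (fun B : 'rV_3 => B 0 (Ordinal i3)) fC; rewrite !mxE => H; rewrite -[RHS]H.
  by apply: eq_bigr => j _; rewrite mxE.
exists f => // x; rewrite -frak_a_row_ker // -VE -WV //.
Qed.

Lemma Omin1_col W : Omin K 4 1 W ->
  exists2 v, v != 0 & forall x, x \in W <-> exists2 f, f \in col_ker v & x = v *m f.
Proof.
move=> [V /dim1_line [v [vV vn0 Vv]] WV].
have VE : V = <[v]>%VS.
  apply/vspaceP => u; apply/idP/vlineP => [/Vv //|[c ->]].
  by rewrite memvZ.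
by exists v => // x; rewrite -frak_a_line // -VE -WV.
Qed.

(** The trace of [u *m f] is the scalar [f *m u], so tracelessness puts [u] in the kernel of [f];
    equality then follows from the dimension 3 on both sides. *)
Lemma Omin3_of_row W f : grassmannian sl4 3 W -> f != 0 ->
  (forall x, x \in W -> exists u : 'cV[K]_4, x = u *m f) -> Omin K 4 3 W.
Proof.
move=> [WU dW] fn0 Wf; exists (row_ker f); first exact: dim_row_ker.
pose H : 'Hom('cV[K]_4, M4) := linfun (mulmxr f).
have HE u : H u = u *m f by rewrite lfunE.
have [e fe] := row_dual fn0.
have Hinj : lker H == 0%VS.
  apply/lker0P => u u'; rewrite !HE => /(congr1 (mulmx^~ e)).
  by rewrite -!mulmxA fe !mulmx1.
have WE : W = (H @: row_ker f)%VS.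
  apply/eqP; rewrite eqEdim limg_dim_eq ?(eqP Hinj) ?capv0 // dim_row_ker // dW leqnn andbT.
  apply/subvP => x xW; have [u xu] := Wf x xW; apply/memv_imgP; exists u; rewrite ?HE //.
  have := subvP WU x xW; rewrite mem_sl xu mxtrace_mulC /mxtrace big_ord1 mem_row_ker.
  by move=> /eqP fu; apply/eqP/matrixP => a b; rewrite !ord1 fu mxE.
apply/seteqP; split=> x /=; rewrite frak_a_row_ker // WE.
  by move=> /memv_imgP [u uV ->]; exists u; rewrite ?HE.
by move=> [u uV ->]; rewrite -HE memv_img.
Qed.

Lemma Omin1_of_col W v : grassmannian sl4 3 W -> v != 0 ->
  (forall x, x \in W -> exists f : 'rV[K]_4, x = v *m f) -> Omin K 4 1 W.
Proof.
move=> [WU dW] vn0 Wv; exists <[v]>%VS; first by rewrite dim_vline vn0.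
pose H : 'Hom('rV[K]_4, M4) := linfun (mulmx v).
have HE f : H f = v *m f by rewrite lfunE.
have [e ev] := col_dual vn0.
have Hinj : lker H == 0%VS.
  apply/lker0P => u u'; rewrite !HE => /(congr1 (mulmx e)).
  by rewrite !mulmxA ev !mul1mx.
have WE : W = (H @: col_ker v)%VS.
  apply/eqP; rewrite eqEdim limg_dim_eq ?(eqP Hinj) ?capv0 // dim_col_ker // dW leqnn andbT.
  apply/subvP => x xW; have [f xf] := Wv x xW; apply/memv_imgP; exists f; rewrite ?HE //.
  have := subvP WU x xW; rewrite mem_sl xf mxtrace_mulC /mxtrace big_ord1 mem_col_ker.
  by move=> /eqP fv; apply/eqP/matrixP => a b; rewrite !ord1 fv mxE.
apply/seteqP; split=> x /=; rewrite frak_a_line // WE.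
  by move=> /memv_imgP [f fV ->]; exists f; rewrite ?HE.
by move=> [f fV ->]; rewrite -HE memv_img.
Qed.

(** A common point would contain [v *m g] for all [g] in a 3-dimensional space of rows, and each
    such [g] would be a multiple of the single row [f]. *)
Lemma Omin_disjoint : Omin K 4 1 `&` Omin K 4 3 = set0.
Proof.
apply/seteqP; split=> // W [/Omin1_col [v vn0 H1] /Omin3_row [f fn0 H3]].
have [e ev] := col_dual vn0.
have : (col_ker v <= <[f]>)%VS.
  apply/subvP => g gV; have /H3 [u _ E] : v *m g \in W by apply/H1; exists g.
  apply/vlineP; exists ((e *m u) 0 0); rewrite -[g]mul1mx -ev -mulmxA E mulmxA.
  by rewrite [e *m u]mx11_scalar mul_scalar_mx !mxE eqxx mulr1n.
by move=> /dimvS; rewrite dim_col_ker // dim_vline fn0.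
Qed.

Lemma mem_vertex (y : M4) : y \in vertex <->
  exists2 u : 'cV[K]_4, u ord_max 0 = 0 & y = u *m delta_mx 0 ord_max.
Proof.
split=> [/span_famP [l ->]|[u u3 ->]].
  exists (\sum_j l j *: delta_mx (lift ord_max j) 0).
    by rewrite summxE big1 // => j _; rewrite !mxE (negPf (neq_lift _ _)) mulr0.
  rewrite mulmx_suml; apply: eq_bigr => j _.
  by rewrite -scalemxAl mul_delta_mx.
apply/span_famP; exists (fun j => u (lift ord_max j) 0).
have {1}-> : u = \sum_(j < 3) u (lift ord_max j) 0 *: delta_mx (lift ord_max j) 0.
  apply/colP => a; rewrite summxE.
  have [j ->|->] := unliftP ord_max a; last first.
    by rewrite u3 big1 // => j _; rewrite !mxE (negPf (neq_lift _ _)) mulr0.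
  rewrite (bigD1 j) //= big1 ?addr0; first by rewrite !mxE !eqxx mulr1.
  by move=> i ij; rewrite !mxE (inj_eq (@lift_inj _ _)) eq_sym (negPf ij) mulr0.
rewrite mulmx_suml; apply: eq_bigr => j _.
by rewrite -scalemxAl mul_delta_mx.
Qed.

Lemma unit_with_row f : f != 0 -> exists2 H : M4, H \in unitmx & f = delta_mx 0 ord_max *m H.
Proof.
move=> fn0; have fr : free [tuple f] by rewrite /= seq1_free.
have [|m [c bc]] := basis_completion (U := fullv) fr; first exact: subvf.
have m3 : m = 3%N.
  have /andP [/eqP E /eqP] := bc; rewrite E dimvf size_cat size_tuple /=.
  by rewrite -[dim _]/4%N size_tuple => -[/esym].
move: c bc; rewrite {}m3 => c bc.
pose H : M4 := \matrix_(i, j) (if unlift ord_max i is Some k then tnth c k else f) 0 j.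
exists H; last by apply/rowP => j; rewrite -rowE !mxE unlift_none.
apply: unitmx_inj => a aH.
have /freeP/(_ (fun i : 'I_(1 + 3) => if split i is inr k then a 0 (lift ord_max k) else a 0 ord_max)) h
  : free [tuple of [tuple f] ++ c] by exact: basis_free bc.
have {}h : forall i : 'I_(1 + 3),
    (if split i is inr k then a 0 (lift ord_max k) else a 0 ord_max) = 0.
  apply: h; rewrite big_split_ord /= big_ord1.
  have -> : split (lshift 3 (ord0 : 'I_1)) = inl ord0 by apply: (unsplitK (inl ord0)).
  under eq_bigr => k _.
    have -> : split (rshift 1 k) = inr k by apply: (unsplitK (inr k)).
    over.
  rewrite -[RHS]aH; apply/rowP => j; rewrite [LHS]mxE [RHS]mxE [RHS]big_ord_recr addrC /=.
  congr (_ + _); last by rewrite [LHS]mxE [H _ _]mxE unlift_none.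
  rewrite summxE; apply: eq_bigr => k _.
  have -> : widen_ord (leqnSn 3) k = lift ord_max k.
    by apply: val_inj; rewrite /= /bump leqNgt ltn_ord.
  rewrite [LHS]mxE [H _ _]mxE liftK; congr (_ * _ 0 j).
  by rewrite (tnth_nth 0).
apply/rowP => i; rewrite mxE; have [k ->|->] := unliftP ord_max i.
  by have := h (rshift 1 k); rewrite (unsplitK (inr k)).
by have := h (lshift 3 (ord0 : 'I_1)); rewrite (unsplitK (inl ord0)).
Qed.

Lemma Omin3_vertex W : Omin K 4 3 W ->
  exists2 P : M4, P \in unitmx & (conj P @: W)%VS = vertex.
Proof.
move=> /Omin3_row [f fn0 Wf]; have [H Hu fE] := unit_with_row fn0.
exists H => //; apply/vspaceP => y; apply/memv_imgP/idP => [[x /Wf [u uV ->] ->]|].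
  move: uV; rewrite mem_row_ker => /eqP fu; apply/mem_vertex; exists (H *m u).
    have := congr1 (fun A : 'M_1 => A 0 0) fu; rewrite fE -mulmxA -rowE mxE.
    by move=> ->; rewrite mxE.
  by rewrite conjE fE !mulmxA mulmxK.
move=> /mem_vertex [u u3 ->]; exists (conj (invmx H) (u *m delta_mx 0 ord_max)).
  apply/Wf; exists (invmx H *m u); last by rewrite conjE invmxK fE !mulmxA.
  rewrite mem_row_ker fE -mulmxA mulKVmx // -rowE; apply/eqP/matrixP => a b.
  by rewrite !ord1 mxE u3 mxE.
by rewrite conjKV.
Qed.

Lemma vertex_orbit_singular W P : P \in unitmx -> (conj P @: W)%VS = vertex ->
  Red_sing K 4 W.
Proof.
move=> Pu E; split; first by apply/(Red_conj _ Pu); rewrite E; apply: vertex_Red.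
move=> [d [[[Z chain] _] td]].
have d12 := Red_chain_bound chain.
have := limg_tangent_dim (conj_sl Pu) (fun W => Red_conj W Pu) td.
by rewrite E => /vertex_tangent_dim; rewrite leqNgt ltnS d12.
Qed.

Lemma Omin3_singular W : Omin K 4 3 W -> Red_sing K 4 W.
Proof. by move=> /Omin3_vertex [P Pu]; apply: vertex_orbit_singular. Qed.

Lemma Omin1_transp W : Omin K 4 1 W -> Omin K 4 3 (transp K @: W)%VS.
Proof.
move=> /Omin1_col [v vn0 Wv]; exists (row_ker v^T).
  by rewrite dim_row_ker // trmx_eq0.
apply/seteqP; split=> x /=; rewrite frak_a_row_ker ?trmx_eq0 //.
  move=> /memv_imgP [y /Wv [f fV ->] ->]; exists f^T; last by rewrite transpE trmx_mul.
  by move: fV; rewrite mem_row_ker mem_col_ker -trmx_mul trmx_eq0.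
move=> [u uV ->]; apply/memv_imgP; exists (v *m u^T).
  apply/Wv; exists u^T => //.
  by move: uV; rewrite mem_row_ker mem_col_ker -[v in u^T *m v]trmxK -trmx_mul trmx_eq0.
by rewrite transpE trmx_mul trmxK.
Qed.

Lemma Omin1_singular W : Omin K 4 1 W -> Red_sing K 4 W.
Proof.
move=> /Omin1_transp W3; have [RW _] := Omin3_singular W3; have [P Pu E] := Omin3_vertex W3.
split; first exact/Red_transp.
move=> [d [[[Z chain] _] td]]; have d12 := Red_chain_bound chain.
have := limg_tangent_dim (transp_sl K) (fun W => Red_transp W) td.
move=> /(limg_tangent_dim (conj_sl Pu) (fun W => Red_conj W Pu)).
by rewrite E => /vertex_tangent_dim; rewrite leqNgt ltnS d12.
Qed.

Lemma Red_sing_Omin W : Red_sing K 4 W -> Omin K 4 1 W \/ Omin K 4 3 W.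
Proof.
move=> [RW sW]; have WG := Red_grassmannian RW; have [WU dW] := WG.
have [|[[f fn0 Wf]|[v vn0 Wv]]] := commuting_trichotomy WU dW (Red_commuting RW).
- move=> /(in_cell_chart WG) [P Pu [A E]]; case: sW.
  have Pu' : invmx P \in unitmx by rewrite unitmx_inv.
  rewrite -(conj_limgK W Pu) E; apply: Red_smooth => //.
  by rewrite -E; apply/Red_conj.
- by right; apply: Omin3_of_row WG fn0 Wf.
- by left; apply: Omin1_of_col WG vn0 Wv.
Qed.

End MinimalOrbits.

Theorem proposition22 (R : realType) :
  (Red_sing R[i] 4 = Omin R[i] 4 1 `|` Omin R[i] 4 3)%classic /\
  (Omin R[i] 4 1 `&` Omin R[i] 4 3 = set0)%classic.
Proof.
split; last exact: Omin_disjoint.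
apply/seteqP; split=> W; first exact: (@Red_sing_Omin R[i]).
by case; [exact: (@Omin1_singular R[i])|exact: (@Omin3_singular R[i])].
Qed.
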